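(* Let $K$ be a number field, let $M,n$ be positive integers with $M\ge 2$, let $A$ be a non-empty set of prime numbers $p$ in the interval $M/2\le p\le M$, let $P$ be a non-zero polynomial of $K[T]$ of degree at most $n$ having no root which is $0$ or a root of unity, and let $Q\in K[T]$ be a greatest common divisor of the polynomials $P(T^a)$ with $a\in A$. Suppose that there exists an integer $\ell$ with \[ 4\le 2\ell\le|A|\quad\text{and}\quad n\le\frac{1}{2^{\ell+1}(\ell+1)!}\binom{|A|}{\ell+2}. \] Then \[ \deg(Q)\le\frac{6\ell}{|A|}\deg(P)\quad\text{and}\quad \log H(Q)\le\frac{c}{|A|M}\big(M\deg(P)+\log H(P)\big), \] with $c=\ell\,2^{2\ell+6}$.
   Context: For a number field $K$ of degree $d=[K:\mathbb{Q}]$ and each place $v$ of $K$, the absolute value $|\cdot|_v$ is normalized to extend the usual absolute value of $\mathbb{Q}$ if $v$ is archimedean, or the $p$-adic one with $|p|_v=p^{-1}$ if $v$ lies above the prime $p$; $d_v$ is the local degree. For $F\in K[T]$, $\|F\|_v$ is the maximum of the $v$-adic absolute values of its coefficients, and the (absolute, homogeneous) height of non-zero $F$ is $H(F)=\prod_v\|F\|_v^{d_v/d}$, the product over all places $v$ of $K$. *)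

(* Defs.v *)
From HB Require Import structures.
From mathcomp Require Export all_boot all_order all_algebra all_field finmap.
From mathcomp Require Export all_classical all_reals all_analysis.

Set Implicit Arguments.
Unset Strict Implicit.
Unset Printing Implicit Defensive.

Export Order.TTheory GRing.Theory Num.Theory.
Export numFieldNormedType.Exports.

#[export] Set Implicit Arguments.
#[export] Unset Strict Implicit.
#[export] Unset Printing Implicit Defensive.

Local Open Scope classical_set_scope.
Local Open Scope ring_scope.

Definition padic_abs (R : realType) (p : nat) (q : rat) : R :=
  if q == 0 then 0
  else p%:R ^ ((logn p `|denq q|%N)%:Z - (logn p `|numq q|%N)%:Z).

Definition absolute_value (R : realType) (F : fieldType) (v : F -> R) : Prop :=
  [/\ forall x, 0 <= v x,
      forall x, v x = 0 <-> x = 0,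
      {morph v : x y / x * y} &
      forall x y, v (x + y) <= v x + v y].

Section NumberField.
Variables (R : realType) (K : fieldExtType rat).

Definition restrictQ (v : K -> R) (q : rat) : R := v (q%:A).

(* A place is represented by the unique absolute value in its class which
   restricts on Q to the usual absolute value, or to a p-adic one. *)
Definition archimedean_place (v : K -> R) : Prop :=
  absolute_value v /\ restrictQ v =1 (fun q => ratr `|q|).

Definition padic_place (p : nat) (v : K -> R) : Prop :=
  absolute_value v /\ restrictQ v =1 padic_abs R p.

Definition places : set (K -> R) :=
  [set v | archimedean_place v \/ exists2 p, prime p & padic_place p v].

End NumberField.

Arguments places R K : clear implicits.

(* The completion of F at v is the ring of v-Cauchy sequences in F modulo the
   v-null ones. *)
Definition v_cauchy (R : realType) (F : fieldType) (v : F -> R)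
    (x : nat -> F) : Prop :=
  forall e : R, 0 < e -> exists N : nat,
    forall m n : nat, (N <= m)%N -> (N <= n)%N -> v (x m - x n) < e.

Definition v_null (R : realType) (F : fieldType) (v : F -> R)
    (x : nat -> F) : Prop :=
  v (x n) @[n --> \oo] --> (0 : R).

Section Height.
Variables (R : realType) (K : fieldExtType rat).

(* The classes of the Cauchy sequences e i form a basis of the completion K_v
   over the completion Q_v of Q: they span, and they are linearly independent. *)
Definition completion_basis (v : K -> R) (n : nat) (e : 'I_n -> nat -> K) :
    Prop :=
  [/\ forall i, v_cauchy v (e i),
      forall x : nat -> K, v_cauchy v x ->
        exists2 a : 'I_n -> nat -> rat,
          forall i, v_cauchy (restrictQ v) (a i) &
          v_null v (fun k => x k - \sum_(i < n) a i k *: e i k) &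
      forall a : 'I_n -> nat -> rat,
        (forall i, v_cauchy (restrictQ v) (a i)) ->
        v_null v (fun k => \sum_(i < n) a i k *: e i k) ->
        forall i, v_null (restrictQ v) (a i)].

(* The local degree [K_v : Q_v]; at a place the default value 0 is not used,
   because K_v is finite-dimensional over Q_v. *)
Definition local_degree (v : K -> R) : nat :=
  xget 0%N [set n | exists e : 'I_n -> nat -> K, completion_basis v e].

Definition poly_norm (v : K -> R) (F : {poly K}) : R :=
  \big[Num.max/0]_(i < size F) v F`_i.

(* For F != 0 only finitely many factors differ from 1, so that the finitely
   supported product below is the product over all places. *)
Definition height (F : {poly K}) : R :=
  \big[*%R/1]_(v \in places R K)
    poly_norm v F `^ ((local_degree v)%:R / (\dim {: K})%:R).

End Height.

Arguments height R {K} F.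

Definition is_gcd (K : fieldType) (A : {fset nat}) (G : nat -> {poly K})
    (Q : {poly K}) : Prop :=
  (forall a, a \in A -> Q %| G a) /\
  (forall D : {poly K}, (forall a, a \in A -> D %| G a) -> D %| Q).

(* Roots are taken in an algebraic closure, i.e. in arbitrary finite
   extensions of K. *)
Definition no_root_0_or_unity (K : fieldType) (P : {poly K}) : Prop :=
  forall (L : fieldExtType K) (z : L), root (map_poly (in_alg L) P) z ->
    z != 0 /\ forall m : nat, (0 < m)%N -> ~~ m.-unity_root z.

Definition deg (K : fieldType) (P : {poly K}) : nat := (size P).-1.

(* Main.v *)
From HB Require Import structures.
Require Import Defs.
From mathcomp Require Import zify ring lra.
From mathcomp Require Import complex.
Local Open Scope ring_scope.

(** Let [z] run through the roots of [Q] and [w] through the roots of [P] in an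
    algebraically closed field. Every [z ^ a] with [a] in [A] is a root of [P],
    of multiplicity at least that of [z]. The core of the proof selects some of
    these edges [(z, a)] so that every [z] is on at least [|A| / 4] of them while
    every [w] is reached by at most [l + 1] of them: otherwise some non-empty
    subgraph has large degrees on both sides, and going repeatedly up to a root of
    [P] and down again to a root of [Q] one reaches more roots of [P] than [n]
    allows. Endpoints are told apart by the set of primes of [A] which were used to
    go up; the endpoint determines this set. Summing the constant [1], respectively
    [log max (1, |z|_v)], along the selected edges bounds the degree,
    respectively the local Mahler measures, of [Q] by those of [P].

    For the heights, a place [v] of [K] above a place of the rationals is the
    composite of one fixed absolute value [u] of an algebraically closed field
    with an embedding of [K], and the local degree of [v] is the number of such
    embeddings, so that heights become sums over embeddings. Since [Q] is only
    defined up to a constant, the product formula is needed; it reduces to the one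
    for the rationals via the norm. *)

(** * Powers of elements of infinite order *)

(** Write k for the number of primes. Two facts keep the walk from z going. After i ascents, i
    primes were used to go up and at most i to go down; without them at least 3k/4 - 2i remain for
    the next ascent. As a set of i + 1 primes comes from at most i + 1 pairs (smaller set, new
    prime), l + 2 ascents produce at least the product of the (3k - 8j) / (4(j + 1)) over j < l + 2
    different sets. On the other hand a descent must not undo an ascent. For each prime used so far
    at most one edge into w does, so w needs more edges than the at most l + 1 primes used: this is
    where the bound l + 1 on the selected edges comes from. Each root of Q is on k/4 selected edges
    and each root of P on at most l + 1, whence the factor 4(l + 1)/k for degrees; a power a >= M/2
    multiplies log max(1, |z|), whence a further factor 2/M for heights. Mahler measures are used
    because their logarithms are sums over roots; comparing them with coefficients costs a factor
    2^deg, and only at archimedean places. The completions of K are not built: local degrees are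
    computed with Cauchy sequences in K. *)

Section Nontorsion.
Variable L : fieldType.

Definition nontorsion (x : L) : Prop :=
  x != 0 /\ forall m, (0 < m)%N -> x ^+ m != 1.

Lemma nontorsion_expr_inj (x : L) m n :
  nontorsion x -> x ^+ m = x ^+ n -> m = n.
Proof.
case=> x0 xt; wlog le_mn : m n / (m <= n)%N => [hw e|e].
  by case/orP: (leq_total m n) => h; [exact: hw | apply/esym/hw].
apply/eqP; rewrite eqn_leq le_mn leqNgt; apply/negP => lt_mn.
have := xt (n - m)%N; rewrite subn_gt0 lt_mn => /(_ isT)/negP; apply.
apply/eqP/(@mulfI _ (x ^+ m)); first by rewrite expf_neq0.
by rewrite -exprD subnKC // mulr1.
Qed.

(* The elements having a power in common with z are pictured as points of a
   product of trees, one for each prime c, where raising to the power c moves the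
   c-th coordinate to its parent. Then [descends z c x] says that the c-th
   coordinate of x is that of z or a descendant of it. *)
Definition descends (z : L) (c : nat) (x : L) : Prop :=
  exists N j N', [/\ ~~ (c %| N)%N, ~~ (c %| N')%N &
    x ^+ (N * c ^ j) = z ^+ N'].

(** With [descends_root]: an exponent prime to [c] does not move the [c]-th coordinate, whether one
    goes up or down. It is absorbed by [N] or by [N']. *)
Lemma descends_expr (z : L) c a x : prime c -> ~~ (c %| a)%N ->
  descends z c (x ^+ a) -> descends z c x.
Proof.
move=> pc ca [N [j [N' [hN hN' e]]]]; exists (a * N)%N, j, N'; split=> //.
  by rewrite Euclid_dvdM // negb_or ca.
by rewrite -e -exprM; congr (_ ^+ _); rewrite mulnA.
Qed.

Lemma descends_root (z : L) c b y : prime c -> ~~ (c %| b)%N ->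
  descends z c y -> descends z c (y ^+ b).
Proof.
move=> pc cb [N [j [N' [hN hN' e]]]]; exists N, j, (b * N')%N; split=> //.
  by rewrite Euclid_dvdM // negb_or cb.
by rewrite -exprM mulnC exprM e -exprM mulnC.
Qed.

Lemma descends_intro (z : L) c x m n : prime c -> (0 < m)%N ->
  ~~ (c %| n)%N -> x ^+ m = z ^+ n -> descends z c x.
Proof.
move=> pc m0 cn e; exists (m`_c^')%N, (logn c m), n; split=> //.
  by rewrite -p'natE ?part_pnat.
by rewrite -e -p_part mulnC partnC.
Qed.

(** The relation places the [c]-th coordinate of [x] at that of [z] or above it, so that of [x ^+ c]
    is strictly above. Otherwise, comparing exponents of the nontorsion [z], [c] would divide
    [N' * m]. *)
Lemma not_descends_up (z : L) c x m n : prime c -> nontorsion z ->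
  ~~ (c %| m)%N -> x ^+ m = z ^+ n -> ~ descends z c (x ^+ c).
Proof.
move=> pc zt cm e [N [j [N' [hN hN' e']]]].
have : (N' * m = c * (N * c ^ j) * n)%N.
  apply: (nontorsion_expr_inj zt); rewrite exprM -e' -!exprM.
  by rewrite mulnA mulnC exprM e -exprM mulnC.
move/(congr1 (dvdn c)); rewrite Euclid_dvdM // (negPf hN') (negPf cm).
by rewrite -mulnA dvdn_mulr.
Qed.

(** Below a point which is not on the side of [z], only one child in direction [c] leads to [z]. The
    quotient of two such children is killed by [c] and, after a comparison of exponents, also by a
    number prime to [c]. *)
Lemma descends_child_unique (z : L) c y y' : prime c -> nontorsion z ->
  y ^+ c = y' ^+ c -> ~ descends z c (y ^+ c) ->
  descends z c y -> descends z c y' -> y = y'.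
Proof.
move=> pc zt eyy ndy [N [j [N1 [hN hN1 e]]]] [N' [j' [N1' [hN' hN1' e']]]].
have c0 := prime_gt0 pc.
(* A positive [j] would make [y ^+ c] itself descend, so [j = 0]. *)
have {e}e : y ^+ N = z ^+ N1.
  case: j e => [|j] e; first by rewrite expn0 muln1 in e.
  case: ndy; exists N, j, N1; split=> //.
  by rewrite -exprM -e expnS; congr (_ ^+ _); rewrite mulnCA.
have {e'}e' : y' ^+ N' = z ^+ N1'.
  case: j' e' => [|j'] e'; first by rewrite expn0 muln1 in e'.
  case: ndy; rewrite eyy; exists N', j', N1'; split=> //.
  by rewrite -exprM -e' expnS; congr (_ ^+ _); rewrite mulnCA.
have N0 : (0 < N)%N by case: (N) hN => //; rewrite dvdn0.
have N10 : (0 < N1)%N by case: (N1) hN1 => //; rewrite dvdn0.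
have z0 : z != 0 by case: zt.
have y0 : y != 0.
  by have : y ^+ N != 0; [rewrite e expf_neq0 | rewrite expf_eq0 N0].
have y'0 : y' != 0.
  by have : y' ^+ c != 0; [rewrite -eyy expf_neq0 | rewrite expf_eq0 c0].
have yt : nontorsion y.
  split=> // m m0; apply/negP => /eqP ym; case: zt => _ /(_ (N1 * m)%N).
  rewrite muln_gt0 N10 m0 => /(_ isT) /negP; apply; apply/eqP.
  by rewrite exprM -e -exprM mulnC exprM ym expr1n.
(* With either exponent multiplied by [c], the power of [y] is [z ^+ (c * N1 * N1')]. *)
have eN : (N * N1' = N' * N1)%N.
  have : y ^+ (c * (N * N1')) = y ^+ (c * (N' * N1)).
    rewrite [in RHS]exprM eyy -[in RHS]exprM mulnCA (exprM _ N) e -exprM.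
    rewrite (_ : (c * (N' * N1) = N' * (c * N1)))%N; last by rewrite mulnCA.
    rewrite (exprM _ N') e' -exprM; congr (_ ^+ _); ring.
  by move/(nontorsion_expr_inj yt)/eqP; rewrite eqn_pmul2l // => /eqP.
have : (y / y') ^+ (N * N1') = 1.
  rewrite expr_div_n {2}eN !exprM e e' -!exprM mulnC divff //.
  by rewrite expf_neq0.
have : (y / y') ^+ c = 1 by rewrite expr_div_n eyy divff // expf_neq0.
move=> h1 h2.
have cop : coprime c (N * N1').
  by rewrite prime_coprime // Euclid_dvdM // negb_or hN.
case: (egcdnP (N * N1') c0) => km kn; rewrite (eqP cop) => ek _.
apply/(@mulIf _ y'^-1); first by rewrite invr_eq0.
rewrite divff // -[LHS]expr1; move: ek; rewrite [(km * c)%N]mulnC [(kn * _)%N]mulnC.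
move/(congr1 (fun m => (y / y') ^+ m)); rewrite exprM h1 expr1n exprD exprM h2.
by rewrite expr1n mul1r.
Qed.

End Nontorsion.

Lemma sum_pred_le1 (T : eqType) (s : seq T) (P : pred T) : uniq s ->
  (forall x y, x \in s -> y \in s -> P x -> P y -> x = y) ->
  (\sum_(x <- s) P x <= 1)%N.
Proof.
move=> us h; rewrite -big_mkcond /= sum1_count -size_filter leqNgt.
case e: [seq x <- s | P x] => [|x [|y t]] //=.
have := filter_uniq P us; rewrite e /= inE negb_or => /andP[/andP[/eqP xy _] _].
have inP z : z \in [:: x, y & t] -> z \in s /\ P z.
  by rewrite -e mem_filter => /andP[].
have [xs Px] := inP x (mem_head _ _); have [|ys Py] := inP y; first by rewrite !inE eqxx orbT.
by case: xy; apply: h.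
Qed.

(** * Walks between roots and the size of a dense subgraph *)

Section DenseSubgraph.
Variables (L : fieldType) (k : nat) (p : 'I_k -> nat).
Hypothesis p_prime : forall i, prime (p i).
Hypothesis p_inj : injective p.

Local Notation up z c := (z ^+ p c).

Definition out_degree (W : seq L) (z : L) : nat := #|[set c | up z c \in W]|.

Definition in_degree (E : L -> 'I_k -> bool) (Z : seq L) (w : L) : nat :=
  (\sum_(z <- Z) \sum_(c : 'I_k) (E z c && (up z c == w)))%N.

(** At the endpoint of a walk from [z] this is the set of primes used upwards. It depends on [z] and
    [x] only, so that different sets have different endpoints. *)
Definition signature (z x : L) : {set 'I_k} :=
  [set c | ~~ `[< descends z (p c) x >]].

(** A walk is remembered only through the relation between powers which it produces. The primes of
    [bs], used downwards, may repeat. At a vertex of [W] there were fewer descents than ascents;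
    [based] allows one more, for the return to [Z]. *)
Definition reached (W : seq L) (z : L) (s : {set 'I_k}) : Prop :=
  exists w bs, [/\ w \in W, (size bs < #|s|)%N,
    w ^+ (\prod_(b <- bs) p b)%N = z ^+ (\prod_(c in s) p c)%N &
    signature z w = s].

Definition based (Z : seq L) (z : L) (s : {set 'I_k}) : Prop :=
  exists y bs, [/\ y \in Z, (size bs <= #|s|)%N,
    y ^+ (\prod_(b <- bs) p b)%N = z ^+ (\prod_(c in s) p c)%N &
    signature z y = s].

Lemma dvdn_prime_prod (c : 'I_k) (I : Type) (r : seq I) (P : pred I)
    (f : I -> 'I_k) :
  (p c %| \prod_(i <- r | P i) p (f i))%N -> has (fun i => P i && (f i == c)) r.
Proof.
elim: r => [|i r IH] /=; first by rewrite big_nil dvdn1 => /eqP h;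
  have := prime_gt1 (p_prime c); rewrite h.
rewrite big_cons; case: ifP => Pi; last by move=> /IH ->; rewrite orbT.
rewrite Euclid_dvdM // => /orP[|/IH ->]; last by rewrite orbT.
by rewrite dvdn_prime2 // => /eqP/p_inj ->; rewrite eqxx.
Qed.

Lemma dvdn_prime_prod_set (c : 'I_k) (s : {set 'I_k}) :
  (p c %| \prod_(i in s) p i)%N = (c \in s).
Proof.
apply/idP/idP => [|cs]; last by rewrite (bigD1 c) //= dvdn_mulr.
by move/dvdn_prime_prod/hasP => [i _ /andP[h /eqP <-]].
Qed.

Lemma dvdn_prime_prod_seq (c : 'I_k) (bs : seq 'I_k) :
  (p c %| \prod_(b <- bs) p b)%N -> c \in bs.
Proof. by move/dvdn_prime_prod/hasP => [i h /eqP <-]. Qed.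

Lemma prod_primes_gt0 (bs : seq 'I_k) : (0 < \prod_(b <- bs) p b)%N.
Proof. by apply: prodn_gt0 => i; exact: prime_gt0. Qed.

Lemma p_ndvd (c d : 'I_k) : c != d -> ~~ (p c %| p d)%N.
Proof.
by move=> cd; rewrite dvdn_prime2 //; apply: contraNN cd => /eqP/p_inj ->.
Qed.

(** Since [a] is not in [bs], [not_descends_up] applies to the [a]-th coordinate; the others do not
    move. *)
Lemma signature_up (z y : L) (s : {set 'I_k}) bs (a : 'I_k) :
  nontorsion z -> y ^+ (\prod_(b <- bs) p b)%N = z ^+ (\prod_(c in s) p c)%N ->
  signature z y = s -> a \notin s -> a \notin bs ->
  signature z (up y a) = a |: s.
Proof.
move=> zt e sy as_ abs; apply/setP => c; rewrite !inE.
have [->|ca] /= := eqVneq c a.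
  apply/asboolPn; apply: (not_descends_up (p_prime a) zt _ e).
  by apply: contra abs => /dvdn_prime_prod_seq.
rewrite -sy inE; congr (~~ _); apply/asboolP/asboolP.
  by apply: descends_expr => //; exact: p_ndvd.
by apply: descends_root => //; exact: p_ndvd.
Qed.

Section Dense.
Variables (Z W : seq L) (l : nat).
Hypothesis Zuniq : uniq Z.
Hypothesis Znt : forall z, z \in Z -> nontorsion z.
Hypothesis denseZ : forall z, z \in Z -> (3 * k <= 4 * out_degree W z)%N.
Hypothesis denseW : forall w, w \in W ->
  (l.+2 <= in_degree (fun _ _ => true) Z w)%N.

(** A descent along [c] spoils the signature only if [c] is in [s] and the descent leads back to the
    branch of [z]. By [descends_child_unique] at most one edge into [w] does so for each [c] in [s],
    whereas [w] has at least [l + 2 > #|s|] edges. *)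
Lemma reached_down (z : L) (s : {set 'I_k}) : z \in Z -> (#|s| <= l.+1)%N -> reached W z s ->
  based Z z s.
Proof.
move=> zZ sl [w [bs [wW bss e sw]]]; have zt := Znt zZ.
have [[y [c [yZ yc gd]]]|nogood] := pselect (exists y c, [/\ y \in Z, up y c = w
    & c \in s -> ~ descends z (p c) y]).
  have ey : y ^+ (\prod_(b <- c :: bs) p b)%N = z ^+ (\prod_(c in s) p c)%N.
    by rewrite big_cons exprM yc.
  exists y, (c :: bs); split=> //.
  (* Outside [s], the exponent of [z] in [ey] is prime to [p d], so [y] descends there. In [s], a
     coordinate other than [c] is not moved by the step from [w] to [y]. *)
  apply/setP => d; rewrite inE; case ds: (d \in s); last first.
    apply/negbF/asboolP; apply: (descends_intro _ _ _ ey) => //.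
      exact: prod_primes_gt0.
    by rewrite dvdn_prime_prod_set ds.
  apply/asboolPn; have [cd|dc] := eqVneq c d; first by rewrite -cd; apply: gd; rewrite cd.
  move: ds; rewrite -sw inE => /asboolPn; apply: contra_not.
  rewrite -yc; apply: descends_root => //; apply: p_ndvd.
  by rewrite eq_sym.
have bad y c : y \in Z -> up y c = w -> c \in s /\ descends z (p c) y.
  move=> yZ yc; split; apply: contrapT => h; apply: nogood; exists y, c; split=> //.
exfalso; have := denseW wW; rewrite leqNgt => /negP; apply.
rewrite ltnS (leq_trans _ sl) // /in_degree exchange_big /=.
rewrite -sum1_card [leqRHS]big_mkcond /=; apply: leq_sum => c _.
case: ifP => cs; last first.
  rewrite big1_seq // => y /andP[_ yZ].
  by case: eqP => // /(bad _ _ yZ) []; rewrite cs.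
apply: sum_pred_le1 => // y y' yZ y'Z /eqP ey /eqP ey'.
have [_ dy] := bad _ _ yZ ey; have [_ dy'] := bad _ _ y'Z ey'.
apply: (descends_child_unique (p_prime c) zt) => //; first by rewrite ey ey'.
by rewrite ey; move: cs; rewrite -sw inE => /asboolPn.
Qed.

Lemma based0 (z : L) : z \in Z -> based Z z finset.set0.
Proof.
move=> zZ; exists z, [::]; split=> //; first by rewrite big_nil big_set0.
apply/setP => c; rewrite !inE; apply/negbF/asboolP.
apply: (@descends_intro _ _ _ _ 1 1) => //.
by rewrite dvdn1; apply/eqP => h; have := prime_gt1 (p_prime c); rewrite h.
Qed.

(** From the at least [3 * k / 4] edges at [y], those with a prime in [s] or in [bs] are discarded,
    at most [2 * #|s|] in number. *)
Lemma based_up (z : L) (s : {set 'I_k}) : z \in Z -> based Z z s ->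
  exists F : {set 'I_k}, (3 * k <= 4 * #|F| + 8 * #|s|)%N /\
    forall a, a \in F -> a \notin s /\ reached W z (a |: s).
Proof.
move=> zZ [y [bs [yZ sbs e sy]]]; have zt := Znt zZ.
exists ([set c | up y c \in W] :\: (s :|: [set b in bs])); split.
  have h1 := denseZ yZ; rewrite /out_degree in h1.
  have h2 := leq_of_leqif (leq_card_setU s [set b in bs]).
  have h3 : (#|[set b in bs]| <= size bs)%N by rewrite cardsE card_size.
  have h4 := cardsD [set c | up y c \in W] (s :|: [set b in bs]).
  have h5 := subset_leq_card (finset.subsetIr [set c | up y c \in W] (s :|: [set b in bs])).
  have aux (o u t b sb i d : nat) : (3 * k <= 4 * o -> u <= t + b -> b <= sb ->
      sb <= t -> d = o - i -> i <= u -> 3 * k <= 4 * d + 8 * t)%N by lia.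
  exact: aux h1 h2 h3 sbs h4 h5.
move=> a; rewrite !inE negb_or => /andP[/andP[as_ abs] yaW]; split=> //.
exists (up y a), bs; split=> //.
- by rewrite cardsU1 as_ ltnS.
- by rewrite -exprM mulnC exprM e -exprM big_setU1 //= mulnC.
- exact: signature_up e sy as_ abs.
Qed.

Definition based_sets (z : L) i := [set s : {set 'I_k} | (#|s| == i) && `[< based Z z s >]].
Definition reached_sets (z : L) i := [set s : {set 'I_k} | (#|s| == i) && `[< reached W z s >]].

(** Double counting. The map from [(s, a)] to [(a |: s, a)] is injective because [a] is not in [s],
    and its image lies over sets of [i + 1] elements, each with [i + 1] choices of [a]. *)
Lemma reached_sets_growth (z : L) i : z \in Z ->
  (#|based_sets z i| * (3 * k - 8 * i) <= 4 * (i.+1 * #|reached_sets z i.+1|))%N.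
Proof.
move=> zZ.
have /choice[F hF] : forall s : {set 'I_k}, exists F : {set 'I_k}, based Z z s ->
    (3 * k <= 4 * #|F| + 8 * #|s|)%N /\
    forall a, a \in F -> a \notin s /\ reached W z (a |: s).
  move=> s; have [/(based_up zZ)[F hF]|h] := pselect (based Z z s); first by exists F.
  by exists finset.set0.
pose S1 := [set x : {set 'I_k} * 'I_k | (x.1 \in based_sets z i) && (x.2 \in F x.1)].
pose S2 := [set x : {set 'I_k} * 'I_k | (x.1 \in reached_sets z i.+1) && (x.2 \in x.1)].
pose f (x : {set 'I_k} * 'I_k) := (x.2 |: x.1, x.2).
have S1P s a : (s, a) \in S1 -> [/\ #|s| = i, based Z z s, a \in F s & a \notin s].
  rewrite !inE /= => /andP[/andP[/eqP si /asboolP bs] aF].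
  by split=> //; case: (hF s bs) => _ /(_ a aF) [].
have le12 : (#|S1| <= #|S2|)%N.
  rewrite -(@card_in_imset _ _ f S1); last first.
    move=> [s a] [s' a'] /S1P[_ _ _ as_] /S1P[_ _ _ as'] [e1 e2].
    rewrite -e2 in e1 as' *; congr (_, _).
    by rewrite -(setU1K as_) e1 setU1K.
  apply: subset_leq_card; apply/fintype.subsetP => _ /imsetP[[s a] /S1P[si bs aF as_] ->].
  rewrite !inE /= eqxx /= cardsU1 as_ si eqxx /=; case: (hF s bs) => _ /(_ a aF) [_ h].
  by rewrite andbT; apply/asboolP.
have card_dep (B : {set {set 'I_k}}) (G : {set 'I_k} -> {set 'I_k}) :
    #|[set x : {set 'I_k} * 'I_k | (x.1 \in B) && (x.2 \in G x.1)]| =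
    (\sum_(s in B) #|G s|)%N.
  rewrite -sum1_card (eq_bigl (fun x => (x.1 \in B) && (x.2 \in G x.1))); last first.
    by move=> x; rewrite inE.
  rewrite -(pair_big_dep (mem B) (fun s a => a \in G s) (fun _ _ => 1%N)) /=.
  by apply: eq_bigr => s _; rewrite sum1_card.
have c1 : (#|based_sets z i| * (3 * k - 8 * i) <= 4 * #|S1|)%N.
  rewrite /S1 card_dep big_distrr /= -sum_nat_const; apply: leq_sum => s.
  rewrite inE => /andP[/eqP si /asboolP bs]; case: (hF s bs) => h _.
  by rewrite leq_subLR -si addnC.
have c2 : #|S2| = (i.+1 * #|reached_sets z i.+1|)%N.
  rewrite /S2 (card_dep _ id) mulnC -sum_nat_const; apply: eq_bigr => s.
  by rewrite inE => /andP[/eqP].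
by rewrite -c2 (leq_trans c1) // leq_mul2l.
Qed.

Lemma reached_sets_card (z : L) i : z \in Z -> (i <= l.+1)%N ->
  (\prod_(j < i.+1) (3 * k - 8 * j) <= 4 ^ i.+1 * (i.+1)`! * #|reached_sets z i.+1|)%N.
Proof.
move=> zZ; elim: i => [|i IH] il.
  rewrite big_ord_recl big_ord0 muln1 /= expn1 (_ : 1`! = 1)%N // muln1.
  have := reached_sets_growth 0 zZ; rewrite mul1n.
  suff -> : #|based_sets z 0| = 1%N by rewrite mul1n.
  rewrite -(cards1 (@finset.set0 'I_k)); congr #|pred_of_set _|; apply/setP => s.
  rewrite !inE cards_eq0; apply/andP/eqP => [[/eqP //]|->]; split=> //.
  exact/asboolP/based0.
rewrite big_ord_recr /=; have {}IH := IH (ltnW il).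
have h1 := reached_sets_growth i.+1 zZ.
have h2 : (#|reached_sets z i.+1| <= #|based_sets z i.+1|)%N.
  apply: subset_leq_card; apply/fintype.subsetP => s; rewrite !inE.
  move=> /andP[/eqP si /asboolP rs]; rewrite si eqxx /=; apply/asboolP.
  by apply: reached_down => //; rewrite si.
have h3 : (#|reached_sets z i.+1| * (3 * k - 8 * i.+1) <=
   4 * (i.+2 * #|reached_sets z i.+2|))%N.
  by rewrite (leq_trans _ h1) // leq_mul2r h2 orbT.
rewrite (leq_trans (leq_mul IH (leqnn _))) // -mulnA.
rewrite (leq_trans (leq_mul (leqnn _) h3)) // (expnS 4 i.+1) (factS i.+1).
by apply/eq_leq; ring.
Qed.

Lemma reached_sets_le_size (z : L) i : (#|reached_sets z i| <= size W)%N.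
Proof.
have h : {subset reached_sets z i <= [seq signature z w | w <- W]}.
  move=> s; rewrite inE => /andP[_ /asboolP[w [bs [wW _ _ <-]]]].
  exact: map_f.
rewrite -(size_map (signature z) W) cardE; apply: uniq_leq_size; first exact: enum_uniq.
by move=> s; rewrite mem_enum; exact: h.
Qed.

Lemma dense_size (z : L) : z \in Z ->
  (\prod_(j < l.+2) (3 * k - 8 * j) <= 4 ^ l.+2 * (l.+2)`! * size W)%N.
Proof.
move=> zZ; apply: leq_trans (reached_sets_card zZ (leqnn _)) _.
by rewrite leq_mul2l reached_sets_le_size orbT.
Qed.
End Dense.

(* Vertices of small degree are deleted one after the other; the edges lost when
   some w in W is deleted are the ones which are selected. *)
Lemma deletion (Z W : seq L) (l : nat) : uniq Z -> uniq W ->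
  (forall Z' W' : seq L, uniq Z' -> uniq W' ->
    {subset Z' <= Z} -> {subset W' <= W} ->
    (forall z, z \in Z' -> (3 * k <= 4 * out_degree W' z)%N) ->
    (forall w, w \in W' -> (l.+2 <= in_degree (fun _ _ => true) Z' w)%N) ->
    Z' = [::]) ->
  exists E : L -> 'I_k -> bool,
    [/\ forall z c, E z c -> up z c \in W,
        forall w, (in_degree E Z w <= l.+1)%N &
        forall z, z \in Z ->
          (k <= 4 * (#|[set c | E z c]| + #|[set c | up z c \notin W]|))%N].
Proof.
move: {2}(size Z + size W)%N (leqnn (size Z + size W)) => m.
elim: m Z W => [|m IH] Z W szm uZ uW nodense.
  case: Z W szm {uZ uW nodense} => [|//] [|//] _.
  by exists (fun _ _ => false); split=> // w; rewrite /in_degree big_nil.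
have [[z [zZ zd]]|h1] :=
    pselect (exists z, z \in Z /\ (4 * out_degree W z < 3 * k)%N).
  have [||||E [EW EZ Ek]] := IH (rem z Z) W.
  - by move: (size_rem zZ) szm; case: (Z) zZ => //= a t _ ->; rewrite addSn ltnS.
  - exact: rem_uniq.
  - by [].
  - by move=> Z' W' uZ' uW' sZ sW; apply: nodense => // x /sZ /mem_rem.
  exists (fun y c => (y != z) && E y c); split.
  - by move=> y c /andP[_ /EW].
  - move=> w; rewrite (leq_trans _ (EZ w)) // /in_degree (big_rem z) //=.
    rewrite [X in (X + _)%N]big1 ?add0n; last by move=> c _; rewrite eqxx.
    by apply: leq_sum => y _; apply: leq_sum => c _; case: (y != z).
  - move=> y yZ; have [->|yz] /= := eqVneq y z; last first.
      by apply: Ek; rewrite (mem_rem_uniq _ uZ) !inE yz.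
    (* Fewer than three quarters of the edges at [z] remain, so more than [k / 4] end outside [W].
       In the recursion these are the edges selected when their endpoints were deleted. *)
    have := cardsC [set c | up z c \in W]; rewrite card_ord.
    rewrite (_ : ~: _ = [set c | up z c \notin W]); last by apply/setP => c; rewrite !inE.
    have aux (o e b : nat) : (4 * o < 3 * k -> o + b = k -> k <= 4 * (e + b))%N by lia.
    exact: aux zd.
have [[w [wW wd]]|h2] :=
    pselect (exists w, w \in W /\ (in_degree (fun _ _ => true) Z w <= l.+1)%N).
  have [||||E [EW EZ Ek]] := IH Z (rem w W).
  - by move: (size_rem wW) szm; case: (W) wW => //= a t _ ->; rewrite addnS ltnS.
  - by [].
  - exact: rem_uniq.
  - by move=> Z' W' uZ' uW' sZ sW; apply: nodense => // x /sW /mem_rem.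
  have Ew y c : up y c = w -> E y c = false.
    by move=> ey; apply/negP => /EW; rewrite ey mem_rem_uniq // !inE eqxx.
  (* The edges into [w] count as leaving [rem w W] in the induction hypothesis and as selected now;
     the sum in the last clause stays the same. *)
  exists (fun y c => (up y c == w) || E y c); split.
  - by move=> y c /orP[/eqP -> //|/EW /mem_rem].
  - move=> x; have [->|xw] := eqVneq x w.
      rewrite (leq_trans _ wd) //; apply: leq_sum => y _; apply: leq_sum => c _.
      by case: (up y c == w); rewrite ?andbF ?orbT.
    rewrite (leq_trans _ (EZ x)) //; apply: leq_sum => y _; apply: leq_sum => c _.
    case: eqP => [->|_] /=; last by [].
    by rewrite eq_sym (negPf xw) andbF.
  - move=> z zZ; have := Ek z zZ.
    have -> : [set c | (up z c == w) || E z c] =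
        [set c | up z c == w] :|: [set c | E z c] by apply/setP => c; rewrite !inE.
    have -> : [set c | up z c \notin rem w W] =
        [set c | up z c == w] :|: [set c | up z c \notin W].
      by apply/setP => c; rewrite !inE mem_rem_uniq // !inE negb_and negbK.
    rewrite !cardsU.
    have -> : [set c | up z c == w] :&: [set c | E z c] = finset.set0.
      by apply/setP => c; rewrite !inE; case: eqP => // /Ew ->.
    rewrite cards0; have := subn0 (#|[set c | up z c == w]| + #|[set c | E z c]|).
    have aux (a b c d : nat) : (k <= 4 * (b + (a + c - d)) -> k <= 4 * (a + b - 0 + c))%N by lia.
    by move=> _; apply: aux.
have Z0 : Z = [::].
  apply: (nodense Z W) => // [z zZ|w wW]; rewrite leqNgt; apply/negP => h.
    by apply: h1; exists z.
  by apply: h2; exists w.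
by exists (fun _ _ => false); rewrite Z0; split=> // w; rewrite /in_degree big_nil.
Qed.

(** From [l] to [l + 1] the left side grows by [N / D], at most
    [4 * (4/3) * (4/3) * (11/8) = 704/72 < 10], and the right side by [2 * (l + 3)], at least 10. *)
Lemma binomial_small (l : nat) : (2 <= l)%N ->
  ('C(4 * l + 2, l.+1) < l.+2 * (2 ^ l.+1 * (l.+1)`!))%N.
Proof.
elim: l => // l IH; rewrite leq_eqVlt => /orP[/eqP <- //|]; rewrite ltnS => l2.
have {}IH := IH l2.
set a := 'C(4 * l + 2, l.+1) in IH; set b := 'C(_, _).
set X := (2 ^ l.+1 * (l.+1)`!)%N in IH.
have ea : (a * ((l.+1)`! * (3 * l + 1)`!) = (4 * l + 2)`!)%N.
  by rewrite /a -(@bin_fact (4 * l + 2) l.+1); [congr (_ * (_ * _`!))%N|]; lia.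
have eb : (b * ((l.+2)`! * (3 * l + 4)`!) = (4 * l + 6)`!)%N.
  rewrite /b (_ : (4 * l.+1 + 2 = 4 * l + 6)%N); last by lia.
  by rewrite -(@bin_fact (4 * l + 6) l.+2); [congr (_ * (_ * _`!))%N|]; lia.
have f3 : ((3 * l + 4)`! = (3 * l + 4) * (3 * l + 3) * (3 * l + 2) * (3 * l + 1)`!)%N.
  by rewrite !addnS !addn0 !factS; ring.
have f4 : ((4 * l + 6)`! = (4 * l + 6) * (4 * l + 5) * (4 * l + 4) * (4 * l + 3) *
    (4 * l + 2)`!)%N.
  by rewrite !addnS !addn0 !factS; ring.
pose D := (l.+2 * ((3 * l + 4) * (3 * l + 3) * (3 * l + 2)))%N.
pose N := ((4 * l + 6) * (4 * l + 5) * (4 * l + 4) * (4 * l + 3))%N.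
have e : (b * D = a * N)%N.
  apply/eqP; rewrite -(@eqn_pmul2r ((l.+1)`! * (3 * l + 1)`!)); last first.
    by rewrite muln_gt0 !fact_gt0.
  have -> : (a * N * ((l.+1)`! * (3 * l + 1)`!) = (4 * l + 6)`!)%N.
    by rewrite f4 -ea /N; ring.
  by rewrite -eb f3 (factS l.+1) /D; apply/eqP; ring.
have ND : (N * 72 <= 704 * D)%N.
  have h1 : (4 * l + 6 <= 4 * l.+2)%N by lia.
  have h2 : (3 * (4 * l + 5) <= 4 * (3 * l + 4))%N by lia.
  have h3 : (3 * (4 * l + 4) <= 4 * (3 * l + 3))%N by lia.
  have h4 : (8 * (4 * l + 3) <= 11 * (3 * l + 2))%N by lia.
  have := leq_mul (leq_mul h1 h2) (leq_mul h3 h4).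
  by rewrite /N /D; lia.
have D0 : (0 < D)%N by rewrite /D; lia.
have D72 : (0 < D * 72)%N by rewrite muln_gt0 D0.
rewrite expnS (factS l.+1) -(ltn_pmul2r D72).
rewrite mulnA e.
have lt1 : (a * (N * 72) < l.+2 * X * (704 * D))%N.
  rewrite (leq_ltn_trans (leq_mul (leqnn a) ND)) // ltn_pmul2r //.
  by rewrite muln_gt0 D0.
rewrite -mulnA (leq_trans lt1) //.
rewrite (_ : (l.+3 * _ * _ = (l.+2 * X) * (2 * l.+3 * 72 * D))%N); last by rewrite /X; ring.
by rewrite leq_mul2l; apply/orP; right; rewrite leq_mul2r; apply/orP; right; lia.
Qed.

(** For small [k] the truncated factors [3 * k - 8 * j] may vanish and the count of sets says
    nothing. Here the size hypothesis of [sparse_edges] alone forces [size W < k]. *)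
Lemma binomial_lt_small (l : nat) : (2 <= l)%N -> (0 < k)%N -> (k < 4 * l.+1)%N ->
  ('C(k, l.+2) < k * (2 ^ l.+1 * (l.+1)`!))%N.
Proof.
move=> l2 k0 kl; rewrite -(@ltn_pmul2l l.+2) // -mul_bin_diag mulnCA ltn_pmul2l //.
apply: leq_ltn_trans (binomial_small l2); apply: leq_bin2l; lia.
Qed.

(** A non-empty dense subgraph would have more vertices in [W] than the binomial bound permits. In
    the induction [3 * k - 8 * i.+1 >= k] because [k >= 4 * l.+1]; the case [i = 2] is a cubic
    inequality for [k >= 12]. *)
Lemma dense_product_lt (l : nat) : (2 <= l)%N -> (4 * l.+1 <= k)%N ->
  (4 ^ l.+2 * k ^_ l.+2 < (\prod_(j < l.+2) (3 * k - 8 * j)) * (2 ^ l.+1 * (l.+1)`!))%N.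
Proof.
move=> l2 kl.
suff h i : (2 <= i)%N -> (i <= l.+1)%N -> (4 ^ i.+1 * k ^_ i.+1 <
    (\prod_(j < i.+1) (3 * k - 8 * j)) * (2 ^ i * i`!))%N.
  by apply: h => //; exact: ltnW.
elim: i => // i IH; rewrite leq_eqVlt => /orP[/eqP [<-] _|].
  rewrite !big_ord_recr big_ord0 /= !ffactnSr ffactn0 /= /bump /=.
  have -> : (2`! = 2)%N by [].
  have [q ->] : exists q, k = (q + 12)%N by exists (k - 12)%N; lia.
  rewrite !subn0 ?muln0 ?muln1 ?mul1n ?subn0.
  rewrite (_ : (q + 12 - 1 = q + 11)%N); last by lia.
  rewrite (_ : (q + 12 - 2 = q + 10)%N); last by lia.
  rewrite (_ : (3 * (q + 12) - 8 = 3 * q + 28)%N); last by lia.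
  rewrite (_ : (3 * (q + 12) - 8 * 2 = 3 * q + 20)%N); last by lia.
  nia.
rewrite ltnS => i2 il; have {}IH := IH i2 (ltnW il).
rewrite big_ord_recr /= (factS i) (expnS 2) (expnS 4) (ffactnSr k i.+1).
have h : (4 * (k - i.+1) <= (3 * k - 8 * i.+1) * (2 * i.+1))%N by nia.
have h0 : (0 < 4 * (k - i.+1))%N by lia.
set P := (\prod_(_ < _) _)%N in IH *; set X := (2 ^ i * i`!)%N in IH.
rewrite (_ : (_ * _ * _ = (4 ^ i.+1 * k ^_ i.+1) * (4 * (k - i.+1)))%N); last by ring.
rewrite (_ : (P * _ * _ = (P * X) * ((3 * k - 8 * i.+1) * (2 * i.+1)))%N); last first.
  by rewrite /X; ring.
by apply: leq_trans (leq_mul (leqnn _) h); rewrite ltn_pmul2r.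
Qed.

Lemma sparse_edges (Z W : seq L) (l : nat) : uniq Z -> uniq W ->
  (forall z, z \in Z -> nontorsion z) ->
  (forall z c, z \in Z -> up z c \in W) ->
  (2 <= l)%N -> (0 < k)%N ->
  (size W * (2 ^ l.+1 * (l.+1)`!) <= 'C(k, l.+2))%N ->
  exists E : L -> 'I_k -> bool,
    (forall w, (in_degree E Z w <= l.+1)%N) /\
    (forall z, z \in Z -> (k <= 4 * #|[set c | E z c]|)%N).
Proof.
move=> uZ uW Znt ZW l2 k0 hW.
have X0 : (0 < 2 ^ l.+1 * (l.+1)`!)%N by rewrite muln_gt0 expn_gt0 fact_gt0.
have [kl|kl] := ltnP k (4 * l.+1).
  case: Z => [|z Z'] in uZ Znt ZW *.
    by exists (fun _ _ => false); split=> // w; rewrite /in_degree big_nil.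
  exfalso; have zZ := mem_head z Z'.
  (* The [k] powers of one nontorsion [z] are distinct elements of [W]. *)
  have kW : (k <= size W)%N.
    rewrite -[k in (k <= _)%N]card_ord cardE -(size_map (fun c => up z c)).
    apply: uniq_leq_size; last by move=> _ /mapP[c _ ->]; exact: ZW.
    rewrite map_inj_uniq ?enum_uniq // => c d /(nontorsion_expr_inj (Znt _ zZ)).
    exact: p_inj.
  have := binomial_lt_small l2 k0 kl; rewrite ltnNge => /negP; apply.
  by apply: leq_trans hW; rewrite leq_mul2r kW orbT.
have [||Z' W' uZ' uW' sZ sW hZ' hW'|E [_ EW EZ]] := deletion (Z := Z) (W := W) (l := l) => //.
  case: Z' => [//|z Z'] in uZ' sZ hZ' hW' *; exfalso.
  have := dense_size uZ' (fun y h => Znt y (sZ y h)) hZ' hW' (mem_head _ _).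
  move=> h; have := dense_product_lt l2 kl; rewrite ltnNge => /negP; apply.
  apply: leq_trans (leq_mul h (leqnn _)) _.
  have hs := uniq_leq_size uW' sW.
  rewrite -bin_ffact (_ : (_ * _ * _ = 4 ^ l.+2 * (l.+2)`! *
    (size W' * (2 ^ l.+1 * (l.+1)`!)))%N); last by ring.
  rewrite (_ : (4 ^ _ * (_ * _) = 4 ^ l.+2 * (l.+2)`! * 'C(k, l.+2))%N); last by ring.
  rewrite leq_mul2l; apply/orP; right; apply: leq_trans hW.
  by rewrite leq_mul2r hs orbT.
exists E; split=> // z zZ; have := EZ z zZ.
rewrite (_ : [set c | up z c \notin W] = finset.set0) ?cards0 ?addn0 //.
by apply/setP => c; rewrite !inE ZW.
Qed.

End DenseSubgraph.

(** * Absolute values and norms of polynomials *)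

Section AbsoluteValue.
Variables (R : realType) (F : fieldType) (v : F -> R).
Hypothesis av : absolute_value v.

Lemma av_ge0 x : 0 <= v x. Proof. by case: av. Qed.

Lemma av_eq0 x : (v x == 0) = (x == 0).
Proof. by case: av => _ h _ _; apply/eqP/eqP => /h. Qed.

Lemma av0 : v 0 = 0. Proof. by apply/eqP; rewrite av_eq0. Qed.

Lemma av_gt0 x : x != 0 -> 0 < v x.
Proof. by rewrite lt0r av_eq0 av_ge0 => ->. Qed.

Lemma avM x y : v (x * y) = v x * v y. Proof. by case: av. Qed.

Lemma av_leD x y : v (x + y) <= v x + v y. Proof. by case: av. Qed.

Lemma av1 : v 1 = 1.
Proof.
have h : v 1 != 0 by rewrite av_eq0 oner_eq0.
by apply: (mulfI h); rewrite mulr1 -avM mulr1.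
Qed.

Lemma avX x n : v (x ^+ n) = v x ^+ n.
Proof. by elim: n => [|n IH]; rewrite ?expr0 ?av1 // !exprS avM IH. Qed.

Lemma avN x : v (- x) = v x.
Proof.
have h : v (-1) = 1.
  have : v (-1) ^+ 2 == 1 by rewrite -avX sqrrN expr1n av1.
  rewrite sqrf_eq1 => /orP[/eqP //|/eqP h].
  by have := av_ge0 (-1); rewrite h ler0N1.
by rewrite -mulN1r avM h mul1r.
Qed.

Lemma av_distC x y : v (x - y) = v (y - x).
Proof. by rewrite -avN opprB. Qed.

Lemma avV x : v x^-1 = (v x)^-1.
Proof.
have [->|x0] := eqVneq x 0; first by rewrite invr0 av0 invr0.
have h : v x != 0 by rewrite av_eq0.
by apply: (mulfI h); rewrite -avM divff // divff // av1.
Qed.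

Lemma av_leB x y : v x - v y <= v (x - y).
Proof. by rewrite lerBlDr; have := av_leD (x - y) y; rewrite subrK. Qed.

Lemma av_prod (I : Type) (r : seq I) (P : pred I) (f : I -> F) :
  v (\prod_(i <- r | P i) f i) = \prod_(i <- r | P i) v (f i).
Proof. exact: (big_morph v avM av1). Qed.

Lemma av_le_sum (I : Type) (r : seq I) (P : pred I) (f : I -> F) :
  v (\sum_(i <- r | P i) f i) <= \sum_(i <- r | P i) v (f i).
Proof.
elim/big_ind2: _ => [|x1 x2 y1 y2 h1 h2|//]; first by rewrite av0.
by apply: le_trans (av_leD _ _) _; rewrite lerD.
Qed.

End AbsoluteValue.

Lemma absolute_value_comp (R : realType) (K F : fieldType) (v : F -> R)
    (f : {rmorphism K -> F}) : absolute_value v -> absolute_value (v \o f).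
Proof.
move=> av; split=> [x|x|x y|x y] /=.
- exact: av_ge0.
- split=> [/eqP|->]; last by rewrite rmorph0 av0.
  by rewrite av_eq0 // fmorph_eq0 => /eqP.
- by rewrite rmorphM avM.
- by rewrite rmorphD; exact: av_leD.
Qed.

Section PolyNorm.
Variables (R : realType) (F : fieldType) (v : F -> R) (kappa : R).
Hypothesis av : absolute_value v.
Hypothesis kappa1 : 1 <= kappa.
Hypothesis av_max : forall x y, v (x + y) <= kappa * Num.max (v x) (v y).

(** The formula of [poly_norm] over any field, so that it applies to images in an algebraically
    closed field. The constant [kappa] will be 1 at a [p]-adic place and 2 at an archimedean one. *)
Definition max_norm (f : {poly F}) : R := \big[Num.max/0]_(i < size f) v f`_i.

(** For the complex modulus, the Mahler measure of the monic polynomial with roots [s], by Jensen's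
    formula. *)
Definition mahler (s : seq F) : R := \prod_(z <- s) Num.max 1 (v z).

Lemma max_norm_ge0 f : 0 <= max_norm f.
Proof. exact: bigmax_ge_id. Qed.

Lemma coef_le_max_norm (f : {poly F}) i : v f`_i <= max_norm f.
Proof.
have [h|h] := ltnP i (size f); last by rewrite nth_default // av0 // max_norm_ge0.
exact: (le_bigmax _ (fun i : 'I_(size f) => v f`_i) (Ordinal h)).
Qed.

Lemma max_norm_le (f : {poly F}) c : 0 <= c -> (forall i, v f`_i <= c) -> max_norm f <= c.
Proof. by move=> c0 h; apply/bigmax_leP; split=> // i _; exact: h. Qed.

Lemma max_norm_gt0 f : f != 0 -> 0 < max_norm f.
Proof.
move=> f0; apply: lt_le_trans (coef_le_max_norm f (size f).-1).
by apply: av_gt0 => //; rewrite lead_coef_eq0.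
Qed.

Lemma max_normZ c f : max_norm (c *: f) = v c * max_norm f.
Proof.
have le a g : max_norm (a *: g) <= v a * max_norm g.
  apply: max_norm_le => [|i]; first by rewrite mulr_ge0 ?max_norm_ge0 ?av_ge0.
  by rewrite coefZ avM // ler_wpM2l ?av_ge0 ?coef_le_max_norm.
apply/eqP; rewrite eq_le le /=.
have [->|c0] := eqVneq c 0; first by rewrite av0 // mul0r max_norm_ge0.
rewrite -[f in v c * max_norm f](scalerK c0).
have v0 := av_gt0 av c0.
rewrite -ler_pdivlMl //; apply: le_trans (le _ _) _; by rewrite avV.
Qed.

Lemma max_norm_monic_ge1 f : f \is monic -> 1 <= max_norm f.
Proof. by move=> /monicP h; rewrite -(av1 av) -h; exact: coef_le_max_norm. Qed.

Lemma mahler_ge1 s : 1 <= mahler s.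
Proof.
rewrite /mahler; elim/big_ind: _ => // [x y x1 y1|z _]; last by rewrite le_max lexx.
by rewrite mulr_ege1.
Qed.

Lemma coef_mul_XsubC (f : {poly F}) z i :
  (('X - z%:P) * f)`_i = (if i is j.+1 then f`_j else 0) - z * f`_i.
Proof. by rewrite mulrBl coefB mul_polyC coefZ coefXM; case: i. Qed.

Lemma max_norm_mul_XsubC_le (f : {poly F}) z :
  max_norm (('X - z%:P) * f) <= kappa * Num.max 1 (v z) * max_norm f.
Proof.
have k0 : 0 <= kappa by apply: le_trans kappa1.
have m0 : 0 <= Num.max 1 (v z) by rewrite le_max ler01.
apply: max_norm_le => [|i]; first by rewrite !mulr_ge0 ?max_norm_ge0.
rewrite coef_mul_XsubC; apply: le_trans (av_max _ _) _.
rewrite -mulrA ler_wpM2l // ge_max avN // avM //; apply/andP; split.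
  apply: (@le_trans _ _ (max_norm f)); last by rewrite ler_peMl ?max_norm_ge0 // le_max lexx.
  by case: i => [|i]; [rewrite av0 // max_norm_ge0|exact: coef_le_max_norm].
by rewrite ler_pM ?av_ge0 ?coef_le_max_norm // le_max lexx orbT.
Qed.

Lemma max_norm_prod_XsubC_le s :
  max_norm (\prod_(z <- s) ('X - z%:P)) <= kappa ^+ size s * mahler s.
Proof.
have k0 : 0 <= kappa by apply: le_trans kappa1.
elim: s => [|z s IH].
  rewrite /mahler !big_nil expr0 mulr1; apply: max_norm_le => // i.
  by rewrite coef1; case: (i == _); rewrite /= ?av0 // av1.
rewrite /mahler !big_cons -/(mahler s) /= exprS.
apply: le_trans (max_norm_mul_XsubC_le _ _) _.
have m0 : 0 <= Num.max 1 (v z) by rewrite le_max ler01.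
rewrite (_ : kappa * kappa ^+ _ * _ =
  kappa * Num.max 1 (v z) * (kappa ^+ size s * mahler s)); last by ring.
by rewrite ler_wpM2l // mulr_ge0.
Qed.

(** From [z * f_i = f_(i-1) - g_i] follows [v z * |f| <= kappa * max(|g|, |f|)]. The maximum cannot
    be an [|f|] larger than [|g|], since [v z > kappa]. *)
Lemma max_norm_mul_XsubC_ge (f : {poly F}) z : kappa < v z ->
  v z * max_norm f <= kappa * max_norm (('X - z%:P) * f).
Proof.
move=> kz; have k0 : 0 < kappa by apply: lt_le_trans kappa1.
set g := _ * f; have vz0 : 0 < v z by exact: lt_trans kz.
have h : v z * max_norm f <= kappa * Num.max (max_norm g) (max_norm f).
  rewrite -ler_pdivlMl //; apply: max_norm_le => [|i].
    by rewrite !mulr_ge0 ?invr_ge0 ?(ltW vz0) ?(ltW k0) // le_max max_norm_ge0.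
  rewrite ler_pdivlMl // -avM // -[v (_ * _)]avN //.
  have -> : - (z * f`_i) = g`_i - (if i is j.+1 then f`_j else 0).
    by rewrite /g coef_mul_XsubC addrAC subrr add0r.
  apply: le_trans (av_max _ _) _; rewrite ler_wpM2l ?(ltW k0) //.
  rewrite ge_max avN // !le_max coef_le_max_norm /=.
  by case: i => [|i]; [rewrite av0 // max_norm_ge0 ?orbT|rewrite coef_le_max_norm orbT].
have [fg|gf] := leP (max_norm f) (max_norm g); first by rewrite max_l in h.
rewrite max_r ?(ltW gf) // in h.
have : max_norm f * (v z - kappa) <= 0 by move: h; lra.
rewrite pmulr_lle0 ?subr_gt0 // => f0.
by move: gf; rewrite ltNge (le_trans f0) // max_norm_ge0.
Qed.

(* The roots of large absolute value are removed first; the remaining factor is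
   monic and so has norm at least 1, and its roots are bounded by kappa. *)
Lemma mahler_le s :
  mahler s <= kappa ^+ size s * max_norm (\prod_(z <- s) ('X - z%:P)).
Proof.
have k0 : 0 < kappa by apply: lt_le_trans kappa1.
have big t (f : {poly F}) : all (fun z => kappa < v z) t ->
    mahler t * max_norm f <= kappa ^+ size t * max_norm (\prod_(z <- t) ('X - z%:P) * f).
  elim: t f => [|z t IH] f /=; first by rewrite /mahler !big_nil !mul1r.
  case/andP=> zk /IH{}IH; rewrite /mahler !big_cons -/(mahler t) -2!mulrA.
  rewrite max_r; last by rewrite (le_trans kappa1) // ltW.
  have vz0 : 0 < v z by exact: lt_trans zk.
  apply: le_trans (ler_wpM2l (ltW vz0) (IH f)) _.
  rewrite mulrCA exprSr -mulrA ler_wpM2l ?exprn_ge0 ?(ltW k0) //.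
  by apply: le_trans (max_norm_mul_XsubC_ge _ zk) _; rewrite mulrA.
pose a z := kappa < v z.
have ps : perm_eq s ([seq z <- s | a z] ++ [seq z <- s | predC a z]).
  by rewrite perm_sym perm_filterC.
rewrite /mahler (perm_big _ ps) [X in _ <= _ * max_norm X](perm_big _ ps) (perm_size ps) /=.
rewrite !big_cat /= size_cat exprD; set t := [seq z <- s | a z];
  set t' := [seq z <- s | ~~ a z].
have ht : all a t by exact: filter_all.
have ht' : mahler t' <= kappa ^+ size t'.
  have : all (predC a) t' by exact: (filter_all (predC a)).
  elim: t' {ps} => [|z q IH] /=; first by rewrite /mahler big_nil expr0.
  case/andP; rewrite -leNgt => zk /IH{}IH; rewrite /mahler big_cons exprS.
  apply: ler_pM => //; first by rewrite le_max ler01.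
    by apply: le_trans (mahler_ge1 q).
  by rewrite ge_max kappa1.
have m0 : 0 <= mahler t by apply: le_trans (mahler_ge1 t).
apply: (@le_trans _ _ (mahler t * kappa ^+ size t')).
  by rewrite -/(mahler t) -/(mahler t') ler_wpM2l.
rewrite mulrAC ler_wpM2r ?exprn_ge0 ?(ltW k0) //.
apply: le_trans (big _ _ ht); rewrite ler_peMr //.
by apply: max_norm_monic_ge1; exact: monic_prod_XsubC.
Qed.

End PolyNorm.

(** * Multiplicities of roots and weighted sums along the selected edges *)

Section RootCount.
Variables (L : numFieldType).

Lemma mup_Xn_sub (a : nat) (z w : L) : z != 0 -> (0 < a)%N ->
  mup z ('X^a - w%:P) = (z ^+ a == w).
Proof.
move=> z0 a0; have [<-|zw] := eqVneq (z ^+ a) w; last first.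
  apply: mupNroot; rewrite rootE !hornerE.
  by rewrite subr_eq0.
rewrite rmorphXn /= subrXX.
rewrite mupMl.
  by rewrite -[X in mup _ X]expr1 mup_XsubCX eqxx.
rewrite rootE horner_sum (eq_bigr (fun _ => z ^+ a.-1)).
  rewrite sumr_const card_ord -mulr_natr mulf_eq0 negb_or expf_neq0 //=.
  by rewrite pnatr_eq0 -lt0n.
move=> i _; rewrite !hornerE -exprD subnK // -ltnS prednK //.
Qed.

Lemma comp_prod_XsubC_Xn (ws : seq L) a :
  (\prod_(w <- ws) ('X - w%:P)) \Po 'X^a = \prod_(w <- ws) ('X^a - w%:P).
Proof.
rewrite rmorph_prod /=; apply: eq_bigr => w _.
by rewrite comp_polyB comp_polyX comp_polyC.
Qed.

(** The multiplicity of [z] in [P(X^a)] is that of [z ^+ a] in [P], because a non-zero root of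
    [X^a - w] is simple in characteristic 0. *)
Lemma count_root_le (zs ws : seq L) (a : nat) (z : L) : z != 0 -> (0 < a)%N ->
  \prod_(x <- zs) ('X - x%:P) %| (\prod_(w <- ws) ('X - w%:P)) \Po 'X^a ->
  (count_mem z zs <= count_mem (z ^+ a) ws)%N.
Proof.
move=> z0 a0; rewrite comp_prod_XsubC_Xn => /dvdpP[q e].
have n0 w : 'X^a - w%:P != 0 :> {poly L}.
  by rewrite -lead_coef_eq0 lead_coefXnsubC // oner_eq0.
have p0 (t : seq L) : \prod_(w <- t) ('X^a - w%:P) != 0 :> {poly L}.
  by rewrite prodf_seq_neq0; apply/allP => w _; rewrite /= n0.
have <- : mup z (\prod_(w <- ws) ('X^a - w%:P)) = count_mem (z ^+ a) ws.
  elim: ws {e} => [|w ws IH] /=; first by rewrite big_nil mupNroot // root1.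
  by rewrite big_cons mupM // IH mup_Xn_sub // eq_sym.
have q0 : q != 0 by apply: contraNneq (p0 ws) => q0; rewrite e q0 mul0r.
have r0 : \prod_(x <- zs) ('X - x%:P) != 0 :> {poly L}.
  exact/monic_neq0/monic_prod_XsubC.
by rewrite e mupM // mu_prod_XsubC leq_addl.
Qed.

End RootCount.

Lemma sum_undup (R : realType) (T : eqType) (s : seq T) (f : T -> R) :
  \sum_(x <- s) f x = \sum_(x <- undup s) (count_mem x s)%:R * f x.
Proof.
rewrite -big_undup_iterop_count; apply: eq_bigr => x _.
by rewrite mulr_natl.
Qed.

Section WeightedSum.
Variables (R : realType) (L : numFieldType) (k : nat) (p : 'I_k -> nat).
Hypothesis p_prime : forall i, prime (p i).
Hypothesis p_inj : injective p.
Variables (zs ws : seq L) (l : nat).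
Hypothesis zs_nt : forall z, z \in zs -> nontorsion z.
Hypothesis zs_count : forall z c, z \in zs ->
  (count_mem z zs <= count_mem (z ^+ p c) ws)%N.
Hypothesis l2 : (2 <= l)%N.
Hypothesis k0 : (0 < k)%N.
Hypothesis ws_size : (size ws * (2 ^ l.+1 * (l.+1)`!) <= 'C(k, l.+2))%N.

(** The graph has the distinct roots as vertices; multiplicities enter as weights, which do not
    decrease along an edge. Each term at [z] is spread over at least [k / 4] selected edges and
    collected at their endpoints, at most [l + 1] edges at each. The lemma serves for [f = g = 1]
    with [m = 1], and for [f = g = ln (max 1 u)] with [m = M / 2]. *)
Lemma weighted_sum (f g : L -> R) (m : R) : 0 <= m ->
  (forall z, 0 <= f z) -> (forall w, 0 <= g w) ->
  (forall z c, z \in zs -> m * f z <= g (z ^+ p c)) ->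
  k%:R * m * \sum_(z <- zs) f z <= 4 * l.+1%:R * \sum_(w <- ws) g w.
Proof.
move=> m0 f0 g0 fg.
have [|||||||E [Ew Ez]] :=
    @sparse_edges L k p p_prime p_inj (undup zs) (undup ws) l.
- exact: undup_uniq.
- exact: undup_uniq.
- by move=> z; rewrite mem_undup; exact: zs_nt.
- move=> z c; rewrite !mem_undup => zz; rewrite -has_pred1 has_count.
  by apply: leq_trans (zs_count c zz); rewrite -has_count has_pred1.
- by [].
- by [].
- by apply: leq_trans ws_size; rewrite leq_mul2r size_undup orbT.
rewrite (sum_undup zs) (sum_undup ws) !mulr_sumr.
pose cz z : R := (count_mem z zs)%:R; pose cw w : R := (count_mem w ws)%:R.
apply: (@le_trans _ _ (\sum_(z <- undup zs) \sum_(c : 'I_k)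
    4 * ((E z c)%:R * (cw (z ^+ p c) * g (z ^+ p c))))).
  rewrite big_seq [leRHS]big_seq; apply: ler_sum => z; rewrite mem_undup => zz.
  apply: (@le_trans _ _ (\sum_(c : 'I_k) 4 * ((E z c)%:R * (cz z * (m * f z))))).
    rewrite -mulr_sumr -mulr_suml -natr_sum.
    rewrite (_ : k%:R * m * _ = k%:R * (cz z * (m * f z))); last by rewrite /cz; ring.
    rewrite [leRHS]mulrA ler_wpM2r ?mulr_ge0 //.
    rewrite -natrM ler_nat.
    rewrite (_ : (\sum_c _ = #|[set c | E z c]|)%N); first by apply: Ez; rewrite mem_undup.
    by rewrite -sum1dep_card [RHS]big_mkcond.
  apply: ler_sum => c _; rewrite ler_wpM2l // ler_wpM2l //.
  by apply: ler_pM => //; rewrite ?mulr_ge0 ?ler_nat ?zs_count ?fg.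
have st z c : z \in zs -> cw (z ^+ p c) * g (z ^+ p c) =
    \sum_(w <- undup ws) (z ^+ p c == w)%:R * (cw w * g w).
  move=> zz.
  have wW : z ^+ p c \in undup ws.
    rewrite mem_undup -has_pred1 has_count.
    by apply: leq_trans (zs_count c zz); rewrite -has_count has_pred1.
  rewrite (bigD1_seq (z ^+ p c)) ?undup_uniq //= eqxx mul1r big1 ?addr0 // => w.
  by rewrite eq_sym => /negPf ->; rewrite mul0r.
rewrite big_seq; under eq_bigr => z zz.
  under eq_bigr => c _. rewrite st; last by rewrite -mem_undup. over.
  over.
rewrite -big_seq /=.
apply: (@le_trans _ _ (\sum_(w <- undup ws) 4 * (in_degree p E (undup zs) w)%:R * (cw w * g w))).
  under eq_bigr => z _. under eq_bigr => c _. rewrite !mulr_sumr. over. rewrite exchange_big. over.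
  rewrite exchange_big /=; apply: ler_sum => w _.
  rewrite /in_degree natr_sum -mulrA mulr_suml mulr_sumr; apply: ler_sum => z _.
  rewrite natr_sum mulr_suml mulr_sumr; apply: ler_sum => c _.
  by case: (E z c) (z ^+ p c == w) => [] []; rewrite /= ?mul0r ?mul1r ?mulr0.
apply: ler_sum => w _; rewrite -!mulrA ler_wpM2l // ler_wpM2r ?mulr_ge0 //.
by rewrite ler_nat.
Qed.

End WeightedSum.

(** * Limits and weak approximation *)

Local Open Scope classical_set_scope.

Section Limits.
Variables (R : realType) (F : fieldType) (v : F -> R).
Hypothesis av : absolute_value v.
Implicit Types x y : nat -> F.

Lemma v_nullP x :
  v_null v x <-> forall e, 0 < e -> \forall n \near \oo, v (x n) < e.
Proof.
split=> [/cvgrPdist_lt h e e0|h].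
  by apply: filterS (h e e0) => n; rewrite sub0r normrN ger0_norm ?av_ge0.
apply/cvgrPdist_lt => e e0; apply: filterS (h e e0) => n.
by rewrite sub0r normrN ger0_norm ?av_ge0.
Qed.

Lemma v_null_le x y (C : R) : v_null v y ->
  (\forall n \near \oo, v (x n) <= C * v (y n)) -> v_null v x.
Proof.
move=> /v_nullP y0 h; apply/v_nullP => e e0.
have C0 : 0 < `|C| + 1 by rewrite ltr_wpDl.
near=> n; apply: le_lt_trans (near h n _) _ => //.
apply: (@le_lt_trans _ _ ((`|C| + 1) * v (y n))).
  by rewrite ler_wpM2r ?av_ge0 // (le_trans (ler_norm _)) // lerDl.
rewrite -ltr_pdivlMl //; near: n; apply: y0; rewrite mulr_gt0 // invr_gt0 //.
Unshelve. all: by end_near. Qed.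

Lemma v_null_ext x y : (forall n, x n = y n) -> v_null v x -> v_null v y.
Proof. by move=> /funext ->. Qed.

Lemma v_nullD x y : v_null v x -> v_null v y -> v_null v (fun n => x n + y n).
Proof.
move=> /v_nullP x0 /v_nullP y0; apply/v_nullP => e e0.
have e2 : 0 < e / 2 by rewrite divr_gt0.
near=> n; apply: le_lt_trans (av_leD av _ _) _; rewrite (splitr e); apply: ltrD.
  by near: n; apply: x0.
by near: n; apply: y0.
Unshelve. all: by end_near. Qed.

Lemma v_null_cst0 : v_null v (fun _ => 0).
Proof. by apply/v_nullP => e e0; near=> n; rewrite av0. Unshelve. all: by end_near. Qed.

Lemma v_null_sum (I : Type) (r : seq I) (x : I -> nat -> F) :
  (forall i, v_null v (x i)) -> v_null v (fun n => \sum_(i <- r) x i n).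
Proof.
move=> h; elim: r => [|i r IH].
  by apply: v_null_ext v_null_cst0 => n; rewrite big_nil.
by apply: v_null_ext (v_nullD (h i) IH) => n; rewrite big_cons.
Qed.

Lemma v_null_mull x y (C : R) : (forall n, v (x n) <= C) -> v_null v y ->
  v_null v (fun n => x n * y n).
Proof.
move=> xC y0; apply: (v_null_le (C := C) y0); near=> n.
by rewrite avM // ler_wpM2r ?av_ge0.
Unshelve. all: by end_near. Qed.

Lemma v_nullM x y : v_null v x -> v_null v y -> v_null v (fun n => x n * y n).
Proof.
move=> /v_nullP x0 y0; apply: (v_null_le (C := 1) y0); near=> n.
rewrite avM // ler_wpM2r ?av_ge0 // ltW //; near: n; exact: x0.
Unshelve. all: by end_near. Qed.

Definition v_conv x (l : F) := v_null v (fun n => x n - l).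

Lemma v_conv_cst l : v_conv (fun _ => l) l.
Proof. by apply: v_null_ext v_null_cst0 => n; rewrite subrr. Qed.

Lemma v_convD x y a b : v_conv x a -> v_conv y b -> v_conv (fun n => x n + y n) (a + b).
Proof. by move=> ha hb; apply: v_null_ext (v_nullD ha hb) => n; ring. Qed.

Lemma v_convM x y a b : v_conv x a -> v_conv y b -> v_conv (fun n => x n * y n) (a * b).
Proof.
move=> ha hb.
have h1 := v_null_mull (fun=> lexx (v a)) hb.
have h2 := v_null_mull (fun=> lexx (v b)) ha.
by apply: v_null_ext (v_nullD (v_nullM ha hb) (v_nullD h1 h2)) => n; ring.
Qed.

Lemma v_conv_sum (I : Type) (r : seq I) (x : I -> nat -> F) (a : I -> F) :
  (forall i, v_conv (x i) (a i)) ->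
  v_conv (fun n => \sum_(i <- r) x i n) (\sum_(i <- r) a i).
Proof.
move=> h; apply: v_null_ext (v_null_sum r (fun i => h i)) => n.
by rewrite sumrB.
Qed.

Lemma v_conv_coef_prod (I : Type) (r : seq I) (f : I -> nat -> {poly F})
    (g : I -> {poly F}) :
  (forall i j, v_conv (fun n => (f i n)`_j) (g i)`_j) ->
  forall j, v_conv (fun n => (\prod_(i <- r) f i n)`_j) (\prod_(i <- r) g i)`_j.
Proof.
move=> h; elim: r => [|i r IH] j.
  rewrite big_nil; apply: v_null_ext (v_conv_cst _) => n; by rewrite big_nil.
rewrite big_cons coefM.
apply: v_null_ext (v_conv_sum (index_enum 'I_j.+1)
  (fun s : 'I_j.+1 => v_convM (h i s) (IH (j - s)%N))) => n.
by rewrite big_cons coefM.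
Qed.

Lemma v_null_expr (z : F) : v z < 1 -> v_null v (fun n => z ^+ n).
Proof.
move=> z1; rewrite /v_null; under eq_cvg => n do rewrite avX //.
by apply: cvg_expr; rewrite ger0_norm ?av_ge0.
Qed.

Lemma v_one_plus_ge (z : F) n : (0 < n)%N -> v z < 1 -> 1 - v z <= v (1 + z ^+ n).
Proof.
move=> n0 z1; apply: (@le_trans _ _ (1 - v (z ^+ n))).
  by rewrite lerB // avX // -[leRHS]expr1 ler_wiXn2l ?av_ge0 // ltW.
by have := av_leB av 1 (- z ^+ n); rewrite opprK av1 // avN.
Qed.

(** With [v_conv_expr_frac]: [z^n / (1 + z^n)] tends to 0 or 1 according to [v z < 1] or [v z > 1],
    and so approximates the indicator function of a set of absolute values. *)
Lemma v_null_expr_frac (z : F) : v z < 1 ->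
  v_null v (fun n => z ^+ n / (1 + z ^+ n)).
Proof.
move=> z1; apply: (v_null_le (C := (1 - v z)^-1) (v_null_expr z1)).
have d0 : 0 < 1 - v z by rewrite subr_gt0.
near=> n; have n0 : (0 < n)%N by near: n; exists 1%N.
rewrite avM // avV // mulrC ler_wpM2r ?av_ge0 //.
have h := v_one_plus_ge n0 z1.
by rewrite lef_pV2 ?posrE // (lt_le_trans d0).
Unshelve. all: by end_near. Qed.

Lemma v_conv_expr_frac (z : F) : 1 < v z ->
  v_conv (fun n => z ^+ n / (1 + z ^+ n)) 1.
Proof.
move=> z1; have z0 : z != 0.
  by rewrite -(av_eq0 av) gt_eqF // (lt_trans _ z1).
have zi1 : v z^-1 < 1 by rewrite avV // invf_lt1 // (lt_trans _ z1).
have h := v_null_expr_frac zi1.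
apply: (v_null_le (C := 1) h); near=> n.
have n0 : (0 < n)%N by near: n; exists 1%N.
(* The difference from 1 is [- t / (1 + t)] with [t = z^-n]. *)
rewrite mul1r le_eqVlt; apply/orP; left; apply/eqP.
have hn := v_one_plus_ge n0 zi1.
have w0 : 1 + z^-1 ^+ n != 0.
  by rewrite -(av_eq0 av) gt_eqF // (lt_le_trans _ hn) // subr_gt0.
have zn0 : z ^+ n != 0 by rewrite expf_neq0.
have w1 : 1 + z ^+ n != 0.
  apply: contraNneq w0 => e; rewrite exprVn -[1](divff zn0) -{2}[_^-1]mul1r -mulrDl.
  by rewrite addrC e mul0r.
rewrite -(avN av) exprVn; congr (v _); rewrite exprVn in w0.
move: zn0 w1 {w0}; move: (z ^+ n) => t t0 t1. 
by field; rewrite t0 addrC.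
Unshelve. all: by end_near. Qed.

Lemma v_cauchy_cst l : v_cauchy v (fun _ => l).
Proof. by move=> e e0; exists 0%N => m n _ _; rewrite subrr av0. Qed.

Lemma v_cauchy_bounded x : v_cauchy v x -> exists C, forall n, v (x n) <= C.
Proof.
move=> /(_ 1 ltr01)[N hN]; exists (1 + \sum_(i < N.+1) v (x i)) => n.
have s0 (i : 'I_N.+1) : v (x i) <= \sum_(i < N.+1) v (x i).
  rewrite (bigD1 i) //= lerDl sumr_ge0 // => j _; exact: av_ge0.
have [nN|Nn] := ltnP n N.+1.
  by apply: le_trans (s0 (Ordinal nN)) _; rewrite lerDr.
rewrite -[x n](subrK (x N)); apply: le_trans (av_leD av _ _) _.
by apply: lerD; [rewrite ltW // hN // ltnW | exact: (s0 ord_max)].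
Qed.

Lemma v_cauchyD x y : v_cauchy v x -> v_cauchy v y -> v_cauchy v (fun n => x n + y n).
Proof.
move=> hx hy e e0; have e2 : 0 < e / 2 by rewrite divr_gt0.
have [N hN] := hx _ e2; have [M hM] := hy _ e2; exists (maxn N M) => m n.
rewrite !geq_max => /andP[m1 m2] /andP[n1 n2].
rewrite (_ : _ - _ = (x m - x n) + (y m - y n)); last by ring.
apply: le_lt_trans (av_leD av _ _) _; rewrite (splitr e).
by apply: ltrD; [exact: hN | exact: hM].
Qed.

Lemma v_cauchyM x y : v_cauchy v x -> v_cauchy v y -> v_cauchy v (fun n => x n * y n).
Proof.
move=> hx hy; have [C hC] := v_cauchy_bounded hx; have [D hD] := v_cauchy_bounded hy.
move=> e e0.
have C0 : 0 < C + 1 by rewrite ltr_wpDl // (le_trans _ (hC 0%N)) // av_ge0.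
have D0 : 0 < D + 1 by rewrite ltr_wpDl // (le_trans _ (hD 0%N)) // av_ge0.
have [N hN] : exists N, forall m n : nat, (N <= m)%N -> (N <= n)%N ->
    v (x m - x n) < e / 2 / (D + 1) by apply: hx; rewrite !divr_gt0.
have [M hM] : exists N, forall m n : nat, (N <= m)%N -> (N <= n)%N ->
    v (y m - y n) < e / 2 / (C + 1) by apply: hy; rewrite !divr_gt0.
exists (maxn N M) => m n; rewrite !geq_max => /andP[m1 m2] /andP[n1 n2].
rewrite (_ : _ - _ = x m * (y m - y n) + (x m - x n) * y n); last by ring.
apply: le_lt_trans (av_leD av _ _) _; rewrite (splitr e) !(avM av).
apply: ltrD.
  apply: (@le_lt_trans _ _ ((C + 1) * v (y m - y n))).
    by rewrite ler_wpM2r ?av_ge0 // (le_trans (hC m)) // lerDl.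
  by rewrite -ltr_pdivlMl // mulrC hM.
apply: (@le_lt_trans _ _ (v (x m - x n) * (D + 1))).
  by rewrite ler_wpM2l ?av_ge0 // (le_trans (hD n)) // lerDl.
by rewrite -ltr_pdivlMr // hN.
Qed.

Lemma v_cauchy_sum (I : Type) (r : seq I) (x : I -> nat -> F) :
  (forall i, v_cauchy v (x i)) -> v_cauchy v (fun n => \sum_(i <- r) x i n).
Proof.
move=> h; elim: r => [|i r IH].
  by rewrite (_ : (fun _ => _) = fun _ => 0); [exact: v_cauchy_cst | apply/funext => n; rewrite big_nil].
rewrite (_ : (fun _ => _) = fun n => x i n + \sum_(i <- r) x i n); first exact: v_cauchyD.
by apply/funext => n; rewrite big_cons.
Qed.

End Limits.

Lemma near_forall_lt (n : nat) (P : nat -> nat -> Prop) :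
  (forall i, (i < n)%N -> \forall r \near \oo, P i r) ->
  \forall r \near \oo, forall i, (i < n)%N -> P i r.
Proof.
elim: n => [|n IH] h; first by near=> r.
have h1 := IH (fun i hi => h i (ltnW hi)); have h2 := h n (ltnSn n).
near=> r => i; rewrite ltnS leq_eqVlt => /orP[/eqP ->|]; first exact: (near h2 r).
exact: (near h1 r).
Unshelve. all: by end_near. Qed.

Section WeakApproximation.
Variables (R : realType) (F : fieldType).

Lemma avXz (v : F -> R) (x : F) (n : int) : absolute_value v -> v (x ^ n) = v x ^ n.
Proof.
move=> av; case: n => n; first by rewrite -!exprnP avX.
by rewrite !NegzE -!exprnN avV // avX.
Qed.

Lemma exprz_between (t x : R) : 1 < t -> 0 < x -> exists j : int, x < t ^ j <= t * x.
Proof.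
move=> t1 x0; have lt0 : 0 < ln t by rewrite ln_gt0.
have t0 : 0 < t by apply: lt_trans t1.
exists (Num.floor (ln x / ln t) + 1).
have e (j : int) : t ^ j = expR (j%:~R * ln t).
  by rewrite -powR_intmul ?(ltW t0) // /powR gt_eqF.
have /andP[h1 h2] := floor_itv (ln x / ln t).
rewrite e; apply/andP; split.
  by rewrite -{1}[x]lnK ?posrE // ltr_expR -ltr_pdivrMr.
rewrite -[t * x]lnK ?posrE ?mulr_gt0 // ler_expR lnM ?posrE // intrD mulrDl mul1r addrC.
by rewrite lerD2l -ler_pdivlMr.
Qed.

(** The common value at [c] prevents [w] from being another power of [v]. Taking [k] with
    [(w a / v a)^k < 1 / v c] leaves room for a power of [v c] strictly between [(w a)^k] and
    [(v a)^k]; dividing [a^k] by that power of [c] separates the two. *)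
Lemma separating_element (v w : F -> R) (c a : F) :
  absolute_value v -> absolute_value w -> 1 < v c -> w c = v c -> v a != w a ->
  exists y, 1 < v y /\ w y < 1.
Proof.
move=> av aw c1 wc; wlog va : a / w a < v a => [hw|] vwa.
  have [h|h|h] := ltgtP (w a) (v a); first exact: (hw a).
    apply: (hw a^-1); last by rewrite !avV // (inj_eq invr_inj).
    have v0 : 0 < v a.
      rewrite lt0r av_ge0 // andbT av_eq0 //; apply: contraNneq vwa => ->.
      by rewrite !av0.
    by rewrite !avV // ltf_pV2 ?posrE // (lt_trans v0).
  by move: vwa; rewrite h eqxx.
have v0 : 0 < v a by apply: le_lt_trans va; exact: av_ge0.
have a0 : a != 0 by rewrite -(av_eq0 av) gt_eqF.
have w0 : 0 < w a by exact: av_gt0.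
have c0 : c != 0 by rewrite -(av_eq0 av) gt_eqF // (lt_trans _ c1).
have vc0 : 0 < v c by apply: lt_trans c1.
have r1 : w a / v a < 1 by rewrite ltr_pdivrMr // mul1r.
have [k hk] : exists k, (w a / v a) ^+ k < (v c)^-1.
  have : (w a / v a) ^+ n @[n --> \oo] --> (0 : R).
    by apply: cvg_expr; rewrite ger0_norm // divr_ge0 // ltW.
  move=> /cvgrPdist_lt /(_ (v c)^-1); rewrite invr_gt0 => /(_ vc0) [k _ /(_ k (leqnn k))].
  by rewrite /= sub0r normrN ger0_norm ?exprn_ge0 ?divr_ge0 ?(ltW v0) ?(ltW w0) //; exists k.
have [j /andP[j1 j2]] := exprz_between c1 (exprn_gt0 k w0).
have cj0 : 0 < v c ^ j by rewrite exprz_gt0.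
exists (a ^+ k / c ^ j); 
  rewrite (avM av) (avM aw) (avV av) (avV aw) (avXz _ _ av) (avXz _ _ aw).
rewrite (avX av) (avX aw) wc; split; last first.
  by rewrite ltr_pdivrMr // mul1r.
rewrite ltr_pdivlMr // mul1r; apply: le_lt_trans j2 _.
move: hk; rewrite expr_div_n ltr_pdivrMr ?exprn_gt0 // => hk.
by rewrite -ltr_pdivlMl.
Qed.

(** The argument of Artin and Whaples: [x] is good for the first [n] absolute values and [y]
    separates [v] from the last. If [u n x <= 1], a high power of [x] times [y] works. Otherwise
    powers are replaced by [x^r / (1 + x^r)], which tends to 1 at [v] and at the last one and to 0
    at the others. *)
Lemma weak_approximation (v : F -> R) (n : nat) (u : nat -> F -> R) (c : F) :
  absolute_value v -> (forall i, (i < n)%N -> absolute_value (u i)) ->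
  1 < v c -> (forall i, (i < n)%N -> u i c = v c) ->
  (forall i, (i < n)%N -> exists a, v a != u i a) ->
  exists y, 1 < v y /\ forall i, (i < n)%N -> u i y < 1.
Proof.
move=> av; elim: n => [|n IH] au c1 uc sep; first by exists c.
have [i hi||i hi|i hi|x [vx ux]] := IH.
- by apply: au; exact: ltnW.
- exact: c1.
- by apply: uc; exact: ltnW.
- by apply: sep; exact: ltnW.
have un := au n (ltnSn n); have [a ha] := sep n (ltnSn n).
have [y [vy uy]] := separating_element av un c1 (uc n (ltnSn n)) ha.
have close (w : F -> R) z (l : F) (e : nat -> F) : absolute_value w -> v_conv w e l ->
    w l * w z < 1 -> \forall r \near \oo, w (e r * z) < 1.
  move=> aw he lz; have d0 : 0 < (1 - w l * w z) / (w z + 1).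
    by rewrite divr_gt0 ?subr_gt0 // ltr_wpDl // av_ge0.
  have wz1 : 0 < w z + 1 by rewrite ltr_wpDl // av_ge0.
  have := (v_nullP aw _).1 he _ d0; apply: filterS => r hr.
  rewrite -[e r](subrK l) mulrDl; apply: le_lt_trans (av_leD aw _ _) _.
  rewrite !(avM aw) -ltrBrDr; apply: (@le_lt_trans _ _ (w (e r - l) * (w z + 1))).
    by rewrite ler_wpM2l ?av_ge0 // lerDl.
  by rewrite -ltr_pdivlMr.
have [un1|un1] := leP (u n x) 1.
  have h : \forall r \near \oo, forall i, (i < n)%N -> u i (x ^+ r * y) < 1.
    apply: near_forall_lt => i hi; have ui := au i (ltnW hi).
    apply: (close (u i) y 0) => //; last by rewrite av0 // mul0r.
    by apply: v_null_ext (v_null_expr ui (ux i hi)) => r; rewrite subr0.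
  have [r _ /(_ r (leqnn r)) /= hr] := h.
  exists (x ^+ r * y); split.
    rewrite avM // avX // (lt_le_trans vy) // ler_peMl ?av_ge0 //.
    by rewrite exprn_ege1 // ltW.
  move=> i; rewrite ltnS leq_eqVlt => /orP[/eqP ->|]; last exact: hr.
  rewrite avM // avX // (le_lt_trans _ uy) // ler_piMl ?av_ge0 //.
  by rewrite exprn_ile1 ?av_ge0.
pose e r := x ^+ r / (1 + x ^+ r).
have h1 : \forall r \near \oo, forall i, (i < n)%N -> u i (e r * y) < 1.
  apply: near_forall_lt => i hi; have ui := au i (ltnW hi).
  apply: (close (u i) y 0) => //; last by rewrite av0 // mul0r.
  by apply: v_null_ext (v_null_expr_frac ui (ux i hi)) => r; rewrite subr0.
have h2 : \forall r \near \oo, u n (e r * y) < 1.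
  by apply: (close (u n) y 1) => //; [exact: v_conv_expr_frac | rewrite av1 // mul1r].
have h3 : \forall r \near \oo, 1 < v (e r * y).
  have d0 : 0 < (v y - 1) / v y by rewrite divr_gt0 ?subr_gt0 // (lt_trans _ vy).
  have vy0 : 0 < v y by apply: lt_trans vy.
  have := (v_nullP av _).1 (v_conv_expr_frac av vx) _ d0; apply: filterS => r.
  rewrite ltr_pdivlMr // -avM // mulrBl mul1r => hr.
  have := av_leB av y (y - e r * y); rewrite subKr (av_distC av) => h.
  by apply: lt_le_trans h; rewrite -/(e r) in hr; lra.
have [r _ /(_ r (leqnn r)) /= [[g1 g2] g3]] := filterI (filterI h1 h2) h3.
exists (e r * y); split=> // i; rewrite ltnS leq_eqVlt => /orP[/eqP -> //|]; exact: g1.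
Qed.

End WeakApproximation.

(** * Embeddings of a number field *)

Section PrimitiveElement.
Variable K : fieldExtType rat.

Local Notation d := (\dim {:K}).
Local Notation evalK h x := (map_poly (in_alg K) h).[x].

(** Up to a constant [f] is the minimal polynomial of a generator, taken with coefficients in [rat]
    rather than in a subfield of [K]. *)
Definition primitive_with (alpha : K) (f : {poly rat}) : Prop :=
  [/\ size f = d.+1, separable_poly f,
      forall h, root (map_poly (in_alg K) h) alpha -> f %| h &
      forall x, exists2 h : {poly rat}, (size h <= d)%N & x = evalK h alpha].

Lemma ex_primitive : exists alpha f, primitive_with alpha f.
Proof.
pose a := separable_generator 1%AS {:K}%AS.
have ch0 : [pchar K] =i pred0.
  by move=> p; rewrite pchar_lalg; exact: (pchar_num rat).
have e : ({:K} = <<1; a>>)%VS.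
  apply: eq_adjoin_separable_generator; last exact: sub1v.
  by apply/separableP => y _; exact: pcharf0_separable.
have /polyOver1P[f ef] := minPolyOver 1%AS a.
have deg : adjoin_degree 1%AS a = d.
  by have := dim_Fadjoin 1%AS a; rewrite -e dimv1 muln1 => ->.
exists a, f; split.
- by rewrite -(size_map_poly (in_alg K)) -ef size_minPoly deg.
- by rewrite -(separable_map (in_alg K)) -ef; exact: pcharf0_separable.
- move=> h ha; rewrite -(dvdp_map (in_alg K)) -ef minPoly_dvdp //.
  by apply/polyOver1P; exists h.
move=> x; have xa : x \in <<1; a>>%VS by rewrite -e memvf.
have /polyOver1P[h eh] := Fadjoin_polyOver 1%AS a x.
exists h; last by rewrite -eh Fadjoin_poly_eq.
by rewrite -(size_map_poly (in_alg K)) -eh -deg size_Fadjoin_poly.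
Qed.

Section WithPrimitive.
Variables (alpha : K) (f : {poly rat}).
Hypothesis prim : primitive_with alpha f.

Lemma rmorph_in_alg (L : numFieldType) (tau : {rmorphism K -> L}) q :
  tau (q%:A) = ratr q.
Proof. exact: (fmorph_eq_rat (tau \o in_alg K)). Qed.

Lemma rmorph_evalK (L : numFieldType) (tau : {rmorphism K -> L}) (h : {poly rat}) x :
  tau (evalK h x) = (map_poly ratr h).[tau x].
Proof.
rewrite -horner_map -map_poly_comp; congr (_.[_]); apply: eq_map_poly => q.
exact: rmorph_in_alg.
Qed.

Lemma embedding_of_root (L : numFieldType) (r : L) : root (map_poly ratr f) r ->
  exists tau : {rmorphism K -> L}, tau alpha = r.
Proof.
case: prim => _ _ dvd gen rf.
have /choice[h hh] : forall x, exists h, x = evalK h alpha.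
  by move=> x; have [h _ e] := gen x; exists h.
pose t x := (map_poly ratr (h x)).[r].
(* The value at [r] is independent of the polynomial representing [x]: two of them differ by a
   multiple of [f]. *)
have tE x g : x = evalK g alpha -> t x = (map_poly ratr g).[r].
  move=> e; have /dvd/dvdpP[q eq] : root (map_poly (in_alg K) (h x - g)) alpha.
    by rewrite rootE rmorphB /= hornerD hornerN -hh -e subrr.
  apply/eqP; rewrite /t -subr_eq0 -hornerN -hornerD -rmorphB /= eq rmorphM /=.
  by rewrite hornerM (rootP rf) mulr0.
have tB : zmod_morphism t.
  move=> x y; rewrite (tE (x - y) (h x - h y)); last first.
    by rewrite rmorphB /= hornerD hornerN -!hh.
  by rewrite rmorphB /= hornerD hornerN.
have tM : monoid_morphism t.
  split=> [|x y]; first by rewrite (tE 1 1) ?rmorph1 ?hornerC.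
  rewrite (tE (x * y) (h x * h y)); last by rewrite rmorphM /= hornerM -!hh.
  by rewrite rmorphM /= hornerM.
pose T : {rmorphism K -> L} := HB.pack t (GRing.isZmodMorphism.Build _ _ t tB)
  (GRing.isMonoidMorphism.Build _ _ t tM).
exists T => /=; rewrite (tE alpha 'X) ?map_polyX ?hornerX //.
Qed.

Lemma ex_embeddings (L : numClosedFieldType) :
  exists tau : 'I_d -> {rmorphism K -> L}, injective (fun i => tau i alpha).
Proof.
case: (prim) => sf sepf _ _.
have [r er] := closed_field_poly_normal (map_poly ratr f : {poly L}).
have lf : lead_coef (map_poly ratr f : {poly L}) != 0.
  by rewrite lead_coef_eq0 map_poly_eq0 -size_poly_gt0 sf.
have sr : size r = d.
  have := congr1 (fun p : {poly L} => size p) er.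
  by rewrite size_map_poly sf size_scale // size_prod_XsubC => -[].
have ur : uniq r.
  rewrite -separable_prod_XsubC; move: sepf; rewrite -(separable_map (ratr : rat -> L)) er.
  by apply: dvdp_separable; rewrite dvdpZr.
have rt (i : 'I_d) : exists tau : {rmorphism K -> L}, tau alpha = r`_i.
  apply: embedding_of_root; rewrite er rootZ // root_prod_XsubC mem_nth //.
  by rewrite sr.
have [tau htau] := choice rt; exists tau => i j; rewrite !htau => /eqP.
by rewrite nth_uniq ?sr // => /eqP/val_inj.
Qed.

(* The characteristic polynomial of multiplication by y, which is diagonal in
   the basis of the columns of a Vandermonde matrix. *)
Lemma ex_char_poly (y : K) : exists F : {poly rat},
  forall (L : numClosedFieldType) (tau : 'I_d -> {rmorphism K -> L}),
    injective (fun i => tau i alpha) ->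
    map_poly ratr F = \prod_(i < d) ('X - (tau i y)%:P).
Proof.
case: (prim) => _ _ _ gen.
have /choice[h hh] : forall i : 'I_d, exists h : {poly rat},
    (size h <= d)%N /\ y * alpha ^+ i = evalK h alpha.
  by move=> i; have [h s e] := gen (y * alpha ^+ i); exists h.
pose M : 'M[rat]_d := \matrix_(i, j) (h i)`_j.
exists (char_poly M) => L tau inj; rewrite map_char_poly.
pose a : 'rV[L]_d := \row_i tau i alpha.
pose V := Vandermonde d a; pose D := diag_mx (\row_i tau i y : 'rV[L]_d).
set A := map_mx _ _.
have AV : A *m V = V *m D.
  apply/matrixP => i j; rewrite mul_mx_diag !mxE.
  have [sh e] := hh i; move/(congr1 (tau j)): e.
  rewrite rmorph_evalK rmorphM rmorphXn /= mulrC => ->.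
  rewrite (horner_coef_wide _ (n := d)) ?size_map_poly //.
  by apply: eq_bigr => k _; rewrite !mxE coef_map.
have V0 : \det V != 0.
  rewrite det_Vandermonde; apply/prodf_neq0 => i _; apply/prodf_neq0 => j ij.
  rewrite !mxE subr_eq0; apply: contraTneq ij => /inj ->.
  by rewrite ltnn.
pose Vp := map_mx polyC V.
have Vp0 : \det Vp != 0 by rewrite det_map_mx polyC_eq0.
have eq : char_poly_mx A *m Vp = Vp *m char_poly_mx D.
  rewrite /char_poly_mx mulmxBl mulmxBr -!map_mxM AV.
  by rewrite mul_scalar_mx mul_mx_scalar.
have : char_poly A * \det Vp = char_poly D * \det Vp.
  by rewrite /char_poly -det_mulmx eq det_mulmx mulrC.
move/(mulIf Vp0) ->; rewrite char_poly_trig; last first.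
  by apply: diag_mx_is_trig.
by apply: eq_bigr => i _; rewrite !mxE eqxx.
Qed.

End WithPrimitive.
End PrimitiveElement.

(** * Places above a place of the rationals and local degrees *)

Lemma absolute_value_restrictQ (R : realType) (K : fieldExtType rat) (v : K -> R) :
  absolute_value v -> absolute_value (restrictQ v).
Proof. exact: (absolute_value_comp (in_alg K)). Qed.

Lemma scale_in_alg (K : fieldExtType rat) (q : rat) (x : K) : q *: x = q%:A * x.
Proof. by rewrite mulr_algl. Qed.

Section BasisSize.
Variables (R : realType) (K : fieldExtType rat) (v : K -> R).
Hypothesis av : absolute_value v.

(** The matrices [A_k], [B_k] expressing each family in the other are only Cauchy in [k], but
    [1 - A_k B_k] tends to 0 by the independence of [e]. If [n' < n], some non-zero [c] has
    [c A_k B_k = 0], so [c = c (1 - A_k B_k)]. This fails at the largest entry of [c] once all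
    entries of [1 - A_k B_k] are below [1 / (n + 1)]. *)
Lemma completion_basis_le n n' (e : 'I_n -> nat -> K) (e' : 'I_n' -> nat -> K) :
  completion_basis v e -> completion_basis v e' -> (n <= n')%N.
Proof.
move=> [ce se ie] [ce' se' ie']; rewrite leqNgt; apply/negP => nn'.
have aw := absolute_value_restrictQ av.
have /choice[A hA] : forall i : 'I_n, exists a : 'I_n' -> nat -> rat,
    (forall j, v_cauchy (restrictQ v) (a j)) /\
    v_null v (fun k => e i k - \sum_(j < n') a j k *: e' j k).
  by move=> i; have [a h1 h2] := se' _ (ce i); exists a.
have /choice[B hB] : forall i : 'I_n', exists a : 'I_n -> nat -> rat,
    (forall j, v_cauchy (restrictQ v) (a j)) /\
    v_null v (fun k => e' i k - \sum_(j < n) a j k *: e j k).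
  by move=> i; have [a h1 h2] := se _ (ce' i); exists a.
pose AB i i' k := \sum_(j < n') A i j k * B j i' k.
pose D i i' k : rat := (i == i')%:R + (- 1) * AB i i' k.
have D0 i i' : v_null (restrictQ v) (D i i').
  apply: (ie (D i)) => {i'}[i'|].
    apply: v_cauchyD => //; first exact: v_cauchy_cst.
    apply: v_cauchyM => //; first exact: v_cauchy_cst.
    apply: v_cauchy_sum => // j; apply: v_cauchyM => //.
      exact: (hA i).1.
    exact: (hB j).1.
  have h1 := (hA i).2.
  have h2 : v_null v (fun k => \sum_(j < n') (A i j k)%:A *
      (e' j k - \sum_(i' < n) B j i' k *: e i' k)).
    apply: v_null_sum => // j; have [C hC] := v_cauchy_bounded aw ((hA i).1 j).
    exact: (v_null_mull av hC (hB j).2).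
  apply: v_null_ext (v_nullD av h1 h2) => k.
  rewrite (eq_bigr (fun i' => (i == i')%:R *: e i' k - AB i i' k *: e i' k)); last first.
    by move=> i' _; rewrite /D mulN1r scalerBl.
  rewrite sumrB; have -> : \sum_(i' < n) (i == i')%:R *: e i' k = e i k.
    rewrite (bigD1 i) //= eqxx scale1r big1 ?addr0 // => i'.
    by rewrite eq_sym => /negPf ->; rewrite scale0r.
  have -> : \sum_(i' < n) AB i i' k *: e i' k =
      \sum_(j < n') A i j k *: (\sum_(i' < n) B j i' k *: e i' k).
    under eq_bigr => i' _ do rewrite scaler_suml.
    rewrite exchange_big; apply: eq_bigr => j _; rewrite scaler_sumr.
    by apply: eq_bigr => i' _; rewrite scalerA.
  rewrite -addrA; congr (_ + _); rewrite addrC -sumrB -sumrN; apply: eq_bigr => j _.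
  by rewrite mulr_algl scalerBr addrAC subrr add0r.
have n0 : (0 < n)%N by apply: leq_ltn_trans nn'.
have eps0 : 0 < (n.+1%:R : R)^-1 by rewrite invr_gt0 ltr0n.
have [k hk] : exists k, forall i i', restrictQ v (D i i' k) < n.+1%:R^-1.
  have h : \forall k \near \oo, forall i, (i < n)%N -> forall i', (i' < n)%N ->
      forall (hi : (i < n)%N) (hi' : (i' < n)%N),
      restrictQ v (D (Ordinal hi) (Ordinal hi') k) < n.+1%:R^-1.
    apply: near_forall_lt => i hi; apply: near_forall_lt => i' hi'.
    have := (v_nullP aw _).1 (D0 (Ordinal hi) (Ordinal hi')) _ eps0.
    apply: filterS => k h hi2 hi2'.
    by rewrite (bool_irrelevance hi2 hi) (bool_irrelevance hi2' hi').
  have [k _ /(_ k (leqnn k)) /= h'] := h; exists k => [[i hi] [i' hi']].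
  exact: h'.
pose MA := \matrix_(i < n, j < n') A i j k; pose MB := \matrix_(j < n', i < n) B j i k.
have : ~~ row_free (MA *m MB).
  rewrite /row_free neq_ltn; apply/orP; left.
  by apply: leq_ltn_trans (mxrankM_maxl _ _) _; apply: leq_ltn_trans (rank_leq_col _) _.
rewrite -kermx_eq0 => /rowV0Pn[c /sub_kermxP cM c0].
have cE j : c 0 j = \sum_i c 0 i * D i j k.
  have : c = c *m (1%:M - MA *m MB) by rewrite mulmxBr mulmx1 cM subr0.
  move/matrixP => /(_ 0 j) {1}->; rewrite mxE; apply: eq_bigr => i _.
  rewrite /D mulN1r !mxE; congr (_ * (_ - _)).
  by apply: eq_bigr => s _; rewrite !mxE.
pose w := restrictQ v.
have [j _ hj] := @arg_maxP _ _ _ (Ordinal n0) xpredT (fun i => w (c 0 i)) isT.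
have wj : 0 < w (c 0 j).
  rewrite lt0r av_ge0 // andbT; apply: contraNneq c0 => ej.
  apply/eqP/rowP => i; rewrite mxE; apply/eqP; rewrite -(av_eq0 aw) eq_le av_ge0 // andbT.
  by rewrite -/w -ej; exact: hj.
have : w (c 0 j) <= \sum_(i < n) w (c 0 j) * n.+1%:R^-1.
  rewrite {1}cE; apply: le_trans (av_le_sum aw _ _ _) _; apply: ler_sum => i _.
  rewrite avM // ler_pM ?av_ge0 //; first exact: hj.
  exact/ltW/hk.
rewrite sumr_const card_ord -mulrnAr ler_pMr // leNgt => /negP; apply.
by rewrite -[_ *+ n]mulr_natl ltr_pdivrMr ?ltr0n // mul1r ltr_nat.
Qed.

Lemma local_degree_eq n (e : 'I_n -> nat -> K) :
  completion_basis v e -> local_degree v = n.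
Proof.
move=> he; rewrite /local_degree; case: xgetP => [m _ [e' he']|].
  apply/eqP; rewrite eqn_leq.
  by rewrite (completion_basis_le he' he) (completion_basis_le he he').
by move=> /(_ n) []; exists e.
Qed.

End BasisSize.

Section LocalDegree.
Variables (R : realType) (K : fieldExtType rat).
Variables (alpha : K) (f : {poly rat}).
Hypothesis prim : primitive_with alpha f.
Local Notation d := (\dim {:K}).
Variables (L : numClosedFieldType) (tau : 'I_d -> {rmorphism K -> L}).
Hypothesis tau_inj : injective (fun i => tau i alpha).
Variables (u : L -> R) (c : rat).
Hypothesis au : absolute_value u.
Hypothesis c1 : 1 < u (ratr c).

Lemma av_embedding i : absolute_value (u \o tau i).
Proof. exact: absolute_value_comp. Qed.

(** Otherwise weak approximation gives [y] with [v y > 1] and all [u (tau i y) < 1]. The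
    characteristic polynomial of [y^N] tends to [X^d], so [y^N] is a root of a monic rational
    polynomial whose other coefficients are small, contradicting [v (y^N) >= 1]. A high power is
    taken because the symmetric functions of the [tau i y] themselves may be large. *)
Lemma place_embedding (v : K -> R) : absolute_value v ->
  (forall q : rat, v q%:A = u (ratr q)) -> exists i, v = u \o tau i.
Proof.
move=> av vq; apply: contrapT => nex.
have d0 : (0 < d)%N by exact: adim_gt0.
pose i0 : 'I_d := Ordinal d0.
pose us n := u \o tau (insubd i0 n).
have [||||y [vy uy]] := @weak_approximation R K v d us c%:A av.
- by move=> i _; exact: av_embedding.
- by rewrite vq.
- by move=> i _; rewrite /us /= rmorph_in_alg vq.
- move=> i _; apply: contrapT => h; apply: nex; exists (insubd i0 i).
  by apply/funext => a; apply: contrapT => ha; apply: h; exists a; apply/eqP.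
have {}uy (i : 'I_d) : u (tau i y) < 1.
  by have := uy i (ltn_ord i); rewrite /us /= valKd.
have /choice[F hF] := fun N => ex_char_poly prim (y ^+ N).
have {}hF N := hF N L tau tau_inj.
have coefF j : v_conv u (fun N => ratr (F N)`_j) ('X^d : {poly L})`_j.
  have := @v_conv_coef_prod R L u au _ (index_enum 'I_d)
    (fun i N => 'X - (tau i (y ^+ N))%:P) (fun i => 'X) _ j.
  rewrite prodr_const card_ord => h; apply: v_null_ext (h _) => [N|i s].
    by rewrite -hF coef_map.
  apply: (v_null_le au (C := 1) (v_null_expr au (uy i))); near=> N.
  rewrite coefB coefC addrAC subrr add0r (avN au) mul1r rmorphXn /=.
  by case: (s == _); rewrite /= ?av0 ?av_ge0.
have sF N : size (F N) = d.+1.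
  by rewrite -(size_map_poly (ratr : {rmorphism rat -> L})) hF size_prod_XsubC
     [size _](_ : _ = d) // /index_enum -enumT size_enum_ord.
have lF N : (F N)`_d = 1.
  apply: (fmorph_inj (ratr : {rmorphism rat -> L})); rewrite rmorph1 -coef_map hF.
  have := lead_coef_prod_XsubC (index_enum 'I_d) xpredT (fun i => tau i (y ^+ N)).
  by rewrite /lead_coef -hF size_map_poly sF.
have rF N : y ^+ N ^+ d = - \sum_(j < d) (F N)`_j *: (y ^+ N) ^+ j.
  have : (map_poly (in_alg K) (F N)).[y ^+ N] = 0.
    apply: (fmorph_inj (tau i0)); rewrite rmorph0 rmorph_evalK hF horner_prod.
    by rewrite (bigD1 i0) //= hornerXsubC subrr mul0r.
  rewrite horner_coef size_map_poly sF big_ord_recr /= coef_map lF /= scale1r mul1r.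
  rewrite addrC => /eqP; rewrite addr_eq0 => /eqP ->; congr (- _).
  by apply: eq_bigr => j _; rewrite coef_map /= mulr_algl.
have eps0 : 0 < (d.+1%:R : R)^-1 by rewrite invr_gt0 ltr0n.
have [N hN] : exists N, forall j, (j < d)%N -> u (ratr (F N)`_j) < d.+1%:R^-1.
  have h : \forall N \near \oo, forall j, (j < d)%N -> u (ratr (F N)`_j) < d.+1%:R^-1.
    apply: near_forall_lt => j jd; have := (v_nullP au _).1 (coefF j) _ eps0.
    by rewrite coefXn ltn_eqF //; apply: filterS => N; rewrite subr0.
  by have [N _ /(_ N (leqnn N)) /= h'] := h; exists N.
pose t := v (y ^+ N).
have t1 : 1 <= t by rewrite /t avX // exprn_ege1 // ltW.
have t0 : 0 < t by apply: lt_le_trans t1.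
have : t ^+ d <= \sum_(j < d) d.+1%:R^-1 * t ^+ d.
  rewrite [leLHS](_ : _ = v (\sum_(j < d) (F N)`_j *: (y ^+ N) ^+ j)); last first.
    by rewrite /t -(avX av) rF (avN av).
  apply: le_trans (av_le_sum av _ _ _) _.
  apply: ler_sum => j _; rewrite scale_in_alg avM // ler_pM ?av_ge0 //.
    by rewrite vq ltW // hN.
  by rewrite (avX av) -/t ler_weXn2l // ltnW.
rewrite sumr_const card_ord -mulrnAl ler_pMl ?exprn_gt0 // leNgt => /negP; apply.
by rewrite -[_ *+ d]mulr_natl ltr_pdivrMr ?ltr0n // mul1r ltr_nat.
Unshelve. all: by end_near. Qed.

Section Fixed.
Variable i0 : 'I_d.
Let v : K -> R := u \o tau i0.
Let T := [set j : 'I_d | `[< u \o tau j = v >]]%SET.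
Let m := #|T|.
Let av : absolute_value v := av_embedding i0.

Lemma same_place_refl : i0 \in T.
Proof. by rewrite inE; apply/asboolP. Qed.

Lemma av_same_place j x : j \in T -> u (tau j x) = v x.
Proof. by rewrite inE => /asboolP <-. Qed.

Lemma av_embedding_in_alg q : v q%:A = u (ratr q).
Proof. by rewrite /v /= rmorph_in_alg. Qed.

Let pow_sum (a : 'I_m -> rat) := \sum_(i < m) a i *: alpha ^+ i.

(** The embeddings in [T] all induce [v]. Applied to [pow_sum a] they give [m] linear equations for
    the [a i] with an invertible Vandermonde matrix. This yields independence, and also that
    coordinates of Cauchy sequences are Cauchy. *)
Lemma vandermonde_bound : exists C, forall (a : 'I_m -> rat) i,
  u (ratr (a i)) <= C * v (pow_sum a).
Proof.
pose s (j : 'I_m) : 'I_d := enum_val j.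
have sT j : s j \in T by exact: enum_valP.
pose V : 'M[L]_m := Vandermonde m (\row_j tau (s j) alpha).
have V0 : V \in unitmx.
  rewrite unitmxE unitfE det_Vandermonde; apply/prodf_neq0 => i _; apply/prodf_neq0 => j ij.
  rewrite !mxE subr_eq0; apply: contraTneq ij => /tau_inj/enum_val_inj ->.
  by rewrite ltnn.
exists (\sum_i \sum_j u (invmx V j i)) => a i.
pose r : 'rV[L]_m := \row_i ratr (a i).
have e : r *m V = \row_j tau (s j) (pow_sum a).
  apply/rowP => j; rewrite !mxE /pow_sum rmorph_sum /=; apply: eq_bigr => k _.
  by rewrite !mxE scale_in_alg rmorphM rmorph_in_alg rmorphXn.
have -> : ratr (a i) = \sum_j tau (s j) (pow_sum a) * invmx V j i.
  have : r = (r *m V) *m invmx V by rewrite mulmxK.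
  move/rowP/(_ i); rewrite e !mxE => ->; by apply: eq_bigr => j _; rewrite !mxE.
apply: le_trans (av_le_sum au _ _ _) _.
rewrite (eq_bigr (fun j => v (pow_sum a) * u (invmx V j i))); last first.
  by move=> j _; rewrite avM // av_same_place.
rewrite -mulr_sumr mulrC ler_wpM2r ?av_ge0 //.
rewrite [leRHS](bigD1 i) //= lerDl sumr_ge0 // => k _; apply: sumr_ge0 => j _.
exact: av_ge0.
Qed.

Let g : {poly L} := \prod_(j in T) ('X - (tau j alpha)%:P).

(** [g] is the local factor of [f] which belongs to [v]. With [y] above 1 at [v] and below 1 at the
    embeddings outside [T], [y^k / (1 + y^k)] approximates the indicator of [T]. Hence the
    characteristic polynomial of its product with [alpha], which is rational, tends to
    [g * X^(d - m)]. *)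
Lemma local_factor_coef_limit : exists gam : nat -> nat -> rat,
  forall i, v_conv u (fun k => ratr (gam i k)) g`_i.
Proof.
pose s := enum (~: T).
pose us n := u \o tau (nth i0 s n).
have sT n : (n < size s)%N -> nth i0 s n \notin T.
  by move=> h; have := mem_nth i0 h; rewrite mem_enum inE.
have [||||y [vy uy]] := @weak_approximation R K v (size s) us c%:A av.
- by move=> i _; exact: av_embedding.
- by rewrite av_embedding_in_alg.
- by move=> i _; rewrite /us /= rmorph_in_alg av_embedding_in_alg.
- move=> i /sT h; apply: contrapT => h'; move: h; rewrite inE => /asboolP; apply.
  by apply/funext => a; apply: contrapT => ha; apply: h'; exists a; apply/eqP => e; apply: ha.
have {}uy j : j \notin T -> u (tau j y) < 1.
  move=> jT; have js : j \in s by rewrite mem_enum inE.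
  by have := uy (index j s); rewrite index_mem js /us /= nth_index //; exact.
have /choice[F hF] := fun k => ex_char_poly prim (alpha * (y ^+ k / (1 + y ^+ k))).
have {}hF k := hF k L tau tau_inj.
exists (fun i k => (F k)`_(i + (d - m))) => i.
pose b j : L := (j \in T)%:R * tau j alpha.
have eg : \prod_(j < d) ('X - (b j)%:P) = g * 'X^(d - m).
  rewrite (bigID (mem T)) /=; congr (_ * _).
    by apply: eq_bigr => j jT; rewrite /b jT mul1r.
  rewrite (eq_bigr (fun _ => 'X)); last by move=> j /negPf jT; rewrite /b jT mul0r subr0.
  rewrite prodr_const (_ : (d - m)%N = #|[predC T]|); first by congr ('X^_); apply: eq_card.
  have aux (p q n : nat) : (p + q = n -> n - p = q)%N by lia.
  exact: aux (etrans (cardC T) (card_ord _)).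
have := @v_conv_coef_prod R L u au _ (index_enum 'I_d)
  (fun j k => 'X - (tau j (alpha * (y ^+ k / (1 + y ^+ k))))%:P)
  (fun j => 'X - (b j)%:P) _ (i + (d - m))%N.
rewrite eg coefMXn ltnNge leq_addl /= addnK => h.
apply: v_null_ext (h _) => [k|j q].
  by rewrite -hF coef_map.
rewrite coefB coefC.
suff hb : v_conv u (fun k => tau j (alpha * (y ^+ k / (1 + y ^+ k)))) (b j).
  apply: (v_null_le au (C := 1) hb); near=> k; rewrite mul1r coefB coefC.
  case: (q == 0%N); last by rewrite !subr0 subrr av0 // av_ge0.
  by rewrite av_distC // (_ : _ - _ = tau j (alpha * (y ^+ k / (1 + y ^+ k))) - b j) //; ring.
have e k : tau j (alpha * (y ^+ k / (1 + y ^+ k))) =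
    tau j alpha * (tau j y ^+ k / (1 + tau j y ^+ k)).
  by rewrite rmorphM fmorph_div rmorphD rmorph1 rmorphXn.
rewrite /b mulrC; apply: v_null_ext (v_convM au (v_conv_cst au (tau j alpha))
    (_ : v_conv u (fun k => tau j y ^+ k / (1 + tau j y ^+ k)) (j \in T)%:R)) => [k|].
  by rewrite e.
case jT: (j \in T); first by apply: v_conv_expr_frac => //; rewrite av_same_place.
apply: v_null_ext (v_null_expr_frac au (uy j _)) => [k|]; first by rewrite subr0.
by rewrite jT.
Unshelve. all: by end_near. Qed.

Let approximable x := forall e : R, 0 < e -> exists a : 'I_m -> rat, v (x - pow_sum a) < e.

Lemma approximable_lim x : (forall e : R, 0 < e -> exists y, approximable y /\ v (x - y) < e) ->
  approximable x.
Proof.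
move=> h e e0; have e2 : 0 < e / 2 by rewrite divr_gt0.
have [y [/(_ _ e2)[a ha] xy]] := h _ e2; exists a.
rewrite -[x](subrK y) -addrA (splitr e); apply: le_lt_trans (av_leD av _ _) _.
exact: ltrD.
Qed.

Lemma approximableD x y : approximable x -> approximable y -> approximable (x + y).
Proof.
move=> hx hy e e0; have e2 : 0 < e / 2 by rewrite divr_gt0.
have [a ha] := hx _ e2; have [b hb] := hy _ e2; exists (fun i => a i + b i).
have -> : pow_sum (fun i => a i + b i) = pow_sum a + pow_sum b.
  by rewrite /pow_sum -big_split; apply: eq_bigr => i _; rewrite scalerDl.
rewrite opprD addrACA (splitr e); apply: le_lt_trans (av_leD av _ _) _.
exact: ltrD.
Qed.

Lemma approximable_sum (I : Type) (r : seq I) (x : I -> K) :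
  (forall i, approximable (x i)) -> approximable (\sum_(i <- r) x i).
Proof.
move=> h; elim: r => [|i r IH]; last by rewrite big_cons; exact: approximableD.
rewrite big_nil => e e0; exists (fun _ => 0).
by rewrite /pow_sum big1 ?subrr ?av0 // => i _; rewrite scale0r.
Qed.

Lemma approximableZ q x : approximable x -> approximable (q *: x).
Proof.
move=> hx e e0; have q0 : 0 < v q%:A + 1 by rewrite ltr_wpDl // av_ge0.
have [|a ha] := hx (e / (v q%:A + 1)); first by rewrite divr_gt0.
exists (fun i => q * a i).
have -> : pow_sum (fun i => q * a i) = q *: pow_sum a.
  by rewrite /pow_sum scaler_sumr; apply: eq_bigr => i _; rewrite scalerA.
rewrite -scalerBr scale_in_alg avM //.
apply: (@le_lt_trans _ _ ((v q%:A + 1) * v (x - pow_sum a))).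
  by rewrite ler_wpM2r ?av_ge0 // lerDl.
by rewrite -ltr_pdivlMl // mulrC.
Qed.

Lemma approximable_exp_lt i : (i < m)%N -> approximable (alpha ^+ i).
Proof.
move=> im e e0; exists (fun j => (j == Ordinal im)%:R).
rewrite /pow_sum (bigD1 (Ordinal im)) //= eqxx scale1r big1 ?addr0 ?subrr ?av0 //.
by move=> j /negPf ->; rewrite scale0r.
Qed.

(** [g] vanishes at [tau i0 alpha]; with rational approximations to its coefficients, [alpha^m] is
    nearly a combination of lower powers. *)
Lemma approximable_exp_m : approximable (alpha ^+ m).
Proof.
have [gam hg] := local_factor_coef_limit; pose t := tau i0 alpha.
have sg : size g = m.+1.
  by rewrite /g -big_enum size_prod_XsubC -cardE.
have gt0 : g.[t] = 0.
  by rewrite /g horner_prod (bigD1 i0) ?same_place_refl //= hornerXsubC subrr mul0r.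
have gm : g`_m = 1.
  by have : g \is monic; [exact: monic_prod_XsubC | rewrite monicE /lead_coef sg => /eqP].
have lim : v_conv u (fun k => t ^+ m + \sum_(i < m) ratr (gam i k) * t ^+ i) g.[t].
  rewrite horner_coef sg big_ord_recr /= gm mul1r addrC.
  apply: v_convD => //; first exact: v_conv_cst.
  by apply: v_conv_sum => // i; apply: v_convM => //; exact: v_conv_cst.
move=> e e0; rewrite gt0 in lim.
have [k _ /(_ k (leqnn k)) /=] := (v_nullP au _).1 lim _ e0; rewrite subr0 => hk.
exists (fun i => - gam i k); rewrite /v /= rmorphB rmorphXn /pow_sum rmorph_sum /=.
rewrite (eq_bigr (fun i : 'I_m => - (ratr (gam i k) * t ^+ i))); last first.
  by move=> i _; rewrite scale_in_alg rmorphM rmorph_in_alg rmorphXn rmorphN mulNr.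
by rewrite sumrN opprK.
Qed.

Lemma approximable_mul x : approximable x -> approximable (alpha * x).
Proof.
move=> hx; apply: approximable_lim => e e0.
have q0 : 0 < v alpha + 1 by rewrite ltr_wpDl // av_ge0.
have [|a ha] := hx (e / (v alpha + 1)); first by rewrite divr_gt0.
exists (alpha * pow_sum a); split; last first.
  rewrite -mulrBr avM //; apply: (@le_lt_trans _ _ ((v alpha + 1) * v (x - pow_sum a))).
    by rewrite ler_wpM2r ?av_ge0 // lerDl.
  by rewrite -ltr_pdivlMl // mulrC.
rewrite /pow_sum mulr_sumr; apply: approximable_sum => i.
rewrite -scalerAr -exprS; apply: approximableZ.
have := ltn_ord i; rewrite leq_eqVlt => /orP[/eqP ->|]; first exact: approximable_exp_m.
exact: approximable_exp_lt.
Qed.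

Lemma same_place_gt0 : (0 < m)%N.
Proof. by apply/card_gt0P; exists i0; exact: same_place_refl. Qed.

Lemma approximable_all x : approximable x.
Proof.
have hpow j : approximable (alpha ^+ j).
  elim: j => [|j IH]; first exact: approximable_exp_lt same_place_gt0.
  by rewrite exprS; exact: approximable_mul.
case: prim => _ _ _ /(_ x) [h _ ->]; rewrite horner_coef.
apply: approximable_sum => j; rewrite coef_map /= mulr_algl.
exact: approximableZ (hpow j).
Qed.

(** Density of the rational combinations gives spanning; [vandermonde_bound] carries convergence
    from elements to coordinates. *)
Lemma power_basis : completion_basis v (fun (i : 'I_m) _ => alpha ^+ i).
Proof.
have [C hC] := vandermonde_bound; split.
- by move=> i; exact: v_cauchy_cst.
- move=> x cx.
  have /choice[a ha] : forall k, exists a : 'I_m -> rat, v (x k - pow_sum a) < k.+1%:R^-1.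
    by move=> k; apply: approximable_all; rewrite invr_gt0 ltr0n.
  have nul : v_null v (fun k => x k - pow_sum (a k)).
    apply/v_nullP => // e e0; near=> k; apply: lt_trans (ha k) _.
    near: k; exact: (near_infty_natSinv_lt (PosNum e0)).
  exists (fun i k => a k i) => // i e e0.
  have C0 : 0 < `|C| + 1 by rewrite ltr_wpDl.
  have e3 : 0 < e / (`|C| + 1) / 3 by rewrite !divr_gt0.
  have [N hN] := cx _ e3; have [M _ hM] := (v_nullP av _).1 nul _ e3.
  exists (maxn N M) => j k; rewrite !geq_max => /andP[j1 j2] /andP[k1 k2].
  have hj := hM j j2; have hk := hM k k2; have hjk := hN j k j1 k1.
  rewrite /restrictQ av_embedding_in_alg; apply: le_lt_trans (hC (fun i => a j i - a k i) i) _.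
  have -> : pow_sum (fun i => a j i - a k i) = pow_sum (a j) - pow_sum (a k).
    by rewrite /pow_sum -sumrB; apply: eq_bigr => s _; rewrite scalerBl.
  apply: (@le_lt_trans _ _ ((`|C| + 1) * v (pow_sum (a j) - pow_sum (a k)))).
    by rewrite ler_wpM2r ?av_ge0 // (le_trans (ler_norm _)) // lerDl.
  rewrite -ltr_pdivlMl //.
  have -> : pow_sum (a j) - pow_sum (a k) =
      - (x j - pow_sum (a j)) + ((x j - x k) + (x k - pow_sum (a k))) by ring.
  apply: le_lt_trans (av_leD av _ _) _; rewrite avN //.
  have := av_leD av (x j - x k) (x k - pow_sum (a k)).
  by rewrite /= in hj hk; move: hj hk hjk; lra.
- move=> a _ nul i.
  have nul' : v_null v (fun k => pow_sum (fun i => a i k)) by [].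
  have aw := absolute_value_restrictQ av.
  apply/v_nullP => // e e0.
  have C0 : 0 < `|C| + 1 by rewrite ltr_wpDl.
  have e1 : 0 < e / (`|C| + 1) by rewrite divr_gt0.
  have := (v_nullP av _).1 nul' _ e1; apply: filterS => k hk.
  rewrite /restrictQ av_embedding_in_alg; apply: le_lt_trans (hC (fun i => a i k) i) _.
  apply: (@le_lt_trans _ _ ((`|C| + 1) * v (pow_sum (fun i => a i k)))).
    by rewrite ler_wpM2r ?av_ge0 // (le_trans (ler_norm _)) // lerDl.
  by rewrite -ltr_pdivlMl // mulrC.
Unshelve. all: by end_near. Qed.

Lemma local_degree_embedding :
  local_degree (u \o tau i0) = #|[set j | `[< u \o tau j = u \o tau i0 >]]%SET|.
Proof. exact: local_degree_eq power_basis. Qed.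

End Fixed.
End LocalDegree.

(** * Extension of the p-adic absolute value *)

Section ValuationRing.
Variables (F : numFieldType) (p : nat).
Hypothesis p_prime : prime p.
Local Notation P := (p%:R : F).

Definition subring_set (A : set F) : Prop :=
  [/\ A 1, forall x y, A x -> A y -> A (x - y) & forall x y, A x -> A y -> A (x * y)].

Let p0 : P != 0. Proof. by rewrite pnatr_eq0 -lt0n prime_gt0. Qed.

(** Such an [A] turns out to be a valuation ring above [p]. The empty set belongs to [Q] to cover
    chains with empty union; the integers then show that a maximal element is not empty. *)
Lemma ex_maximal_subring : exists A, [/\ subring_set A, ~ A P^-1 &
  forall B, subring_set B -> A `<=` B -> ~ B P^-1 -> B `<=` A].
Proof.
pose Q (A : set F) := A = set0 \/ (subring_set A /\ ~ A P^-1).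
have [C CQ totC|A [QA maxA]] := @Zorn_bigcup F Q.
  have [[X CX X0]|noX] := pselect (exists2 X, C X & X !=set0); last first.
    left; rewrite -subset0 => x [X CX Xx]; apply: noX; exists X => //; by exists x.
  have big Y x : C Y -> Y x -> subring_set Y /\ ~ Y P^-1.
    by move=> CY Yx; have [Y0|//] := CQ _ CY; rewrite Y0 in Yx.
  have two x y : (\bigcup_(Y in C) Y) x -> (\bigcup_(Y in C) Y) y ->
      exists Y, [/\ C Y, Y x & Y y].
    move=> [Y CY Yx] [Z CZ Zy]; have [YZ|ZY] := totC _ _ CY CZ.
      by exists Z; split=> //; exact: YZ.
    by exists Y; split=> //; exact: ZY.
  right; split; last first.
    by move=> [Y CY Yp]; have [_] := big _ _ CY Yp; apply.
  split.
  - have [x Xx] := X0; have [[X1 _ _] _] := big _ _ CX Xx; by exists X.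
  - move=> x y hx hy; have [Y [CY Yx Yy]] := two _ _ hx hy.
    have [[_ YB _] _] := big _ _ CY Yx; exists Y => //; exact: YB.
  - move=> x y hx hy; have [Y [CY Yx Yy]] := two _ _ hx hy.
    have [[_ _ YM] _] := big _ _ CY Yx; exists Y => //; exact: YM.
have [A0|[sA nA]] := QA; last first.
  exists A; split=> // B sB vrB nB x Bx; apply: contrapT => Ax.
  apply: (maxA B); last by right.
  by split=> // BA; apply: Ax; exact: BA.
exfalso; pose Z : set F := [set x | exists n : int, x = n%:~R].
apply: (maxA Z); first by rewrite A0; split=> // h; have := h 1; apply; exists 1.
right; split; first split.
- by exists 1.
- by move=> x y [n ->] [m ->]; exists (n - m); rewrite intrB.
- by move=> x y [n ->] [m ->]; exists (n * m); rewrite intrM.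
move=> [n /(congr1 ( *%R P))]; rewrite divff // [p%:R]pmulrn -intrM => /esym/eqP.
rewrite -[1]/(1%:~R) eqr_int => /eqP e.
have := prime_gt1 p_prime; have : (p %| 1)%Z.
  by apply/dvdzP; exists n; rewrite [RHS]mulrC e.
by rewrite dvdzE /= dvdn1 => /eqP ->.
Qed.

Variable A : set F.
Hypothesis sA : subring_set A.
Hypothesis nA : ~ A P^-1.
Hypothesis maxA : forall B, subring_set B -> A `<=` B -> ~ B P^-1 -> B `<=` A.

Lemma vr1 : A 1. Proof. by case: sA. Qed.
Lemma vrB x y : A x -> A y -> A (x - y). Proof. by case: sA => _ h _; exact: h. Qed.
Lemma vrM x y : A x -> A y -> A (x * y). Proof. by case: sA => _ _; exact. Qed.
Lemma vr0 : A 0. Proof. by rewrite -(subrr 1); apply: vrB; exact: vr1. Qed.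
Lemma vrN x : A x -> A (- x). Proof. by move=> h; rewrite -sub0r; apply: vrB => //; exact: vr0. Qed.
Lemma vrD x y : A x -> A y -> A (x + y).
Proof. by move=> hx hy; rewrite -[y]opprK; apply: vrB => //; exact: vrN. Qed.
Lemma vrX x n : A x -> A (x ^+ n).
Proof. by move=> h; elim: n => [|n IH]; [exact: vr1 | rewrite exprS; exact: vrM]. Qed.
Lemma vr_sum (I : Type) (r : seq I) (f : I -> F) :
  (forall i, A (f i)) -> A (\sum_(i <- r) f i).
Proof. by move=> h; elim/big_ind: _ => //; [exact: vr0 | exact: vrD]. Qed.
Lemma vr_nat n : A n%:R.
Proof. by elim: n => [|n IH]; [exact: vr0 | rewrite -addn1 natrD; apply: vrD => //; exact: vr1]. Qed.

(** [B] is the ring obtained by inverting [s]. As [s^n = 1 - p b'], an element [s^n / p] of [A]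
    would put [1/p = s^n / p + b'] in [A]; so [B] avoids [1/p] and is contained in [A] by
    maximality. *)
Lemma vr_inv_1sub b : A b -> A (1 - P * b)^-1.
Proof.
move=> Ab; set s := 1 - P * b.
have As : A s by apply: vrB; [exact: vr1 | apply: vrM => //; exact: vr_nat].
have s0 : s != 0.
  apply/eqP => s0; apply: nA; rewrite (_ : P^-1 = b) //.
  by apply: (mulfI p0); rewrite divff //; apply/eqP; rewrite -subr_eq0 -/s s0.
pose B : set F := [set x | exists n, A (s ^+ n * x)].
have up x n m : A (s ^+ n * x) -> A (s ^+ (m + n) * x).
  by move=> h; rewrite exprD -mulrA; apply: vrM => //; exact: vrX.
have sB : subring_set B.
  split=> [|x y [n hx] [m hy]|x y [n hx] [m hy]].
  - by exists 0%N; rewrite expr0 mul1r; exact: vr1.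
  - exists (n + m)%N; rewrite mulrBr; apply: vrB; last exact: up.
    by rewrite addnC; exact: up.
  - exists (n + m)%N; rewrite exprD mulrACA; exact: vrM.
have AsubB : A `<=` B by move=> x Ax; exists 0%N; rewrite expr0 mul1r.
apply: (maxA sB AsubB); last by exists 1%N; rewrite expr1 divff //; exact: vr1.
move=> [n hn]; apply: nA.
have [b' Ab' e] : exists2 b', A b' & s ^+ n = 1 - P * b'.
  elim: n {hn} => [|n [b' Ab' e]]; first by exists 0; [exact: vr0 | rewrite mulr0 subr0].
  exists (b + b' - P * b * b'); last by rewrite exprS e /s; ring.
  apply: vrB; first exact: vrD.
  by apply: vrM => //; apply: vrM => //; exact: vr_nat.
rewrite (_ : P^-1 = s ^+ n * P^-1 + b'); first exact: vrD.
by rewrite e; field; rewrite p0.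
Qed.

Let rep x (f : {poly F}) := (forall i, A f`_i) /\ f.[x] = P^-1.

Lemma ex_rep x : ~ A x -> exists f, rep x f.
Proof.
move=> nAx; apply: contrapT => nof.
pose B : set F := [set y | exists f : {poly F}, (forall i, A f`_i) /\ y = f.[x]].
apply: nAx; apply: (maxA (B := B)).
- split=> [|y z [f [hf ->]] [g [hg ->]]|y z [f [hf ->]] [g [hg ->]]].
  + exists 1; split=> [i|]; last by rewrite hornerC.
    by rewrite coef1; case: (i == _); [exact: vr1 | exact: vr0].
  + exists (f - g); split=> [i|]; last by rewrite hornerD hornerN.
    by rewrite coefB; exact: vrB.
  + exists (f * g); split=> [i|]; last by rewrite hornerM.
    by rewrite coefM; apply: vr_sum => j; exact: vrM.
- move=> y Ay; exists y%:P; split=> [i|]; last by rewrite hornerC.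
  by rewrite coefC; case: (i == _) => //; exact: vr0.
- by move=> [f [hf e]]; apply: nof; exists f.
- exists 'X; split=> [i|]; last by rewrite hornerX.
  by rewrite coefX; case: (i == _); [exact: vr1 | exact: vr0].
Qed.

Lemma ex_min_rep x : ~ A x -> exists f, rep x f /\
  forall g, rep x g -> (size f <= size g)%N.
Proof.
move=> /ex_rep[f0 hf0].
have ex : exists n, `[< exists2 f, rep x f & size f = n >].
  by exists (size f0); apply/asboolP; exists f0.
case: (ex_minnP ex) => n /asboolP[f hf <-] hmin; exists f; split=> // g hg.
by apply: hmin; apply/asboolP; exists g.
Qed.

(** Chevalley's argument. If neither [x] nor its inverse is in [A], then [1/p = f(x) = g(1/x)] with
    both degrees minimal and, by symmetry, [deg g <= deg f = m]. As [1 - p g_0] is a unit of [A],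
    the second relation expresses [x^m] by lower powers; substituting it for the leading term of [f]
    lowers the degree. *)
Lemma valuation_ring x : x != 0 -> A x \/ A x^-1.
Proof.
move=> x0; apply: contrapT => /not_orP[nx nx'].
have [f [hf fmin]] := ex_min_rep nx; have [g [hg gmin]] := ex_min_rep nx'.
wlog le_gf : x x0 nx nx' f g hf hg fmin gmin / (size g <= size f)%N => [hw|].
  have [|/ltnW] := leqP (size g) (size f); first exact: (hw x _ nx nx' f g).
  apply: (hw x^-1 _ nx' _ g f) => //; rewrite ?invr_eq0 ?invrK //.
have [[Af fx] [Ag gx]] := (hf, hg).
have gs : (1 < size g)%N.
  rewrite ltnNge; apply/negP => /size1_polyC e; apply: nA.
  by rewrite -gx e hornerC; exact: Ag.
set s := 1 - P * g`_0; have As : A s^-1 by exact: vr_inv_1sub.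
have s0 : s != 0.
  apply/eqP => s0; apply: nA; rewrite (_ : P^-1 = g`_0) //.
  by apply: (mulfI p0); rewrite divff //; apply/eqP; rewrite -subr_eq0 -/s s0.
pose m := (size f).-1.
have sm : size f = m.+1 by rewrite /m prednK // (leq_trans _ le_gf) // ltnW.
have xm : x ^+ m = \sum_(j < (size g).-1) P * (g`_j.+1 / s) * x ^+ (m - j.+1).
  have : s = \sum_(j < (size g).-1) P * g`_j.+1 * x^-1 ^+ j.+1.
    have e1 : 1 = P * g.[x^-1] by rewrite gx divff.
    rewrite /s [X in X - _]e1 horner_coef -(prednK (ltnW gs)) big_ord_recl /=.
    rewrite expr0 mulr1 mulrDr addrAC subrr add0r mulr_sumr.
    by apply: eq_bigr => j _; rewrite /bump /= add1n mulrA.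
  move/(congr1 (fun y => y / s * x ^+ m)); rewrite divff // mul1r => ->.
  rewrite !mulr_suml; apply: eq_bigr => j _.
  have jm : (j.+1 <= m)%N.
    by apply: leq_trans (ltn_ord j) _; move: le_gf gs; rewrite sm; lia.
  rewrite -{1}(subnK jm) exprD exprVn.
  have xj0 : x ^+ j.+1 != 0 by rewrite expf_neq0.
  by field; rewrite xj0 s0.
pose h := f - f`_m *: 'X^m + f`_m *: \sum_(j < (size g).-1) (P * (g`_j.+1 / s)) *: 'X^(m - j.+1).
have rh : rep x h.
  split=> [i|]; last first.
    rewrite /h !hornerD hornerN !hornerZ hornerXn fx horner_sum.
    rewrite (eq_bigr (fun j : 'I_(size g).-1 => P * (g`_j.+1 / s) * x ^+ (m - j.+1))); last first.
      by move=> j _; rewrite hornerZ hornerXn.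
    by rewrite -xm subrK.
  rewrite /h coefD coefB !coefZ coefXn coef_sum.
  have Ab (b : bool) : A b%:R by case: b; [exact: vr1 | exact: vr0].
  apply: vrD; first by apply: vrB => //; apply: vrM => //; exact: Ab.
  apply: vrM => //; apply: vr_sum => j; rewrite coefZ coefXn; apply: vrM; last exact: Ab.
  by apply: vrM; [exact: vr_nat | apply: vrM].
have := fmin _ rh; rewrite sm leqNgt => /negP; apply; rewrite ltnS.
apply/leq_sizeP => i im.
have m0 : (0 < m)%N by rewrite -ltnS -sm (leq_trans gs).
rewrite /h coefD coefB !coefZ coefXn coef_sum big1 ?mulr0 ?addr0; last first.
  move=> j _; rewrite coefZ coefXn (_ : i == _ = false) ?mulr0 //.
  apply/negbTE/eqP => e; move: im; rewrite e.
  by rewrite leqNgt ltn_subrL m0.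
move: im; rewrite leq_eqVlt => /orP[/eqP <-|im]; first by rewrite eqxx mulr1 subrr.
by rewrite (gtn_eqF im) mulr0 subr0 nth_default // sm.
Qed.

Definition vr_unit x := [/\ x != 0, A x & A x^-1].

Lemma vr_unit1 : vr_unit 1.
Proof. by split; rewrite ?oner_eq0 ?invr1 //; exact: vr1. Qed.

Lemma vr_unitM x y : vr_unit x -> vr_unit y -> vr_unit (x * y).
Proof.
move=> [x0 Ax Ax'] [y0 Ay Ay']; split; first by rewrite mulf_neq0.
  exact: vrM.
by rewrite invfM; exact: vrM.
Qed.

Lemma vr_unitV x : vr_unit x -> vr_unit x^-1.
Proof. by move=> [x0 Ax Ax']; split; rewrite ?invr_eq0 ?invrK. Qed.

Lemma vr_unitX x n : vr_unit x -> vr_unit (x ^+ n).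
Proof. by move=> h; elim: n => [|n IH]; [exact: vr_unit1 | rewrite exprS; exact: vr_unitM]. Qed.

(** Bezout makes a multiple of [n] of the form [1 - p b], invertible by [vr_inv_1sub]. *)
Lemma vr_unit_coprime n : coprime p n -> vr_unit n%:R.
Proof.
move=> cop; have n0 : (0 < n)%N.
  by case: n cop => //; rewrite /coprime gcdn0 => /eqP e; have := prime_gt1 p_prime; rewrite e.
split; [by rewrite pnatr_eq0 -lt0n | exact: vr_nat |].
case: (egcdnP p n0) => km kn e _; move: e; rewrite gcdnC (eqP cop) => e.
have h := vr_inv_1sub (vrN (vr_nat kn)).
have e2 : 1 - P * - kn%:R = km%:R * n%:R.
  by rewrite mulrN opprK -!natrM e natrD addrC mulnC.
have kn0 : km%:R * n%:R != 0 :> F.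
  by rewrite -natrM e pnatr_eq0 addn1.
have : A (km%:R * (km%:R * n%:R)^-1) by apply: vrM; [exact: vr_nat | rewrite -e2].
move: kn0; rewrite mulf_eq0 negb_or => /andP[k0 nn0].
by rewrite invfM mulrA divff // mul1r.
Qed.

Lemma vr_unit_part n : (0 < n)%N -> vr_unit (n%:R / P ^+ logn p n).
Proof.
move=> n0; have e : n = (n`_p * n`_p^')%N by rewrite partnC.
have -> : n%:R / P ^+ logn p n = (n`_p^')%N%:R :> F.
  rewrite {1}e p_part natrM natrX mulrAC divff ?mul1r //.
  by rewrite expf_neq0.
apply: vr_unit_coprime; rewrite prime_coprime // -p'natE //; exact: part_pnat.
Qed.

Definition padic_val (q : rat) : int := (logn p `|numq q|%N)%:Z - (logn p `|denq q|%N)%:Z.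

Lemma vr_unit_sign x : vr_unit x -> vr_unit (- x).
Proof.
by move=> [x0 Ax Ax']; split; rewrite ?oppr_eq0 ?invrN //; exact: vrN.
Qed.

Lemma vr_unit_rat q : q != 0 -> vr_unit (ratr q / P ^ padic_val q).
Proof.
move=> q0; rewrite /padic_val expfzDr // invfM -invr_expz invrK /ratr.
have un (z : int) : z != 0 -> vr_unit (z%:~R / P ^ (logn p `|z|%N)%:Z).
  move=> z0; rewrite -exprnP; case: (intP z) z0 => // n _.
    by rewrite -pmulrn; exact: vr_unit_part.
  rewrite abszN intrN mulNr; apply: vr_unit_sign; rewrite -pmulrn; exact: vr_unit_part.
suff : vr_unit ((numq q)%:~R / P ^ (logn p `|numq q|%N)%:Z *
    ((denq q)%:~R / P ^ (logn p `|denq q|%N)%:Z)^-1).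
  by congr vr_unit; rewrite invfM invrK mulrACA.
by apply: vr_unitM; [apply: un; rewrite numq_eq0 | apply: vr_unitV; apply: un; exact: denq_neq0].
Qed.

Lemma vr_exp_ge0 (r : int) : A (P ^ r) -> 0 <= r.
Proof.
move=> h; rewrite leNgt; apply/negP => r0; apply: nA.
have [n e] : exists n : nat, r = - n.+1%:Z.
  by case: r r0 {h} => // n _; exists n; rewrite NegzE.
rewrite (_ : P^-1 = P ^ r * P ^+ n); first by apply: vrM => //; apply: vrX; exact: vr_nat.
rewrite e -invr_expz -exprnP exprS invfM.
by rewrite mulfVK // expf_neq0.
Qed.

(** The non-units form an ideal: if [x / y] is in [A] and [x + y] is a unit, then
    [1/y = (x/y + 1) / (x + y)] is in [A]. *)
Lemma nonunit_add x y : A x -> A y -> ~ vr_unit x -> ~ vr_unit y -> ~ vr_unit (x + y).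
Proof.
wlog xy : x y / y != 0 /\ A (x / y) => [hw Ax Ay nx ny|].
  have [->|y0] := eqVneq y 0; first by rewrite addr0.
  have [->|x0] := eqVneq x 0; first by rewrite add0r.
  have [h|h] := @valuation_ring (x / y) (mulf_neq0 x0 (invr_neq0 y0)).
    exact: (hw x y).
  by rewrite addrC; apply: (hw y x) => //; split=> //; rewrite invfM invrK mulrC in h.
case: xy => y0 Axy Ax Ay nx ny [s0 As As']; apply: ny; split=> //.
rewrite (_ : y^-1 = (x / y + 1) * (x + y)^-1); last first.
  by field; rewrite y0 s0.
by apply: vrM => //; apply: vrD => //; exact: vr1.
Qed.

Lemma nonunit_sum (I : eqType) (r : seq I) (f : I -> F) :
  (forall i, i \in r -> A (f i)) -> (forall i, i \in r -> ~ vr_unit (f i)) ->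
  A (\sum_(i <- r) f i) /\ ~ vr_unit (\sum_(i <- r) f i).
Proof.
elim: r => [|i r IH] hA hn; first by rewrite big_nil; split; [exact: vr0 | case; rewrite eqxx].
have [||h1 h2] := IH.
- by move=> j jr; apply: hA; rewrite inE jr orbT.
- by move=> j jr; apply: hn; rewrite inE jr orbT.
rewrite big_cons; have h3 := hA i (mem_head _ _); have h4 := hn i (mem_head _ _).
split; [exact: vrD | exact: nonunit_add].
Qed.

Lemma ex_max_term (I : eqType) (r : seq I) (f : I -> F) : r != [::] ->
  (forall i, i \in r -> f i != 0) ->
  exists i, i \in r /\ forall j, j \in r -> A (f j / f i).
Proof.
elim: r => // i r IH _ hf.
have fi0 := hf i (mem_head _ _).
have [r0|r0] := eqVneq r [::].
  exists i; rewrite r0; split; rewrite ?mem_head // => j; rewrite inE => /eqP ->.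
  by rewrite divff //; exact: vr1.
have [|k [kr hk]] := IH r0; first by move=> j jr; apply: hf; rewrite inE jr orbT.
have fk0 : f k != 0 by apply: hf; rewrite inE kr orbT.
have [h|h] := @valuation_ring (f i / f k) (mulf_neq0 fi0 (invr_neq0 fk0)).
  exists k; rewrite inE kr orbT; split=> // j; rewrite inE => /orP[/eqP -> //|]; exact: hk.
exists i; rewrite mem_head; split=> // j; rewrite inE => /orP[/eqP ->|jr].
  by rewrite divff //; exact: vr1.
rewrite (_ : f j / f i = (f j / f k) * (f i / f k)^-1); first by apply: vrM => //; exact: hk.
by field; rewrite fi0 fk0.
Qed.

(* Of the terms of a vanishing sum f_0 + ... + f_n x^n two have the same value,
   which determines the value of a power of x. *)
Lemma ex_value x (f : {poly rat}) : x != 0 -> f != 0 -> root (map_poly ratr f) x ->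
  exists s (r : int), (0 < s)%N /\ vr_unit (x ^+ s / P ^ r).
Proof.
move=> x0 f0 /rootP fx.
pose t (i : nat) := ratr f`_i * x ^+ i.
pose r := [seq i <- iota 0 (size f) | f`_i != 0].
have tn i : i \in r -> t i != 0.
  by rewrite mem_filter => /andP[h _]; rewrite mulf_neq0 ?expf_neq0 // fmorph_eq0.
have ls : (size f).-1 \in r.
  rewrite mem_filter mem_iota add0n ltn_predL size_poly_gt0 f0 !andbT.
  by rewrite -/(lead_coef f) lead_coef_eq0.
have r0 : r != [::] by case: (r) ls.
have [i [ir hi]] := ex_max_term r0 tn.
have ur : uniq r by rewrite filter_uniq // iota_uniq.
have sum0 : \sum_(j <- r) t j / t i = 0.
  rewrite -mulr_suml big_filter; apply/eqP; rewrite mulf_eq0; apply/orP; left.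
  rewrite big_mkcond /= -[size f]subn0 -/(index_iota 0 (size f)) big_mkord -[X in _ == X]fx.
  rewrite horner_coef size_map_poly; apply/eqP; apply: eq_bigr => j _.
  by rewrite coef_map /t /=; case: eqP => //= ->; rewrite rmorph0 mul0r.
have [j [jr ji uj]] : exists j, [/\ j \in r, j != i & vr_unit (t j / t i)].
  apply: contrapT => noj.
  have [||_ h] := @nonunit_sum _ (rem i r) (fun j => t j / t i).
  - by move=> j /mem_rem; exact: hi.
  - move=> j; rewrite mem_rem_uniq // inE => /andP[ji jr] uj.
    by apply: noj; exists j.
  apply: h; move: sum0; rewrite (big_rem i) //= divff ?tn // => /eqP.
  rewrite addrC addr_eq0 => /eqP ->; apply: vr_unit_sign; exact: vr_unit1.
have fi0 : f`_i != 0 by move: ir; rewrite mem_filter => /andP[].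
have fj0 : f`_j != 0 by move: jr; rewrite mem_filter => /andP[].
have gen (a b : nat) : (b < a)%N -> f`_a != 0 -> f`_b != 0 -> vr_unit (t a / t b) ->
    exists s (r : int), (0 < s)%N /\ vr_unit (x ^+ s / P ^ r).
  move=> ab a0 b0 uab; exists (a - b)%N, (padic_val (f`_b / f`_a)).
  split; first by rewrite subn_gt0.
  have q0 : f`_b / f`_a != 0 by rewrite mulf_neq0 // invr_eq0.
  have := vr_unitM uab (vr_unit_rat q0); congr vr_unit.
  rewrite mulrA; congr (_ / _); rewrite /t fmorph_div.
  rewrite /= (_ : x ^+ a = x ^+ (a - b) * x ^+ b); last by rewrite -exprD subnK // ltnW.
  have ra0 : ratr f`_a != 0 :> F by rewrite fmorph_eq0.
  have rb0 : ratr f`_b != 0 :> F by rewrite fmorph_eq0.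
  have xb0 : x ^+ b != 0 by rewrite expf_neq0.
  by field; rewrite ra0 rb0 xb0.
have [lt|gt|e] := ltngtP i j; last by rewrite e eqxx in ji.
  exact: (gen j i).
by apply: (gen i j) => //; have := vr_unitV uj; rewrite invfM invrK mulrC.
Qed.

(** The valuation with value 1 at [p]. By [ex_value] some power of a non-zero algebraic number is a
    unit times a power of [p], so values can be taken in [rat]. *)
Definition has_value x (rho : rat) : Prop := exists s (r : int),
  [/\ (0 < s)%N, rho = r%:~R / s%:R & vr_unit (x ^+ s / P ^ r)].

Lemma has_value_neq0 x rho : has_value x rho -> x != 0.
Proof.
move=> [s [r [s0 _ [h _ _]]]]; apply: contraNneq h => ->.
by rewrite expr0n gtn_eqF //= mul0r.
Qed.

Lemma has_value_ge0 x rho : has_value x rho -> A x <-> 0 <= rho.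
Proof.
move=> hx; have x0 := has_value_neq0 hx; move: hx => [s [r [s0 -> [h1 h2 h3]]]].
have sr0 : 0 < (s%:R : rat) by rewrite ltr0n.
have Pr0 : P ^ r != 0 by rewrite expfz_neq0.
rewrite pmulr_lge0 ?invr_gt0 // ler0z; split=> [Ax|r0].
  apply: vr_exp_ge0; rewrite (_ : P ^ r = x ^+ s * (x ^+ s / P ^ r)^-1).
    by apply: vrM => //; exact: vrX.
  by rewrite invfM invrK mulrA divff ?mul1r // expf_neq0.
have Axs : A (x ^+ s).
  rewrite (_ : x ^+ s = x ^+ s / P ^ r * P ^ r); last by rewrite mulfVK.
  apply: vrM => //; case: r r0 {h1 h2 h3 Pr0} => // n _; rewrite -exprnP.
  by apply: vrX; exact: vr_nat.
have [//|Ax'] := valuation_ring x0.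
rewrite (_ : x = x ^+ s * x^-1 ^+ s.-1); first by apply: vrM => //; exact: vrX.
rewrite -{1}(prednK s0) exprS exprVn mulfK // expf_neq0 //.
Qed.

Lemma has_valueM x y a b : has_value x a -> has_value y b -> has_value (x * y) (a + b).
Proof.
move=> [s [r [s0 -> hx]]] [s' [r' [s0' -> hy]]].
exists (s * s')%N, (r * s'%:Z + r' * s%:Z); split.
- by rewrite muln_gt0 s0.
- rewrite intrD !intrM natrM -!pmulrn.
  have h1 : (s%:R : rat) != 0 by rewrite pnatr_eq0 -lt0n.
  have h2 : (s'%:R : rat) != 0 by rewrite pnatr_eq0 -lt0n.
  by field; rewrite h1 h2.
have := vr_unitM (vr_unitX s' hx) (vr_unitX s hy); congr vr_unit.
rewrite !expr_div_n -!exprM exprMn [(s' * s)%N]mulnC expfzDr // -!exprz_exp -!exprnP invfM.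
by rewrite mulrACA.
Qed.

Lemma has_value_unique x a b : has_value x a -> has_value x b -> a = b.
Proof.
move=> [s [r [s0 -> hx]]] [s' [r' [s0' -> hy]]].
have h : vr_unit (P ^ (r' * s%:Z - r * s'%:Z)).
  have := vr_unitM (vr_unitX s' hx) (vr_unitV (vr_unitX s hy)); congr vr_unit.
  have x0 : x ^+ (s * s') != 0.
    case: hx => h _ _; apply: contraNneq h => /eqP; rewrite expf_eq0 => /andP[_ /eqP ->].
    by rewrite expr0n gtn_eqF // mul0r.
  rewrite !expr_div_n -!exprM [(s' * s)%N]mulnC expfzDr // -invr_expz -!exprz_exp -!exprnP.
  rewrite invfM invrK mulrACA divff // mul1r mulrC //.
have : r' * s%:Z - r * s'%:Z = 0.
  case: h => _ h1 h2; apply/eqP; rewrite eq_le (vr_exp_ge0 h1) andbT.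
  by rewrite -oppr_ge0; apply: vr_exp_ge0; rewrite -invr_expz.
move/eqP; rewrite subr_eq0 => /eqP e.
apply/eqP; rewrite eqr_div ?pnatr_eq0 -?lt0n //; apply/eqP.
by move/(congr1 (fun z : int => z%:~R : rat)): e; rewrite !intrM -!pmulrn => ->.
Qed.

Lemma has_value_rat q : q != 0 -> has_value (ratr q) (padic_val q)%:~R.
Proof.
move=> q0; exists 1%N, (padic_val q); split=> //; first by rewrite divr1.
by rewrite expr1; exact: vr_unit_rat.
Qed.

Lemma has_valueD x y a b c : has_value x a -> has_value y b -> has_value (x + y) c ->
  Num.min a b <= c.
Proof.
wlog ba : x y a b / b <= a => [hw hx hy hxy|hx hy hxy].
  have /orP[h|h] := le_total b a; first exact: (hw x y a b).
  rewrite minC; apply: (hw y x) => //; by rewrite addrC.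
have y0 := has_value_neq0 hy.
have hyV : has_value y^-1 (- b).
  move: hy => [s [r [s0 -> h]]]; exists s, (- r); split=> //; first by rewrite intrN mulNr.
  by have := vr_unitV h; rewrite invfM invrK exprVn -invr_expz invrK mulrC.
have Axy : A (x / y) by apply/(has_value_ge0 (has_valueM hx hyV)); rewrite subr_ge0.
have : A ((x + y) / y) by rewrite mulrDl divff //; apply: vrD => //; exact: vr1.
move/(has_value_ge0 (has_valueM hxy hyV)); rewrite subr_ge0.
by apply: le_trans; rewrite ge_min lexx orbT.
Qed.

End ValuationRing.

(** The field is [algC] because all its elements are algebraic, which gives each non-zero one a
    value. The archimedean place uses [R[i]] instead, where the modulus takes values in [R]. *)
Lemma ex_padic_absolute_value (R : realType) (p : nat) : prime p ->
  exists u : algC -> R, [/\ absolute_value u,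
    forall x y, u (x + y) <= Num.max (u x) (u y) &
    forall q : rat, u (ratr q) = padic_abs R p q].
Proof.
move=> pp; have [A [sA nA maxA]] := ex_maximal_subring algC pp.
have exv x : exists rho, x != 0 -> has_value p A x rho.
  have [->|x0] := eqVneq x 0; first by exists 0.
  have [f [_ f1] hf] := minCpolyP x.
  have [||s [r [s0 h]]] := ex_value pp sA nA maxA x0 (f := f).
  - exact: monic_neq0.
  - by rewrite hf.
  by exists (r%:~R / s%:R) => _; exists s, r.
have [val hval] := choice exv.
have lnp : 0 < ln (p%:R : R) by rewrite ln_gt0 // ltr1n prime_gt1.
pose u x : R := if x == 0 then 0 else expR (- ratr (val x) * ln p%:R).
have um x y : u (x + y) <= Num.max (u x) (u y).
  rewrite /u; have [->|x0] := eqVneq x 0; first by rewrite add0r le_max lexx orbT.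
  have [->|y0] := eqVneq y 0; first by rewrite addr0 (negPf x0) le_max lexx.
  have [e|xy0] := eqVneq (x + y) 0; first by rewrite le_max expR_ge0.
  have h := has_valueD pp sA nA maxA (hval _ x0) (hval _ y0) (hval _ xy0).
  rewrite le_max !ler_expR !ler_pM2r // !lerN2 !ler_rat.
  by move: h; rewrite ge_min.
have u0 x : 0 <= u x by rewrite /u; case: ifP => // _; exact: expR_ge0.
have uM x y : u (x * y) = u x * u y.
  rewrite /u mulf_eq0; have [_|x0] := eqVneq x 0; first by rewrite mul0r.
  have [_|y0] := eqVneq y 0; first by rewrite mulr0.
  have xy0 : x * y != 0 by rewrite mulf_neq0.
  have -> : val (x * y) = val x + val y.
    apply: (has_value_unique pp sA nA (hval _ xy0)).
    exact: (has_valueM pp sA (hval _ x0) (hval _ y0)).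
  by rewrite /= (rmorphD (ratr : {rmorphism rat -> R})) opprD mulrDl expRD.
exists u; split=> //.
- split=> // [x|x y]; last first.
    by apply: le_trans (um _ _) _; rewrite ge_max lerDl lerDr !u0.
  rewrite /u; split=> [|->]; last by rewrite eqxx.
  by case: eqP => // _ /eqP; rewrite gt_eqF ?expR_gt0.
- move=> q; rewrite /u /padic_abs fmorph_eq0; case: eqP => // /eqP q0.
  have rq0 : ratr q != 0 :> algC by rewrite fmorph_eq0.
  rewrite (has_value_unique pp sA nA (hval _ rq0) (has_value_rat pp sA nA maxA q0)).
  have pR : 0 < (p%:R : R) by rewrite ltr0n prime_gt0.
  rewrite -powR_intmul ?(ltW pR) // /powR gt_eqF // ratr_int -intrN /padic_val opprB.
  by [].
Qed.

Lemma normc_absolute_value (R : realType) :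
  absolute_value (fun x : R[i] => ComplexField.Normc.normc x).
Proof.
split.
- by case=> a b /=; exact: sqrtr_ge0.
- by move=> x; split=> [/ComplexField.Normc.eq0_normc //|->]; exact: ComplexField.Normc.normc0.
- exact: ComplexField.Normc.normcM.
- exact: le_normcD.
Qed.

Lemma normc_ratr (R : realType) (q : rat) :
  ComplexField.Normc.normc (ratr q : R[i]) = ratr `|q|.
Proof.
rewrite -(fmorph_rat (real_complex R)) /=.
by rewrite expr0n addr0 sqrtr_sqr ratr_norm.
Qed.

(** * Local inequalities *)

Section Logarithms.
Variable R : realType.

Lemma ln_prod (I : eqType) (r : seq I) (f : I -> R) :
  (forall i, i \in r -> 0 < f i) ->
  ln (\prod_(i <- r) f i) = \sum_(i <- r) ln (f i).
Proof.
elim: r => [|i r IH] h; first by rewrite !big_nil ln1.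
have h' j : j \in r -> 0 < f j by move=> jr; apply: h; rewrite inE jr orbT.
rewrite !big_cons lnM ?posrE ?IH // ?h ?mem_head //.
by rewrite big_seq; apply: prodr_gt0 => j; exact: h'.
Qed.

Lemma ln_exprz (x : R) (z : int) : 0 < x -> ln (x ^ z) = z%:~R * ln x.
Proof. by move=> x0; rewrite -powR_intmul ?ltW // ln_powR. Qed.

Lemma ln_nat_logn (n B : nat) : (0 < n)%N -> (n < B)%N ->
  ln (n%:R : R) = \sum_(p <- index_iota 0 B | prime p) (logn p n)%:R * ln (p%:R : R).
Proof.
case: B => // B n0; rewrite ltnS => nB.
rewrite -{1}(partnT n0) (widen_partn _ nB) natr_prod.
rewrite ln_prod; last first.
  move=> p _; rewrite ltr0n expn_gt0.
  by case: p => // ; rewrite logn0 orbT.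
rewrite [RHS]big_mkcond /=; apply: eq_bigr => p _; case: ifP => pp.
  by rewrite natrX lnXn ?ltr0n ?prime_gt0 // mulr_natl.
by rewrite lognE pp /= expn0 ln1.
Qed.

End Logarithms.

(** [None] is the archimedean place. Sums over all places become sums over this list for every large
    [B], the other primes contributing 0. *)
Definition place_index (B : nat) : seq (option nat) :=
  None :: [seq Some p | p <- index_iota 0 B & prime p].

Definition rat_abs (R : realType) (w : option nat) (q : rat) : R :=
  if w is Some p then padic_abs R p q else ratr `|q|.

Lemma rat_product_formula (R : realType) (q : rat) : q != 0 ->
  exists B0, forall B, (B0 <= B)%N ->
    \sum_(w <- place_index B) ln (rat_abs R w q) = 0.
Proof.
move=> q0; pose n := `|numq q|%N; pose m := `|denq q|%N.
have n0 : (0 < n)%N by rewrite absz_gt0 numq_eq0.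
have m0 : (0 < m)%N by rewrite absz_gt0 denq_neq0.
exists (maxn n m).+1 => B; rewrite gtn_max => /andP[nB mB].
rewrite /place_index big_cons big_map big_filter /=.
have -> : ln (ratr `|q| : R) = ln (n%:R : R) - ln (m%:R : R).
  rewrite ratr_norm /ratr normrM normfV -!intr_norm -!abszE -/n -/m -!pmulrn.
  by rewrite lnM ?posrE ?invr_gt0 ?ltr0n // lnV ?posrE ?ltr0n.
rewrite (ln_nat_logn R n0 nB) (ln_nat_logn R m0 mB) -sumrB -big_split /=.
apply: big1 => p pp; rewrite /padic_abs (negPf q0) ln_exprz ?ltr0n ?prime_gt0 //.
by rewrite intrB -!pmulrn -/n -/m; ring.
Qed.

Section NontorsionRoots.
Variable K : fieldType.

Lemma ex_irreducible_factor (D : {poly K}) : (1 < size D)%N ->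
  exists g, irreducible_poly g /\ g %| D.
Proof.
move=> sD; have ex : exists n, `[< exists2 g : {poly K}, (1 < size g)%N /\ g %| D & size g = n >].
  by exists (size D); apply/asboolP; exists D.
case: (ex_minnP ex) => n /asboolP[g [sg gD] <-] hmin; exists g; split=> //.
split=> // h sh hg; rewrite -(dvdp_size_eqp hg) eqn_leq.
have g0 : g != 0 by rewrite -size_poly_gt0 ltnW.
rewrite dvdp_leq //=; apply: hmin; apply/asboolP; exists h => //; split.
  have h0 : h != 0 by apply: contraNneq g0 => h0; move: hg; rewrite h0 dvd0p.
  by rewrite ltn_neqAle eq_sym sh size_poly_gt0.
exact: dvdp_trans hg gD.
Qed.

(** [no_root_0_or_unity] speaks of finite extensions of [K]. A common root in a larger field makes
    the gcd over [K] non-constant, and an irreducible factor of it has a root in a finite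
    extension. *)
Lemma ex_common_root (L : fieldType) (tau : {rmorphism K -> L}) (P S : {poly K}) (w : L) :
  P != 0 -> root (map_poly tau P) w -> root (map_poly tau S) w ->
  exists (M : fieldExtType K) (z : M),
    root (map_poly (in_alg M) P) z /\ root (map_poly (in_alg M) S) z.
Proof.
move=> P0 Pw Sw; pose D := gcdp P S.
have Dw : root (map_poly tau D) w by rewrite gcdp_map root_gcd Pw.
have D0 : D != 0 by rewrite gcdp_eq0 (negPf P0).
have sD : (1 < size D)%N.
  rewrite ltn_neqAle size_poly_gt0 D0 andbT eq_sym; apply: contraL Dw => /size_poly1P[c c0 ->].
  by rewrite map_polyC /= rootC fmorph_eq0.
have [g [irr gD]] := ex_irreducible_factor sD.
have [M _ [z zg _]] := irredp_FAdjoin irr; exists M, z.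
have : root (map_poly (in_alg M) D) z.
  by move: zg; rewrite -!dvdp_XsubCl => /dvdp_trans; apply; rewrite dvdp_map.
by rewrite gcdp_map root_gcd => /andP.
Qed.

Lemma nontorsion_root (L : fieldType) (tau : {rmorphism K -> L}) (P : {poly K}) (w : L) :
  P != 0 -> no_root_0_or_unity P -> root (map_poly tau P) w -> nontorsion w.
Proof.
move=> P0 hP Pw; split.
  apply/eqP => w0; have [|M [z [zP z0]]] := ex_common_root (S := 'X) P0 Pw.
    by rewrite map_polyX rootX w0.
  have [/eqP h _] := hP M z zP; apply: h; apply/eqP.
  by move: z0; rewrite map_polyX rootX.
move=> m m0; apply/eqP => wm.
have [|M [z [zP zm]]] := ex_common_root (S := 'X^m - 1) P0 Pw.
  by rewrite rmorphB rmorph1 /= map_polyXn rootE !hornerE wm subrr.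
have [_ /(_ m m0) /negP] := hP M z zP; apply.
by move: zm; rewrite rmorphB rmorph1 /= map_polyXn.
Qed.

End NontorsionRoots.

Lemma sumr_const_seq (R : nzSemiRingType) (I : Type) (r : seq I) :
  \sum_(i <- r) 1 = (size r)%:R :> R.
Proof. by rewrite big_const_seq count_predT iter_addr_0. Qed.

Section LocalInequality.
Variables (R : realType) (K : fieldType) (L : numClosedFieldType).
Variables (tau : {rmorphism K -> L}) (k : nat) (p : 'I_k -> nat).
Hypothesis p_prime : forall i, prime (p i).
Hypothesis p_inj : injective p.
Variables (P Q : {poly K}) (l M : nat).
Hypothesis P_monic : P \is monic.
Hypothesis Q_monic : Q \is monic.
Hypothesis P_nt : no_root_0_or_unity P.
Hypothesis QP : forall i, Q %| P \Po 'X^(p i).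
Hypothesis l2 : (2 <= l)%N.
Hypothesis k0 : (0 < k)%N.
Hypothesis P_deg : (deg P * (2 ^ l.+1 * (l.+1)`!) <= 'C(k, l.+2))%N.
Hypothesis pM : forall i, M%:R / 2 <= (p i)%:R :> R.
Hypothesis M0 : (0 < M)%N.

Lemma ex_root_lists : exists zs ws : seq L,
  [/\ map_poly tau Q = \prod_(z <- zs) ('X - z%:P),
      map_poly tau P = \prod_(w <- ws) ('X - w%:P),
      size zs = deg Q /\ size ws = deg P,
      forall z, z \in zs -> nontorsion z &
      forall z c, z \in zs -> (count_mem z zs <= count_mem (z ^+ p c) ws)%N].
Proof.
have split_monic (F : {poly K}) : F \is monic -> exists2 s : seq L,
    map_poly tau F = \prod_(z <- s) ('X - z%:P) & size s = deg F.
  move=> mF; have [s e] := closed_field_poly_normal (map_poly tau F).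
  rewrite (monicP _) ?map_monic // scale1r in e; exists s => //.
  by rewrite /deg -(size_map_poly tau) e size_prod_XsubC.
have [zs eQ sQ] := split_monic Q Q_monic; have [ws eP sP] := split_monic P P_monic.
have dvd c : \prod_(x <- zs) ('X - x%:P) %| (\prod_(w <- ws) ('X - w%:P)) \Po 'X^(p c).
  by rewrite -eQ -eP -[X in _ \Po X](map_polyXn tau) -map_comp_poly dvdp_map.
(* A power of [z] is a root of [P], and [z] is nontorsion as soon as a power of it is. *)
have nt z : z \in zs -> nontorsion z.
  move=> zz; pose c : 'I_k := Ordinal k0.
  have zr : root (map_poly tau P) (z ^+ p c).
    have : root ((\prod_(w <- ws) ('X - w%:P)) \Po 'X^(p c)) z.
      by rewrite -dvdp_XsubCl (dvdp_trans _ (dvd c)) // dvdp_XsubCl root_prod_XsubC.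
    by rewrite -eP !rootE horner_comp hornerXn.
  have [w0 wt] := nontorsion_root (monic_neq0 P_monic) P_nt zr.
  split=> [|m m0].
    apply: contraNneq w0 => ->; rewrite expr0n gtn_eqF //; exact: prime_gt0.
  apply: contraNneq (wt m m0) => e; by rewrite -exprM mulnC exprM e expr1n.
exists zs, ws; split=> // z c zz; apply: count_root_le (dvd c).
  by case: (nt z zz).
exact: prime_gt0.
Qed.

Lemma degree_bound : k%:R * (deg Q)%:R <= 4 * l.+1%:R * (deg P)%:R :> R.
Proof.
have [zs [ws [_ _ [sQ sP] nt cnt]]] := ex_root_lists.
have := @weighted_sum R L k p p_prime p_inj zs ws l nt cnt l2 k0.
rewrite sP => /(_ P_deg (fun _ => 1) (fun _ => 1) 1).
rewrite !sumr_const_seq !mulr1 sQ sP; apply=> //.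
Qed.

Variables (u : L -> R) (kappa : R).
Hypothesis au : absolute_value u.
Hypothesis kappa1 : 1 <= kappa.
Hypothesis u_max : forall x y, u (x + y) <= kappa * Num.max (u x) (u y).

(** Passing between norms and Mahler measures costs [deg * ln kappa] for each polynomial. As the
    power [p c] multiplies [ln (max 1 (u z))] by [p c >= M / 2], [weighted_sum] gives the factor
    [4 * l.+1 / (k * (M / 2))]. *)
Lemma local_height_bound :
  ln (max_norm u (map_poly tau Q)) <= (deg Q)%:R * ln kappa +
    8 * l.+1%:R / (k%:R * M%:R) *
      ((deg P)%:R * ln kappa + ln (max_norm u (map_poly tau P))).
Proof.
have [zs [ws [eQ eP [sQ sP] nt cnt]]] := ex_root_lists.
have kp : 0 < kappa by apply: lt_le_trans kappa1.
have nQ : 0 < max_norm u (map_poly tau Q).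
  by apply: max_norm_gt0 => //; rewrite map_poly_eq0 monic_neq0.
have nP : 0 < max_norm u (map_poly tau P).
  by apply: max_norm_gt0 => //; rewrite map_poly_eq0 monic_neq0.
have mpos s : 0 < mahler u s by apply: lt_le_trans (mahler_ge1 u s).
have mx1 z : 1 <= Num.max 1 (u z) by rewrite le_max lexx.
have mx0 z : 0 < Num.max 1 (u z) by apply: lt_le_trans (mx1 z).
have lnm s : ln (mahler u s) = \sum_(z <- s) ln (Num.max 1 (u z)) by rewrite ln_prod.
have h1 : ln (max_norm u (map_poly tau Q)) <= (deg Q)%:R * ln kappa + ln (mahler u zs).
  rewrite mulr_natl -lnXn // -lnM ?posrE ?exprn_gt0 // ler_ln ?posrE ?mulr_gt0 ?exprn_gt0 //.
  by rewrite eQ -sQ; exact: max_norm_prod_XsubC_le.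
have h2 : ln (mahler u ws) <= (deg P)%:R * ln kappa + ln (max_norm u (map_poly tau P)).
  rewrite mulr_natl -lnXn // -lnM ?posrE ?exprn_gt0 // ler_ln ?posrE ?mulr_gt0 ?exprn_gt0 //.
  by rewrite eP -sP; exact: mahler_le.
have h3 : k%:R * (M%:R / 2) * ln (mahler u zs) <= 4 * l.+1%:R * ln (mahler u ws).
  rewrite !lnm; apply: (@weighted_sum R L k p p_prime p_inj zs ws l nt cnt l2 k0) => //.
  - by rewrite sP.
  - by move=> z; rewrite ln_ge0.
  - by move=> z; rewrite ln_ge0.
  move=> z c _; have -> : Num.max 1 (u (z ^+ p c)) = Num.max 1 (u z) ^+ p c.
    rewrite avX //; have [h|h] := leP (u z) 1.
      rewrite max_l; last by rewrite exprn_ile1 ?av_ge0.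
      by rewrite expr1n.
    by rewrite max_r // exprn_ege1 // ltW.
  rewrite lnXn // -[X in _ <= X]mulr_natl ler_wpM2r ?ln_ge0 //.
have kM : 0 < (k%:R * M%:R : R) by rewrite mulr_gt0 ?ltr0n.
apply: le_trans h1 _; rewrite lerD2l.
rewrite -mulrA (mulrCA _ (_ ^-1)) ler_pdivlMl //.
apply: le_trans (_ : 8 * l.+1%:R * ln (mahler u ws) <= _); last first.
  by rewrite ler_wpM2l // mulr_ge0.
by move: h3; lra.
Qed.

End LocalInequality.

(** * The product formula and the height *)

Lemma padic_abs_p (R : realType) (p q : nat) : prime p -> prime q ->
  padic_abs R p q%:R = if p == q then p%:R^-1 else 1.
Proof.
move=> pp pq; rewrite /padic_abs pnatr_eq0.
have -> /= : (q == 0)%N = false by rewrite gtn_eqF ?prime_gt0.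
rewrite -[q%:R]/((q%:Z)%:~R : rat) numq_int denq_int /= logn1 logn_prime // add0r.
by case: (p == q); rewrite /= ?oppr0 ?expr0z // exprN1.
Qed.

Lemma ultrametric_sum_le (R : realType) (F : fieldType) (v : F -> R) (c : R)
    (I : Type) (r : seq I) (f : I -> F) : absolute_value v ->
  (forall x y, v (x + y) <= Num.max (v x) (v y)) -> 0 <= c ->
  (forall i, v (f i) <= c) -> v (\sum_(i <- r) f i) <= c.
Proof.
move=> av vm c0 h; elim/big_ind: _ => //; first by rewrite av0.
by move=> x y hx hy; apply: le_trans (vm x y) _; rewrite ge_max hx.
Qed.

Definition valid_index (w : option nat) : bool := if w is Some p then prime p else true.

Lemma mem_place_index B w : w \in place_index B -> valid_index w.
Proof.
rewrite inE => /orP[/eqP -> //|/mapP[p]].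
by rewrite mem_filter => /andP[pp _] ->.
Qed.

Lemma mem_place_index_Some B p : prime p -> (Some p \in place_index B) = (p < B)%N.
Proof.
move=> pp; rewrite inE /= mem_map; last by move=> x y [].
by rewrite mem_filter pp mem_index_iota.
Qed.

Lemma place_index_uniq B : uniq (place_index B).
Proof.
rewrite /place_index cons_uniq map_inj_uniq ?filter_uniq ?iota_uniq ?andbT //.
  by apply/mapP => -[].
Qed.

Lemma rat_abs_lt1 (R : realType) w (p : nat) : prime p -> valid_index w ->
  (rat_abs R w p%:R < 1) = (w == Some p).
Proof.
move=> pp; case: w => [q|] /= vw; last first.
  by rewrite normr_nat ratr_nat ltrn1 ltnNge prime_gt0.
rewrite padic_abs_p //; have [->|qp] := eqVneq q p.
  by rewrite invf_lt1 ?ltr0n ?prime_gt0 // ltr1n prime_gt1 ?eqxx.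
by rewrite ltxx; apply/esym/eqP => -[] /eqP; rewrite (negPf qp).
Qed.

Section Places.
Variables (R : realType) (K : fieldExtType rat).
Local Notation d := (\dim {:K}).
Variables (alpha : K) (f : {poly rat}).
Hypothesis prim : primitive_with alpha f.
Variables (tauC : 'I_d -> {rmorphism K -> algC}) (tauI : 'I_d -> {rmorphism K -> R[i]}).
Hypothesis tauC_inj : injective (fun i => tauC i alpha).
Hypothesis tauI_inj : injective (fun i => tauI i alpha).
Variable up : nat -> algC -> R.
Hypothesis up_spec : forall p, prime p -> [/\ absolute_value (up p),
    forall x y, up p (x + y) <= Num.max (up p x) (up p y) &
    forall q : rat, up p (ratr q) = padic_abs R p q].

Let nrm (x : R[i]) : R := ComplexField.Normc.normc x.
Let nrm_av : absolute_value nrm := @normc_absolute_value R.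

Definition embedding_place (w : option nat) (i : 'I_d) : K -> R :=
  if w is Some p then up p \o tauC i else nrm \o tauI i.

Lemma embedding_place_av w i : valid_index w -> absolute_value (embedding_place w i).
Proof.
case: w => [p|] /= h; last exact: absolute_value_comp.
by have [? _ _] := up_spec h; exact: absolute_value_comp.
Qed.

Lemma embedding_place_in_alg w i q : valid_index w -> embedding_place w i q%:A = rat_abs R w q.
Proof.
case: w => [p|] /= h; rewrite rmorph_in_alg; last exact: normc_ratr.
by have [_ _ ->] := up_spec h.
Qed.

(** The restriction to the rationals determines the index: [p] has absolute value below 1 at
    [Some p] only. *)
Lemma embedding_place_inj w w' i j : valid_index w -> valid_index w' -> embedding_place w i = embedding_place w' j -> w = w'.
Proof.
move=> vw vw' e.
have eq q : rat_abs R w q = rat_abs R w' q by rewrite -(embedding_place_in_alg i) // e embedding_place_in_alg.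
case: w vw eq {e} => [p|] vw eq.
  have := rat_abs_lt1 R vw vw; rewrite eq rat_abs_lt1 // eqxx => /eqP ->.
  by rewrite /=.
case: w' vw' eq => // p vw' eq.
by have := rat_abs_lt1 R vw' vw'; rewrite -eq rat_abs_lt1 // eqxx.
Qed.

Lemma embedding_place_places w i : valid_index w -> places R K (embedding_place w i).
Proof.
move=> vw; have av := embedding_place_av i vw; have eq q := embedding_place_in_alg i q vw.
case: w vw av eq => [p|] vw av eq; [right; exists p => // | left];
by split=> // q; rewrite /restrictQ eq.
Qed.

Lemma up_invp_gt1 p : prime p -> 1 < up p (ratr p%:R^-1).
Proof.
move=> pp; have [aup _ uq] := up_spec pp.
rewrite fmorphV /= (avV aup) uq padic_abs_p // eqxx invrK.
by rewrite ltr1n prime_gt1.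
Qed.

Lemma places_embedding_place v : places R K v -> exists w i, valid_index w /\ v = embedding_place w i.
Proof.
case=> [[av eq]|[p pp [av eq]]].
  have [|q|i ->] := @place_embedding R K alpha f prim _ tauI tauI_inj nrm 2 nrm_av _ v av.
  - by rewrite /nrm normc_ratr normr_nat ratr_nat ltr1n.
  - by rewrite /nrm normc_ratr; exact: (eq q).
  by exists None, i.
have [aup _ uq] := up_spec pp.
have [|q|i ->] := @place_embedding R K alpha f prim _ tauC tauC_inj (up p) p%:R^-1 aup _ v av.
- exact: up_invp_gt1.
- by rewrite uq; exact: (eq q).
by exists (Some p), i.
Qed.

Lemma embedding_place_local_degree w i : valid_index w ->
  local_degree (embedding_place w i) = #|[set j | `[< embedding_place w j = embedding_place w i >]]%SET|.
Proof.
case: w => [p|] /= vw; last first.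
  apply: (@local_degree_embedding R K alpha f prim _ tauI tauI_inj nrm 2 nrm_av).
  by rewrite /nrm normc_ratr normr_nat ratr_nat ltr1n.
have [aup _ uq] := up_spec vw.
apply: (@local_degree_embedding R K alpha f prim _ tauC tauC_inj (up p) p%:R^-1 aup).
exact: up_invp_gt1.
Qed.

(** [q] is the constant coefficient of the characteristic polynomial, the norm of [x] up to sign;
    one rational number serves all places. *)
Lemma embedding_place_norm x : x != 0 -> exists2 q : rat, q != 0 &
  forall w, valid_index w -> \prod_(i < d) embedding_place w i x = rat_abs R w q.
Proof.
move=> x0; have [F hF] := ex_char_poly prim x.
have ev (L : numClosedFieldType) (tau : 'I_d -> {rmorphism K -> L}) :
    injective (fun i => tau i alpha) -> ratr F.[0] = \prod_(i < d) - tau i x.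
  move=> inj; rewrite -horner_map rmorph0 /= (hF _ tau inj) horner_prod.
  by apply: eq_bigr => i _; rewrite hornerXsubC sub0r.
exists F.[0].
  rewrite -(fmorph_eq0 (ratr : {rmorphism rat -> algC})) /= (ev _ tauC) //.
  by apply/prodf_neq0 => i _; rewrite oppr_eq0 fmorph_eq0.
case=> [p|] vw /=; last first.
  rewrite -normc_ratr (ev _ tauI) // -/(nrm _) (av_prod nrm_av); apply: eq_bigr => i _.
  by rewrite (avN nrm_av).
have [aup _ uq] := up_spec vw.
rewrite -uq (ev _ tauC) // (av_prod aup); apply: eq_bigr => i _.
by rewrite (avN aup).
Qed.

Lemma product_formula x : x != 0 -> exists B0, forall B, (B0 <= B)%N ->
  \sum_(w <- place_index B) \sum_(i < d) ln (embedding_place w i x) = 0.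
Proof.
move=> x0; have [q q0 hq] := embedding_place_norm x0.
have [B0 hB] := rat_product_formula R q0; exists B0 => B /hB h; rewrite -[RHS]h.
rewrite big_seq [RHS]big_seq; apply: eq_bigr => w /mem_place_index vw.
by rewrite -hq // ln_prod // => i _; apply: av_gt0 => //; exact: embedding_place_av.
Qed.

(** A root of a monic polynomial with [p]-integral coefficients is [p]-integral. The coefficients of
    the characteristic polynomial are so once [p] exceeds all their denominators, in particular
    their sum. *)
Lemma embedding_place_almost_le1 x : exists B0, forall p, prime p -> (B0 <= p)%N ->
  forall i, embedding_place (Some p) i x <= 1.
Proof.
have [F hF] := ex_char_poly prim x.
exists (\sum_(j < size F) `|denq F`_j|%N).+1 => p pp hp i.
have [aup um uq] := up_spec pp; set t := tauC i x.
have {}hF := hF _ tauC tauC_inj.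
have sF : size F = d.+1.
  by rewrite -(size_map_poly (ratr : {rmorphism rat -> algC})) hF size_prod_XsubC
     [size _](_ : _ = d) // /index_enum -enumT size_enum_ord.
have lF : F`_d = 1.
  apply: (fmorph_inj (ratr : {rmorphism rat -> algC})); rewrite rmorph1 -coef_map hF.
  have := lead_coef_prod_XsubC (index_enum 'I_d) xpredT (fun i => tauC i x).
  by rewrite /lead_coef -hF size_map_poly sF.
have coef1 j : up p (ratr F`_j) <= 1.
  have [js|js] := ltnP j (size F); last by rewrite nth_default // rmorph0 av0.
  rewrite uq /padic_abs; case: ifP => // _.
  have -> : logn p `|denq F`_j|%N = 0%N.
    apply: ltn_log0; apply: leq_trans hp; rewrite ltnS.
    by rewrite (bigD1 (Ordinal js)) //= leq_addr.
  rewrite add0r -invr_expz -exprnP invf_le1 ?exprn_gt0 ?ltr0n ?prime_gt0 //.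
  by rewrite exprn_ege1 // ler1n prime_gt0.
rewrite /= -/t leNgt; apply/negP => t1.
have d0 : (0 < d)%N by exact: adim_gt0.
have : t ^+ d = - \sum_(j < d) ratr F`_j * t ^+ j.
  have : (map_poly ratr F).[t] = 0.
    by rewrite hF horner_prod (bigD1 i) //= hornerXsubC subrr mul0r.
  rewrite horner_coef size_map_poly sF big_ord_recr /= coef_map lF /= rmorph1 mul1r.
  rewrite addrC => /eqP; rewrite addr_eq0 => /eqP ->; congr (- _).
  by apply: eq_bigr => j _; rewrite coef_map.
move/(congr1 (up p)); rewrite avX // avN // => e.
have : up p t ^+ d <= up p t ^+ d.-1.
  rewrite e; apply: ultrametric_sum_le => //; first by rewrite exprn_ge0 // av_ge0.
  move=> j; rewrite (avM aup) (avX aup) -[leRHS]mul1r ler_pM ?exprn_ge0 ?(av_ge0 aup) //.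
  by rewrite ler_weXn2l ?ltW // -ltnS prednK.
by rewrite leNgt ltr_eXn2l ?prednK ?leqnn.
Qed.

Lemma embedding_place_almost_one x : x != 0 -> exists B0, forall p, prime p -> (B0 <= p)%N ->
  forall i, embedding_place (Some p) i x = 1.
Proof.
move=> x0; have [B hB] := embedding_place_almost_le1 x; have [C hC] := embedding_place_almost_le1 x^-1.
exists (maxn B C) => p pp; rewrite geq_max => /andP[h1 h2] i.
apply/eqP; rewrite eq_le hB //=; have av : absolute_value (embedding_place (Some p) i) by exact: embedding_place_av.
have := hC p pp h2 i; rewrite avV // invf_le1 //; exact: av_gt0.
Qed.

Lemma max_norm_almost_one (F : {poly K}) : F != 0 -> exists B0, forall p, prime p ->
  (B0 <= p)%N -> forall i, max_norm (embedding_place (Some p) i) F = 1.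
Proof.
move=> F0.
have /choice[b hb] : forall j : nat, exists B0, F`_j != 0 -> forall p, prime p ->
    (B0 <= p)%N -> forall i, embedding_place (Some p) i F`_j = 1.
  move=> j; have [->|/embedding_place_almost_one[B0 h]] := eqVneq F`_j 0; first by exists 0%N.
  by exists B0.
exists (\sum_(j < size F) b j)%N => p pp hp i.
have av : absolute_value (embedding_place (Some p) i) by exact: embedding_place_av.
have one j : F`_j != 0 -> embedding_place (Some p) i F`_j = 1.
  move=> Fj; apply: hb => //; apply: leq_trans hp.
  have js : (j < size F)%N by rewrite ltnNge; apply: contra Fj => h; rewrite nth_default.
  by rewrite (bigD1 (Ordinal js)) //= leq_addr.
apply/eqP; rewrite eq_le; apply/andP; split.
  apply: max_norm_le => // j.
  by have [->|/one ->//] := eqVneq F`_j 0; rewrite av0.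
have lc : F`_(size F).-1 != 0 by rewrite -/(lead_coef F) lead_coef_eq0.
by rewrite -(one _ lc); exact: coef_le_max_norm.
Qed.

(** Among the maps [embedding_place w i] a place occurs as often as its local degree indicates, so
    the exponents in the height become multiplicities. *)
Lemma ln_height (F : {poly K}) : F != 0 -> exists B0, forall B, (B0 <= B)%N ->
  ln (height R F) = d%:R^-1 *
    \sum_(w <- place_index B) \sum_(i < d) ln (max_norm (embedding_place w i) F).
Proof.
move=> F0; have [B0 hB0] := max_norm_almost_one F0; exists B0 => B hB.
pose rr : seq (K -> R) := [seq embedding_place w i | w <- place_index B, i <- enum 'I_d].
have rrP v : v \in rr -> exists w i, [/\ w \in place_index B, valid_index w & v = embedding_place w i].
  move=> /allpairsP[[w i] [hw _ ->]]; exists w, i; split=> //.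
  exact: mem_place_index hw.
have npos v : v \in rr -> 0 < max_norm v F.
  by move=> /rrP[w [i [_ vw ->]]]; apply: max_norm_gt0 => //; exact: embedding_place_av.
have cnt v : v \in rr -> count_mem v rr = local_degree v.
  move=> /rrP[w [i [hw vw ->]]]; rewrite embedding_place_local_degree //.
  rewrite -sum1_count big_mkcond /rr big_allpairs_dep /=.
  rewrite (bigD1_seq w) ?place_index_uniq //= [X in (_ + X)%N]big1_seq ?addn0; last first.
    move=> w' /andP[ww hw']; apply: big1 => j _; case: eqP => // e.
    by move/eqP: ww; case; exact: (embedding_place_inj (mem_place_index hw') vw e).
  rewrite -sum1_card [RHS]big_mkcond big_enum /=; apply: eq_bigr => j _; rewrite inE.
  by case: eqP => [e|ne]; case: asboolP.
have -> : height R F = \prod_(v <- undup rr)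
    max_norm v F `^ ((local_degree v)%:R / d%:R).
  pose g (v : K -> R) : R := poly_norm v F `^ ((local_degree v)%:R / d%:R).
  have sub : [set` undup rr] `<=` places R K.
    by move=> v /=; rewrite mem_undup => /rrP[w [i [_ vw ->]]]; exact: embedding_place_places.
  (* A place outside the list lies above a prime [p >= B], where the norm of [F] is 1. *)
  have out : places R K `\` [set` undup rr] `<=` g @^-1` [set 1].
    move=> v [/places_embedding_place[w [i [vw e]]] nin] /=.
    case: w vw e => [p|] vw e; last first.
      exfalso; apply: nin; rewrite /= mem_undup; apply/allpairsP.
      by exists (None, i); split; rewrite ?mem_head ?mem_enum.
    have Bp : (B <= p)%N.
      rewrite leqNgt; apply/negP => pB; apply: nin; rewrite /= mem_undup.
      by apply/allpairsP; exists (Some p, i); rewrite mem_place_index_Some // mem_enum.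
    have := hB0 p vw (leq_trans hB Bp) i; rewrite -e => h.
    by rewrite /g (_ : poly_norm v F = 1) // powR1.
  have e : \big[*%R/1]_(v \in [set` undup rr]) g v = \big[*%R/1]_(v \in places R K) g v.
    exact: fsbig_widen.
  rewrite -[height R F]/(\big[*%R/1]_(v \in places R K) g v) -[LHS]e.
  by rewrite -fsbig_seq ?undup_uniq.
rewrite ln_prod; last first.
  by move=> v; rewrite mem_undup => /npos h; rewrite powR_gt0.
rewrite big_seq (eq_bigr (fun v => (count_mem v rr)%:R * (d%:R^-1 * ln (max_norm v F)))).
  rewrite -big_seq -(sum_undup rr (fun v => d%:R^-1 * ln (max_norm v F))).
  rewrite -mulr_sumr /rr big_allpairs_dep; congr (_ * _); apply: eq_bigr => w _.
  by rewrite big_enum.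
by move=> v; rewrite mem_undup => /cnt ->; rewrite ln_powR mulrA.
Qed.

Lemma ln_heightZ (c : K) (F : {poly K}) : c != 0 -> F != 0 ->
  ln (height R (c *: F)) = ln (height R F).
Proof.
move=> c0 F0; have cF0 : c *: F != 0 by rewrite scaler_eq0 negb_or c0.
have [B1 h1] := ln_height cF0; have [B2 h2] := ln_height F0.
have [B3 h3] := product_formula c0.
pose B := maxn B1 (maxn B2 B3).
rewrite (h1 B) ?leq_maxl // (h2 B); last by rewrite leq_max leq_max leqnn orbT.
have {}h3 : \sum_(w <- place_index B) \sum_(i < d) ln (embedding_place w i c) = 0.
  by apply: h3; rewrite !leq_max leqnn !orbT.
congr (_ * _); rewrite -[RHS]addr0 -[X in _ = _ + X]h3 -big_split /= big_seq [RHS]big_seq.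
apply: eq_bigr => w /mem_place_index vw; rewrite -big_split /=; apply: eq_bigr => i _.
have av := embedding_place_av i vw.
have c1 := av_gt0 av c0; have F1 := max_norm_gt0 av F0.
by rewrite (max_normZ av) addrC lnM.
Qed.

Lemma ln_height_ge0 (F : {poly K}) : F \is monic -> 0 <= ln (height R F).
Proof.
move=> mF; have [B h] := ln_height (monic_neq0 mF); rewrite (h B) //.
rewrite mulr_ge0 ?invr_ge0 ?ler0n // big_seq sumr_ge0 // => w /mem_place_index vw.
apply: sumr_ge0 => i _; rewrite ln_ge0 // max_norm_monic_ge1 //; exact: embedding_place_av.
Qed.

Lemma max_norm_comp (L : fieldType) (u : L -> R) (tau : {rmorphism K -> L}) (F : {poly K}) :
  max_norm (u \o tau) F = max_norm u (map_poly tau F).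
Proof.
rewrite /max_norm size_map_poly; apply: eq_bigr => i _.
by rewrite /= coef_map.
Qed.

Section Main.
Variables (k : nat) (p : 'I_k -> nat).
Hypothesis p_prime : forall i, prime (p i).
Hypothesis p_inj : injective p.
Variables (P Q : {poly K}) (l M : nat).
Hypothesis P_monic : P \is monic.
Hypothesis Q_monic : Q \is monic.
Hypothesis P_nt : no_root_0_or_unity P.
Hypothesis QP : forall i, Q %| P \Po 'X^(p i).
Hypothesis l2 : (2 <= l)%N.
Hypothesis k0 : (0 < k)%N.
Hypothesis P_deg : (deg P * (2 ^ l.+1 * (l.+1)`!) <= 'C(k, l.+2))%N.
Hypothesis pM : forall i, M%:R / 2 <= (p i)%:R :> R.
Hypothesis M0 : (0 < M)%N.

(** Only the [d] archimedean indices have [kappa = 2], so after division by [d] each term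
    [deg * ln 2] occurs once. *)
Lemma ln_height_gcd :
  ln (height R Q) <= (deg Q)%:R * ln 2 + 8 * l.+1%:R / (k%:R * M%:R) *
    ((deg P)%:R * ln 2 + ln (height R P)).
Proof.
set C := 8 * l.+1%:R / (k%:R * M%:R); pose kap (w : option nat) : R := if w is None then 2 else 1.
have loc w i : valid_index w -> ln (max_norm (embedding_place w i) Q) <= (deg Q)%:R * ln (kap w) +
    C * ((deg P)%:R * ln (kap w) + ln (max_norm (embedding_place w i) P)).
  case: w => [q|] vw; rewrite /embedding_place !max_norm_comp.
    have [aup um _] := up_spec vw.
    apply: (@local_height_bound R K algC (tauC i) k p p_prime p_inj P Q l M P_monic
      Q_monic P_nt QP l2 k0 P_deg pM M0 (up q) 1 aup (lexx 1)).
    by move=> x y; rewrite mul1r; exact: um.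
  apply: (@local_height_bound R K R[i] (tauI i) k p p_prime p_inj P Q l M P_monic
      Q_monic P_nt QP l2 k0 P_deg pM M0 nrm 2 nrm_av); first by rewrite ler1n.
  move=> x y; apply: le_trans (av_leD nrm_av x y) _; rewrite mulrDl mul1r.
  by rewrite lerD // le_max lexx ?orbT.
have [B1 h1] := ln_height (monic_neq0 Q_monic); have [B2 h2] := ln_height (monic_neq0 P_monic).
pose B := maxn B1 B2; rewrite (h1 B) ?leq_maxl // (h2 B) ?leq_maxr //.
have d0 : 0 < (d%:R : R) by rewrite ltr0n adim_gt0.
rewrite ler_pdivrMl //.
pose E : R := (deg Q)%:R * ln 2 + C * ((deg P)%:R * ln 2).
apply: (@le_trans _ _ (\sum_(w <- place_index B) \sum_(i < d)
    ((if w is None then E else 0) + C * ln (max_norm (embedding_place w i) P)))).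
  rewrite big_seq [leRHS]big_seq; apply: ler_sum => w /mem_place_index vw.
  apply: ler_sum => i _; apply: le_trans (loc w i vw) _; rewrite /kap /E.
  by case: (w) => [q|]; rewrite ?ln1 ?mulr0 ?add0r // mulrDr addrA.
rewrite (eq_bigr (fun w => (if w is None then d%:R * E else 0) +
    C * \sum_(i < d) ln (max_norm (embedding_place w i) P))); last first.
  move=> w _; rewrite big_split /= -mulr_sumr; congr (_ + _).
  by case: w => [q|]; rewrite sumr_const card_ord ?mul0rn // mulr_natl.
rewrite big_split /= -mulr_sumr /place_index big_cons big_map big1 ?addr0 //.
rewrite /E; set S := \sum_(_ <- _) _.
have dn : (d%:R : R) != 0 by rewrite gt_eqF.
rewrite le_eqVlt; apply/orP; left; apply/eqP; rewrite !mulrDr.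
rewrite [d%:R * (C * (d%:R^-1 * S))]mulrCA mulVKf // addrA.
by congr (_ + _); ring.
Qed.

End Main.
End Places.

Lemma ex_places (R : realType) (K : fieldExtType rat) : exists
  (alpha : K) (f : {poly rat})
  (tauC : 'I_(\dim {:K}) -> {rmorphism K -> algC})
  (tauI : 'I_(\dim {:K}) -> {rmorphism K -> R[i]}) (up : nat -> algC -> R),
  [/\ primitive_with alpha f, injective (fun i => tauC i alpha),
      injective (fun i => tauI i alpha) &
      forall p, prime p -> [/\ absolute_value (up p),
        forall x y, up p (x + y) <= Num.max (up p x) (up p y) &
        forall q : rat, up p (ratr q) = padic_abs R p q]].
Proof.
have [alpha [f prim]] := ex_primitive K.
have [tauC injC] := ex_embeddings prim algC.
have [tauI injI] := ex_embeddings prim (R[i] : numClosedFieldType).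
have /choice[up hup] : forall p, exists u : algC -> R, prime p -> [/\ absolute_value u,
    forall x y, u (x + y) <= Num.max (u x) (u y) &
    forall q : rat, u (ratr q) = padic_abs R p q].
  move=> p; have [pp|pp] := boolP (prime p); last by exists (fun _ => 0).
  by have [u hu] := ex_padic_absolute_value R pp; exists u.
by exists alpha, f, tauC, tauI, up.
Qed.

Local Close Scope classical_set_scope.

(** * Reduction to monic polynomials and the final constants *)

Lemma comp_poly_Xn_neq0 (K : fieldType) (P : {poly K}) (a : nat) :
  (0 < a)%N -> P != 0 -> P \Po 'X^a != 0.
Proof.
by move=> a0 P0; rewrite comp_poly_eq0 // size_polyXn ltnS.
Qed.

Lemma no_rootZ (K : fieldType) (P : {poly K}) (c : K) : c != 0 ->
  no_root_0_or_unity P -> no_root_0_or_unity (c *: P).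
Proof.
move=> c0 hP L z; rewrite map_polyZ rootZ; first exact: hP.
by rewrite fmorph_eq0.
Qed.

Theorem theorem7p1 (R : realType) (K : fieldExtType rat) (M n : nat)
    (A : {fset nat}) (P Q : {poly K}) (l : nat)
    (hM : (2 <= M)%N) (hn : (0 < n)%N)
    (hA0 : A != fset0)
    (hA : forall p : nat, p \in A ->
       prime p /\ M%:R / 2 <= p%:R :> R /\ (p <= M)%N)
    (hP0 : P != 0) (hPn : (deg P <= n)%N)
    (hP : no_root_0_or_unity P)
    (hQ : is_gcd A (fun a : nat => P \Po 'X^a) Q)
    (hl : (4 <= 2 * l <= #|` A|)%N)
    (hnl : n%:R <= 1 / (2 ^+ l.+1 * (l.+1)`!%:R) * 'C(#|` A|, l.+2)%:R :> R) :
  (deg Q)%:R <= 6 * l%:R / #|` A|%:R * (deg P)%:R :> R /\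
  ln (height R Q) <=
    (l%:R * 2 ^+ (2 * l + 6)) / (#|` A|%:R * M%:R) *
      (M%:R * (deg P)%:R + ln (height R P)).
Proof.
set k := #|` A| in hl hnl *; case/andP: hl => l4 lk.
have l2 : (2 <= l)%N by lia.
have k0 : (0 < k)%N by lia.
have M0 : (0 < M)%N by lia.
pose p (i : 'I_k) : nat := nth 0%N (enum_fset A) i.
have pA i : p i \in A by exact: mem_nth.
have p_prime i : prime (p i) by case: (hA _ (pA i)).
have pM i : M%:R / 2 <= (p i)%:R :> R by case: (hA _ (pA i)) => _ [].
have p_inj : injective p.
  move=> i j /eqP; rewrite nth_uniq ?fset_uniq //.
  by move=> /eqP/val_inj.
case: hQ => QP _; pose i0 : 'I_k := Ordinal k0.
have Q0 : Q != 0.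
  have := QP _ (pA i0); apply: contraTneq => ->; rewrite dvd0p.
  exact: comp_poly_Xn_neq0 (prime_gt0 (p_prime i0)) hP0.
have lP : lead_coef P != 0 by rewrite lead_coef_eq0.
have lQ : lead_coef Q != 0 by rewrite lead_coef_eq0.
(* Monic polynomials are products over their root lists; degrees and, by the product formula,
   heights do not change. *)
pose P' := (lead_coef P)^-1 *: P; pose Q' := (lead_coef Q)^-1 *: Q.
have mP : P' \is monic by rewrite monicE lead_coefZ mulVf.
have mQ : Q' \is monic by rewrite monicE lead_coefZ mulVf.
have dP : deg P' = deg P by rewrite /deg size_scale // invr_eq0.
have dQ : deg Q' = deg Q by rewrite /deg size_scale // invr_eq0.
have ntP : no_root_0_or_unity P' by apply: no_rootZ; rewrite ?invr_eq0.
have QP' i : Q' %| P' \Po 'X^(p i).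
  by rewrite comp_polyZ dvdpZl ?dvdpZr ?invr_eq0 // QP.
have degP : (deg P' * (2 ^ l.+1 * (l.+1)`!) <= 'C(k, l.+2))%N.
  rewrite dP (leq_trans (leq_mul hPn (leqnn _))) // -(ler_nat R) (natrM _ n) (natrM _ (2 ^ _)) natrX.
  have X0 : 0 < 2 ^+ l.+1 * (l.+1)`!%:R :> R by rewrite mulr_gt0 ?exprn_gt0 ?ltr0n ?fact_gt0.
  by move: hnl; rewrite mul1r ler_pdivlMl // mulrC.
have [alpha [f [tauC [tauI [up [prim injC injI upP]]]]]] := ex_places R K.
have kR : 0 < k%:R :> R by rewrite ltr0n.
have MR : 2 <= M%:R :> R by rewrite ler_nat.
have lR : 2 <= l%:R :> R by rewrite ler_nat.
have hdeg : k%:R * (deg Q)%:R <= 4 * l.+1%:R * (deg P)%:R :> R.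
  by rewrite -dP -dQ; exact: (@degree_bound R K algC (tauC (Ordinal (adim_gt0 {:K}%AS)))
    k p p_prime p_inj P' Q' l mP mQ ntP QP' l2 k0 degP).
have dP0 : 0 <= (deg P)%:R :> R by rewrite ler0n.
split.
  rewrite mulrAC ler_pdivlMr // mulrC; apply: le_trans hdeg _; rewrite ler_wpM2r //.
  (* [4 * (l + 1) <= 6 * l], as [l >= 2]. *)
  by rewrite -natr1; lra.
have hgcd := ln_height_gcd prim injC injI upP p_prime p_inj mP mQ ntP QP' l2 k0 degP pM M0.
have lP' : (lead_coef P)^-1 != 0 by rewrite invr_eq0.
have lQ' : (lead_coef Q)^-1 != 0 by rewrite invr_eq0.
have eP : ln (height R P') = ln (height R P).
  exact: (ln_heightZ prim injC injI upP lP' hP0).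
have eQ : ln (height R Q') = ln (height R Q).
  exact: (ln_heightZ prim injC injI upP lQ' Q0).
have hP1 : 0 <= ln (height R P).
  by rewrite -eP; exact: (ln_height_ge0 prim injC injI upP mP).
move: hgcd; rewrite dP dQ eP eQ.
set hp := ln (height R P) in hP1 *; move=> h; apply: le_trans h _.
have ln2 : ln 2 <= 1 :> R.
  by rewrite -[leRHS](expRK 1) ler_ln ?posrE ?expR_gt0 // (le_trans _ (expR_ge1Dx 1)).
have ln20 : 0 <= ln 2 :> R by rewrite ln_ge0 // ler1n.
have kM : 0 < k%:R * M%:R :> R by rewrite mulr_gt0 // (lt_le_trans _ MR).
rewrite [leRHS]mulrAC ler_pdivlMr // mulrDl [8 * _ / _ * _]mulrAC mulfVK ?gt_eqF //.
have pow : 64 <= 2 ^+ (2 * l + 6) :> R.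
  rewrite (_ : 64 = 2 ^+ 6); first by rewrite ler_weXn2l ?ler1n // leq_addl.
  by rewrite -natrX.
have e1 : l.+1%:R = l%:R + 1 :> R by rewrite -natr1.
rewrite e1 in hdeg *.
have b1 : (deg Q)%:R * ln 2 * (k%:R * M%:R) <= 4 * (l%:R + 1) * (M%:R * (deg P)%:R) :> R.
  have q0 : 0 <= M%:R * (k%:R * (deg Q)%:R) :> R by rewrite !mulr_ge0.
  apply: (@le_trans _ _ (M%:R * (k%:R * (deg Q)%:R))).
    rewrite (_ : _ * ln 2 * _ = M%:R * (k%:R * (deg Q)%:R) * ln 2); last by ring.
    by rewrite ler_piMr.
  rewrite (_ : 4 * _ * _ = M%:R * (4 * (l%:R + 1) * (deg P)%:R)); last by ring.
  by rewrite ler_wpM2l.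
have b2 : (deg P)%:R * ln 2 <= M%:R * (deg P)%:R :> R.
  by rewrite mulrC ler_wpM2r // (le_trans ln2) // (le_trans _ MR) // ler1n.
have MP0 : 0 <= M%:R * (deg P)%:R :> R by rewrite mulr_ge0.
(* By [b1] and [b2] the left side is at most [12 * (l + 1)] times the bracket, and
   [12 * (l + 1) <= 18 * l <= 64 * l], while [64 <= 2^(2 * l + 6)]. *)
apply: (@le_trans _ _ (64 * l%:R * (M%:R * (deg P)%:R + hp))); last first.
  by rewrite ler_wpM2r ?addr_ge0 // mulrC ler_wpM2l.
nra.
Qed.
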